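(* Let $d$ be a positive integer and let $\xi$ be a discrete random vector in $\mathbb{R}^d$ with distribution function $$F(x)=\sum_{k\in\mathbb{N}:\ x_k\in(-\infty,x]} p_{x_k},\qquad x\in\mathbb{R}^d,$$ where $x_k\in\mathbb{R}^d$, $k\in\mathbb{N}$, are distinct, $p_{x_k}\geqslant 0$ for all $k\in\mathbb{N}$, and $\sum_{k=1}^\infty p_{x_k}=1$. For $c\in\mathbb{R}^d$ let $F_c$ denote the distribution function of the random variable $\langle c,\xi\rangle$. Then: (1) $F$ is infinitely divisible if and only if $F_c$ is infinitely divisible for every $c\in\mathbb{R}^d$; (2) $F$ is quasi-infinitely divisible if and only if $F_c$ is quasi-infinitely divisible for every $c\in\mathbb{R}^d$.
   Context: $\mathbb{N}$ is the set of positive integers; $\langle\cdot,\cdot\rangle$ is the standard scalar product on $\mathbb{R}^d$. For $x=(x^{(1)},\ldots,x^{(d)})\in\mathbb{R}^d$, $(-\infty,x]=(-\infty,x^{(1)}]\times\cdots\times(-\infty,x^{(d)}]$. For any positive integer $m$ (here used with $m=d$ for $F$ and $m=1$ for $F_c$): a distribution function $G$ on $\mathbb{R}^m$ is infinitely divisible if for every positive integer $n$ there is a distribution function $G_n$ on $\mathbb{R}^m$ with $G=G_n^{*n}$ ($n$-fold convolution power). A distribution function $G$ on $\mathbb{R}^m$ is quasi-infinitely divisible if there exist infinitely divisible distribution functions $G_1,G_2$ on $\mathbb{R}^m$ such that $G_1=G*G_2$, where $*$ is convolution. *)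

(* Defs.v *)
From HB Require Import structures.
From mathcomp Require Import all_boot all_order all_algebra.
From mathcomp Require Import all_classical all_reals all_analysis.

Set Implicit Arguments.
Unset Strict Implicit.
Unset Printing Implicit Defensive.

Import Order.TTheory GRing.Theory Num.Theory.
Import numFieldNormedType.Exports.

Local Open Scope classical_set_scope.
Local Open Scope ring_scope.

(* Row vectors carry the product sigma-algebra, generated by the coordinate
   maps, like n.-tuple T in the library; over the reals it is the Borel
   sigma-algebra of R^n. *)
Definition measure_row_display : measure_display -> measure_display.
Proof. exact. Qed.

Section measurable_row.
Context {d} {T : sigmaRingType d}.
Variable n : nat.

Let coors : 'I_n -> 'rV[T]_n -> T := fun i v => v ord0 i.

Let row_set0 : g_sigma_preimage coors set0.
Proof. exact: sigma_algebra0. Qed.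

Let row_setC A : g_sigma_preimage coors A -> g_sigma_preimage coors (~` A).
Proof. exact: sigma_algebraC. Qed.

Let row_bigcup (F : _^nat) : (forall i, g_sigma_preimage coors (F i)) ->
  g_sigma_preimage coors (\bigcup_i (F i)).
Proof. exact: sigma_algebra_bigcup. Qed.

HB.instance Definition _ := @isMeasurable.Build (measure_row_display d)
  'rV[T]_n (g_sigma_preimage coors) row_set0 row_setC row_bigcup.

End measurable_row.

Section distribution_functions.
Context {R : realType} {m : nat}.
Implicit Types (mu : probability 'rV[R]_m R) (G H : 'rV[R]_m -> \bar R).

Definition orthant (x : 'rV[R]_m) : set 'rV[R]_m :=
  [set y | forall i, y ord0 i <= x ord0 i].

(* Distribution functions take values in \bar R, as the library's cdf does. *)
Definition df (mu : set 'rV[R]_m -> \bar R) : 'rV[R]_m -> \bar R :=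
  fun x => mu (orthant x).

Definition is_df G := exists mu, G = df mu.

(* The probability measure with distribution function G; a junk value if G is
   not a distribution function. *)
Definition df_measure G : probability 'rV[R]_m R :=
  get [set mu : probability 'rV[R]_m R | G = df mu].

Definition df_conv G H : 'rV[R]_m -> \bar R :=
  fun x => (\int[df_measure H]_y G (x - y)%R)%E.

(* The 0-th power, never used below, is the distribution function of the point
   mass at 0. *)
Definition df_convX G n : 'rV[R]_m -> \bar R :=
  iterop n df_conv G (df (dirac (0 : 'rV[R]_m))).

Definition infinitely_divisible G :=
  is_df G /\
  forall n, (0 < n)%N -> exists Gn, is_df Gn /\ G = df_convX Gn n.

Definition quasi_infinitely_divisible G :=
  is_df G /\
  exists G1 G2, [/\ infinitely_divisible G1, infinitely_divisible G2
                  & G1 = df_conv G G2].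

End distribution_functions.

(* The scalar product as a vector of R^1, so that one notion of distribution
   function serves both for xi and for <c, xi>. *)
Definition dotv {R : realType} {d : nat} (c x : 'rV[R]_d) : 'rV[R]_1 :=
  const_mx (\sum_(i < d) c ord0 i * x ord0 i).

(* Main.v *)
Require Import Defs.
From HB Require Import structures.
From mathcomp Require Import all_boot all_order all_algebra.
From mathcomp Require Import all_classical all_reals all_analysis.
From mathcomp Require Import measurable_realfun.
From mathcomp.real_closed Require Import complex.
From mathcomp Require Import ring lra.
Set Implicit Arguments. Unset Strict Implicit. Unset Printing Implicit Defensive.
Import Order.TTheory GRing.Theory Num.Theory.
Import numFieldNormedType.Exports.
Local Open Scope classical_set_scope.
Local Open Scope ring_scope.
Local Open Scope complex_scope.

(* Let L be the rational span of the points x k. A generic vector c makes <c, .>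
   injective on L, and this single c suffices for both converse implications.

   (1) A convolution root of the law of <c, xi> is carried by a countable set;
   if z is one of its atoms then n z belongs to <c, L>, hence so does z, because
   L is divisible. The root therefore lifts to L.

   (2) If the characteristic function f of <c, xi> is a quotient of infinitely
   divisible ones, the second differences of ln |f|^2 with step s are bounded
   uniformly in t. As f is almost periodic, finitely many steps s bring every t
   close to a period, where |f| >= 1/2; hence |f| is bounded away from 0, and the
   family F of the atoms is invertible in the convolution ring l^1(L) (Wiener).
   Let T_t multiply F by exp(i t <c, .>). The logarithm of T_t F / F exists for t
   near a period of F and equals (exp(i t <c, .>) - 1) lam for some function lam
   independent of t. A bound uniform in t, averaged over t, puts lam in l^1(L).
   Then F exp(-lam) is an eigenvector of T_1, that is, a point mass, and the
   positive and negative parts of the real function lam exhibit F as a shifted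
   quotient of two compound Poisson laws. *)

(** * Unconditional sums *)

(** Laws are compared through their atoms in [l1 R V], with [V] the rational span. Characteristic
    functions enter only through their squared modulus [chf2], which is multiplicative under
    convolution and is the real characteristic function of a symmetrized law, so that logarithms and
    second differences stay real. The obstacle in (2) is that a logarithm of f along the real line
    has no evident coefficients in l^1(L). Logarithms are therefore taken inside the ring, only of
    quotients T_t F / F close to 1, where a small logarithm is unique. These give the differences
    T_t lam - lam, from which lam is rebuilt coordinate by coordinate; its summability is the real
    issue. Wiener's lemma and the averages sample integer times only, so the functional <c, .> must
    be rescaled until exp(i r <c, .>) separates the points of L. This is done twice: once for
    Wiener's lemma, and again, with a smaller scale depending on the inverse of F, to make T_1 F
    close to F. Divisibility of L also serves (2): the shift is divided by every n inside L. *)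

Definition esumT {R : realType} {I : choiceType} (u : I -> R) : \bar R :=
  \esum_(i in [set: I]) (u i)%:E.

Definition rsummable {R : realType} {I : choiceType} (u : I -> R) : Prop :=
  (esumT (fun i => `|u i|%R) < +oo)%E.

(** The value is meaningful for summable families only, since [fine] sends an infinite sum to 0. The
    lock keeps simplification from exposing the two parts. *)
HB.lock
Definition rsum {R : realType} {I : choiceType} (u : I -> R) : R :=
  fine (esumT (fun i => Num.max (u i) 0)) -
  fine (esumT (fun i => Num.max (- u i) 0)).

Section rsum.
Context {R : realType}.

Section one_index.
Context {I : choiceType}.
Implicit Types u v f g : I -> R.

Lemma esumT_ge0 u : (forall i, 0 <= u i) -> (0 <= esumT u)%E.
Proof. by move=> u0; apply: esum_ge0 => i _; rewrite lee_fin. Qed.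

Lemma le_esumT u v : (forall i, u i <= v i) -> (esumT u <= esumT v)%E.
Proof. by move=> uv; apply: le_esum => i _; rewrite lee_fin. Qed.

Lemma eq_esumT u v : u =1 v -> esumT u = esumT v.
Proof. by move=> uv; apply: eq_esum => i _; rewrite uv. Qed.

Lemma esumTD u v : (forall i, 0 <= u i) -> (forall i, 0 <= v i) ->
  esumT (fun i => u i + v i) = (esumT u + esumT v)%E.
Proof.
move=> u0 v0; rewrite /esumT -esumD; first by apply: eq_esum => i _; rewrite EFinD.
all: by move=> i _; rewrite lee_fin.
Qed.

Lemma esumTZ_le c u : 0 <= c -> (forall i, 0 <= u i) ->
  (esumT (fun i => (c * u i)%R) <= c%:E * esumT u)%E.
Proof.
move=> c0 u0; apply: ge_ereal_sup => _ [X [finX _] <-].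
rewrite (eq_fsbigr (fun i => c%:E * (u i)%:E)%E); last first.
  by move=> i _; rewrite EFinM.
rewrite -ge0_mule_fsumr; last by move=> i; rewrite lee_fin.
apply: lee_wpmul2l; first by rewrite lee_fin.
by apply: ereal_sup_ubound; exists X.
Qed.

Lemma rsummable_le u v : (forall i, `|u i| <= v i) -> (esumT v < +oo)%E ->
  rsummable u.
Proof. by move=> uv; apply: le_lt_trans; exact: le_esumT. Qed.

Lemma rsummableW u v : rsummable v -> (forall i, `|u i| <= `|v i|) -> rsummable u.
Proof. by move=> sv uv; exact: rsummable_le sv. Qed.

Lemma rsummable_ge0 u : (forall i, 0 <= u i) ->
  rsummable u <-> (esumT u < +oo)%E.
Proof.
by move=> u0; rewrite /rsummable (@eq_esumT _ u)// => i; rewrite ger0_norm.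
Qed.

Lemma rsummableD u v : rsummable u -> rsummable v ->
  rsummable (fun i => u i + v i).
Proof.
move=> su sv.
apply: (@rsummable_le _ (fun i => `|u i| + `|v i|)); first by move=> i; exact: ler_normD.
by rewrite esumTD//; exact: lte_add_pinfty.
Qed.

Lemma rsummableZ c u : rsummable u -> rsummable (fun i => c * u i).
Proof.
move=> su; apply: (@rsummable_le _ (fun i => `|c| * `|u i|)).
  by move=> i; rewrite normrM.
apply: le_lt_trans (esumTZ_le _ _) _ => //.
by rewrite lte_mul_pinfty// lee_fin.
Qed.

Lemma rsummableN u : rsummable u -> rsummable (fun i => - u i).
Proof. by move=> su; apply: rsummableW su _ => i; rewrite normrN. Qed.

Lemma rsummable_norm u : rsummable u -> rsummable (fun i => `|u i|).
Proof. by move=> su; apply: rsummableW su _ => i; rewrite normr_id. Qed.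

Lemma rsummable0 : rsummable (fun _ : I => 0 : R).
Proof. by rewrite /rsummable /esumT esum1// => i _; rewrite normr0. Qed.

(** The sum may be computed from any decomposition into nonnegative summable families, not only from
    the positive and negative parts; linearity rests on this freedom. *)
Lemma rsum_subE f g : (forall i, 0 <= f i) -> (forall i, 0 <= g i) ->
  rsummable f -> rsummable g ->
  rsum (fun i => f i - g i) = fine (esumT f) - fine (esumT g).
Proof.
move=> f0 g0 sf sg; rewrite unlock.
set p := fun i => Num.max (f i - g i) 0.
set n := fun i => Num.max (- (f i - g i)) 0.
have p0 i : 0 <= p i by rewrite /p le_max lexx orbT.
have n0 i : 0 <= n i by rewrite /n le_max lexx orbT.
have pf i : `|p i| <= f i.
  by rewrite ger0_norm// /p ge_max f0 lerBlDr lerDl g0.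
have ng i : `|n i| <= g i.
  by rewrite ger0_norm// /n ge_max g0 opprB lerBlDr lerDl f0.
have fi u : (forall i, 0 <= u i) -> rsummable u -> esumT u \is a fin_num.
  by move=> u0 /(rsummable_ge0 u0); rewrite ge0_fin_numE// esumT_ge0.
have sp : rsummable p by apply: rsummable_le pf ((rsummable_ge0 f0).1 sf).
have sn : rsummable n by apply: rsummable_le ng ((rsummable_ge0 g0).1 sg).
(* Both [p + g] and [n + f] are pointwise the maximum of [f] and [g]. *)
have : (esumT p + esumT g = esumT n + esumT f)%E.
  rewrite -!esumTD//; apply: eq_esumT => i; rewrite /p /n.
  case: (leP (f i) (g i)) => fg.
    have -> : Num.max (f i - g i) 0 = 0 by apply/max_idPr; lra.
    have -> : Num.max (- (f i - g i)) 0 = - (f i - g i) by apply/max_idPl; lra.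
    by rewrite add0r; lra.
  have -> : Num.max (f i - g i) 0 = f i - g i by apply/max_idPl; lra.
  have -> : Num.max (- (f i - g i)) 0 = 0 by apply/max_idPr; lra.
  by lra.
rewrite -(fineK (fi _ p0 sp)) -(fineK (fi _ n0 sn)) -(fineK (fi _ f0 sf)).
rewrite -(fineK (fi _ g0 sg)) -!EFinD => -[]; lra.
Qed.

Lemma rsum_ge0E u : (forall i, 0 <= u i) -> rsummable u ->
  (rsum u)%:E = esumT u.
Proof.
move=> u0 su; have := @rsum_subE u (fun=> 0) u0 (fun=> lexx _) su rsummable0.
have -> : (fun i => u i - 0) = u by apply/funext => i; rewrite subr0.
move=> ->; have -> : esumT (fun _ : I => 0 : R) = 0%E.
  by rewrite /esumT esum1.
by rewrite subr0 fineK// ge0_fin_numE ?esumT_ge0//; exact: (rsummable_ge0 u0).1.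
Qed.

Lemma rsum_sub f g : (forall i, 0 <= f i) -> (forall i, 0 <= g i) ->
  rsummable f -> rsummable g ->
  rsum (fun i => f i - g i) = rsum f - rsum g.
Proof. by move=> f0 g0 sf sg; rewrite rsum_subE// -!rsum_ge0E. Qed.

Definition rpos u : I -> R := fun i => Num.max (u i) 0.
Definition rneg u : I -> R := fun i => Num.max (- u i) 0.

Lemma rpos_ge0 u i : 0 <= rpos u i.
Proof. by rewrite /rpos le_max lexx orbT. Qed.
Lemma rneg_ge0 u i : 0 <= rneg u i.
Proof. by rewrite /rneg le_max lexx orbT. Qed.
Hint Resolve rpos_ge0 rneg_ge0 : core.

Lemma rposneg u : u = (fun i => rpos u i - rneg u i).
Proof.
apply/funext => i; rewrite /rpos /rneg; case: (leP (u i) 0) => ui.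
  have -> : Num.max (- u i) 0 = - u i by apply/max_idPl; lra.
  by lra.
have -> : Num.max (- u i) 0 = 0 by apply/max_idPr; lra.
by lra.
Qed.

Lemma rpos_le u i : `|rpos u i| <= `|u i|.
Proof. by rewrite ger0_norm// /rpos ge_max ler_norm normr_ge0. Qed.
Lemma rneg_le u i : `|rneg u i| <= `|u i|.
Proof. by rewrite ger0_norm// /rneg ge_max -normrN ler_norm normr_ge0. Qed.

Lemma rsummable_pos u : rsummable u -> rsummable (rpos u).
Proof. by move=> su; apply: rsummableW su _ => i; exact: rpos_le. Qed.
Lemma rsummable_neg u : rsummable u -> rsummable (rneg u).
Proof. by move=> su; apply: rsummableW su _ => i; exact: rneg_le. Qed.
Hint Resolve rsummable_pos rsummable_neg : core.

Lemma rsum_posneg u : rsummable u -> rsum u = rsum (rpos u) - rsum (rneg u).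
Proof. by move=> su; rewrite {1}(rposneg u) rsum_sub//; auto. Qed.

Lemma rsumD_ge0 u v : (forall i, 0 <= u i) -> (forall i, 0 <= v i) ->
  rsummable u -> rsummable v -> rsum (fun i => u i + v i) = rsum u + rsum v.
Proof.
move=> u0 v0 su sv; apply: EFin_inj; rewrite EFinD !rsum_ge0E//.
- exact: esumTD.
- by move=> i; rewrite addr_ge0.
- exact: rsummableD.
Qed.

Lemma rsumD u v : rsummable u -> rsummable v ->
  rsum (fun i => u i + v i) = rsum u + rsum v.
Proof.
move=> su sv.
have -> : (fun i => u i + v i) =
    (fun i => (rpos u i + rpos v i) - (rneg u i + rneg v i)).
  apply/funext => i; rewrite {1}(rposneg u) {1}(rposneg v); ring.
rewrite rsum_sub; [|by move=> i; rewrite addr_ge0|by move=> i; rewrite addr_ge0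
  |by apply: rsummableD; auto|by apply: rsummableD; auto].
rewrite !rsumD_ge0; auto.
rewrite (rsum_posneg su) (rsum_posneg sv); ring.
Qed.

Lemma rsum0 : rsum (fun _ : I => 0 : R) = 0.
Proof. by apply: EFin_inj; rewrite rsum_ge0E// ?/esumT ?esum1//; exact: rsummable0. Qed.

Lemma rsumN u : rsummable u -> rsum (fun i => - u i) = - rsum u.
Proof.
move=> su; apply/eqP; rewrite -subr_eq0 opprK -rsumD//; last exact: rsummableN.
by apply/eqP; rewrite -[RHS]rsum0; congr rsum; apply/funext => i; rewrite addNr.
Qed.

Lemma le_rsum_ge0 u v : (forall i, 0 <= u i) -> (forall i, u i <= v i) ->
  rsummable v -> rsum u <= rsum v.
Proof.
move=> u0 uv sv.
have v0 i : 0 <= v i by exact: le_trans (u0 i) (uv i).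
rewrite -lee_fin !rsum_ge0E//; first exact: le_esumT.
by apply: rsummableW sv _ => i; rewrite !ger0_norm.
Qed.

Lemma rsum_ge0 u : (forall i, 0 <= u i) -> 0 <= rsum u.
Proof.
move=> u0; rewrite unlock [X in _ - fine X](_ : _ = 0%E).
  by rewrite subr0; apply/fine_ge0/esumT_ge0 => i; rewrite le_max lexx orbT.
by rewrite /esumT esum1// => i _; congr EFin; apply/max_idPr; rewrite oppr_le0.
Qed.

Lemma le_rsum u v : rsummable u -> rsummable v -> (forall i, u i <= v i) ->
  rsum u <= rsum v.
Proof.
move=> su sv uv; rewrite -subr_ge0 -rsumN// -rsumD//; last exact: rsummableN.
by apply: rsum_ge0 => i; rewrite subr_ge0.
Qed.

Lemma rsumZ_ge0 c u : 0 <= c -> (forall i, 0 <= u i) -> rsummable u ->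
  rsum (fun i => c * u i) = c * rsum u.
Proof.
move=> c0 u0 su.
have le d v : 0 <= d -> (forall i, 0 <= v i) -> rsummable v ->
    rsum (fun i => d * v i) <= d * rsum v.
  move=> d0 v0 sv; rewrite -lee_fin EFinM !rsum_ge0E//.
  - exact: esumTZ_le.
  - by move=> i; rewrite mulr_ge0.
  - exact: rsummableZ.
apply/eqP; rewrite eq_le le//=.
have [->|c1] := eqVneq c 0.
  by rewrite mul0r; apply: rsum_ge0 => i; rewrite mul0r.
rewrite mulrC -ler_pdivlMr ?lt_def ?c1// mulrC.
(* The reverse inequality is [le] again, for the inverse of [c] and the family [c * u]. *)
apply: le_trans (le c^-1 (fun i => c * u i) _ _ _).
- by rewrite (_ : (fun i => _ * (_ * _)) = u)//; apply/funext => i; rewrite mulKf.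
- by rewrite invr_ge0.
- by move=> i; rewrite mulr_ge0.
- exact: rsummableZ.
Qed.

Lemma rsumZ c u : rsummable u -> rsum (fun i => c * u i) = c * rsum u.
Proof.
move=> su.
have pos d : 0 <= d -> rsum (fun i => d * u i) = d * rsum u.
  move=> d0; rewrite (rsum_posneg su).
  have -> : (fun i => d * u i) = (fun i => d * rpos u i - d * rneg u i).
    by apply/funext => i; rewrite {1}(rposneg u) mulrBr.
  rewrite rsum_sub; [|by move=> i; rewrite mulr_ge0|by move=> i; rewrite mulr_ge0
    |by apply: rsummableZ; auto|by apply: rsummableZ; auto].
  by rewrite !rsumZ_ge0; auto; rewrite mulrBr.
case: (leP 0 c) => [/pos//|c0].
have := pos (- c); rewrite oppr_ge0 => /(_ (ltW c0)).
have -> : (fun i => - c * u i) = (fun i => - (c * u i)).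
  by apply/funext => i; rewrite mulNr.
by rewrite rsumN ?mulNr; [move/oppr_inj|exact: rsummableZ].
Qed.

Lemma ler_norm_rsum u : rsummable u -> `|rsum u| <= rsum (fun i => `|u i|).
Proof.
move=> su; rewrite ler_norml -rsumN; last exact: rsummable_norm.
have sn := rsummable_norm su.
apply/andP; split; last by apply: le_rsum => // i; exact: ler_norm.
by apply: le_rsum => [|//|i]; [exact: rsummableN|rewrite lerNl -normrN ler_norm].
Qed.

Lemma esumT_seq (s : seq I) u : uniq s -> (forall i, 0 <= u i) ->
  (forall i, i \notin s -> u i = 0) -> esumT u = (\sum_(i <- s) u i)%:E.
Proof.
move=> us u0 uns; rewrite /esumT (esumID [set` s]); last by move=> i _; rewrite lee_fin.
rewrite !setTI [X in (_ + X)%E]esum1 ?adde0; last first.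
  by move=> i /= /negP si; rewrite uns.
rewrite esum_fset//; last by move=> i _; rewrite lee_fin.
rewrite fsbig_finite//= sumEFin; congr EFin.
apply: perm_big; apply: uniq_perm => //.
by move=> i; rewrite in_fset_set// mem_setE.
Qed.

Lemma rsummable_seq (s : seq I) u : (forall i, i \notin s -> u i = 0) -> rsummable u.
Proof.
move=> us; rewrite /rsummable (@esumT_seq (undup s)) ?ltry ?undup_uniq//.
by move=> i; rewrite mem_undup => /us ->; rewrite normr0.
Qed.

Lemma rsum_seq (s : seq I) u : uniq s -> (forall i, i \notin s -> u i = 0) ->
  rsum u = \sum_(i <- s) u i.
Proof.
move=> us uns; rewrite unlock.
rewrite (_ : esumT _ = (\sum_(i <- s) rpos u i)%:E); last first.
  by apply: (esumT_seq us (rpos_ge0 u)) => i /uns ui; rewrite /rpos ui maxxx.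
rewrite (_ : esumT _ = (\sum_(i <- s) rneg u i)%:E); last first.
  by apply: (esumT_seq us (rneg_ge0 u)) => i /uns ui; rewrite /rneg ui oppr0 maxxx.
by rewrite -sumrB; apply: eq_bigr => i _; rewrite [RHS](congr1 (@^~ i) (rposneg u)).
Qed.

Lemma rsum_seq_le (s : seq I) u : uniq s -> (forall i, 0 <= u i) -> rsummable u ->
  \sum_(i <- s) u i <= rsum u.
Proof.
move=> us u0 su.
rewrite big_seq (eq_bigr (fun i => if i \in s then u i else 0)); last by move=> i ->.
rewrite -big_seq -(@rsum_seq s (fun i => if i \in s then u i else 0))//; last first.
  by move=> i /negbTE ->.
by apply: le_rsum_ge0 => // i; case: ifP.
Qed.

Lemma rsummable_bounded u B : (forall i, 0 <= u i) ->
  (forall s : seq I, uniq s -> \sum_(i <- s) u i <= B) -> rsummable u /\ rsum u <= B.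
Proof.
move=> u0 uB.
have le : (esumT u <= B%:E)%E.
  apply: ge_ereal_sup => _ [X [finX _] <-].
  by rewrite fsbig_finite//= sumEFin lee_fin uB//; exact: finmap.fset_uniq.
have su : rsummable u by apply: (rsummable_ge0 u0).2; exact: le_lt_trans le (ltry _).
by split => //; rewrite -lee_fin rsum_ge0E.
Qed.

Lemma rsum_approx u (e : R) : (forall i, 0 <= u i) -> rsummable u -> 0 < e ->
  exists2 s : seq I, uniq s & rsum (fun i => if i \in s then 0 else u i) <= e.
Proof.
move=> u0 su e0.
have : (esumT u \is a fin_num) by rewrite ge0_fin_numE ?esumT_ge0//; exact: (rsummable_ge0 u0).1.
move=> /(ub_ereal_sup_adherent e0)[_ [X [finX _] <-]].
rewrite fsbig_finite//= sumEFin -[ereal_sup _]/(esumT u) -rsum_ge0E// lte_fin.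
set s : seq I := finmap.enum_fset (fset_set X) => h.
have us : uniq s by exact: finmap.fset_uniq.
exists s => //.
set v := (fun i => if i \in s then u i else 0).
have sv : rsummable v by apply: (@rsummable_seq s) => i /negbTE; rewrite /v => ->.
have -> : (fun i => if i \in s then 0 else u i) = (fun i => u i + - v i).
  by apply/funext => i; rewrite /v; case: ifP => _; rewrite ?subrr ?subr0.
rewrite rsumD//; last exact: rsummableN.
rewrite rsumN// (@rsum_seq s v)//; last by move=> i /negbTE; rewrite /v => ->.
rewrite [X in _ - X](_ : _ = \sum_(i <- s) u i).
  by rewrite lerBlDr -lerBlDl ltW.
by rewrite !big_seq; apply: eq_bigr => i si; rewrite /v si.
Qed.

Lemma rsum_eq0 u : (forall i, 0 <= u i) -> rsummable u -> rsum u <= 0 ->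
  forall i, u i = 0.
Proof.
move=> u0 su h i; apply/eqP; rewrite eq_le u0 andbT; apply: le_trans h.
by have := @rsum_seq_le [:: i] u isT u0 su; rewrite big_seq1.
Qed.

End one_index.

Lemma esumT_reindex (I J : choiceType) (e : J -> I) (u : I -> R) : bijective e ->
  esumT u = esumT (fun j => u (e j)).
Proof. by move=> be; apply: reindex_esum; rewrite setTT_bijective. Qed.

Lemma rsummable_reindex (I J : choiceType) (e : J -> I) (u : I -> R) :
  bijective e -> rsummable (fun j => u (e j)) <-> rsummable u.
Proof. by move=> be; rewrite /rsummable (esumT_reindex _ be). Qed.

Lemma rsum_reindex (I J : choiceType) (e : J -> I) (u : I -> R) : bijective e ->
  rsum u = rsum (fun j => u (e j)).
Proof. by move=> be; rewrite unlock !(esumT_reindex _ be). Qed.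

Section fubini.
Context {I J : choiceType}.
Implicit Type u : I * J -> R.

Lemma esumT_pair u : (forall k, 0 <= u k) ->
  esumT u = \esum_(i in [set: I]) esumT (fun j => u (i, j)).
Proof.
move=> u0; rewrite /esumT esum_esum; last by move=> i j _ _; rewrite lee_fin.
by congr esum => //; [apply/seteqP; split => // -[]|apply/funext => -[]].
Qed.

Lemma rsummable_section u i : rsummable u -> rsummable (fun j => u (i, j)).
Proof.
rewrite /rsummable esumT_pair// => h; apply: le_lt_trans h.
rewrite (esumID [set i]); last by move=> j _; apply: esumT_ge0 => k.
rewrite setTI esum_set1; last by apply: esumT_ge0 => k.
rewrite leeDl//; apply: esum_ge0 => j _; apply: esumT_ge0 => k //.
Qed.

Let fubini_ge0 u : (forall k, 0 <= u k) -> rsummable u ->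
  rsummable (fun i => rsum (fun j => u (i, j))) /\
  rsum u = rsum (fun i => rsum (fun j => u (i, j))).
Proof.
move=> u0 su.
have E : esumT (fun i => rsum (fun j => u (i, j))) = esumT u.
  rewrite (esumT_pair u0); apply: eq_esum => i _.
  by rewrite rsum_ge0E//; exact: rsummable_section.
have r0 i : 0 <= rsum (fun j => u (i, j)) by apply: rsum_ge0.
have s : rsummable (fun i => rsum (fun j => u (i, j))).
  by apply: (rsummable_ge0 r0).2; rewrite E; exact: (rsummable_ge0 u0).1.
by split => //; apply: EFin_inj; rewrite !rsum_ge0E.
Qed.

Lemma rsummable_rsum u : rsummable u -> rsummable (fun i => rsum (fun j => u (i, j))).
Proof.
move=> su; have [s _] := fubini_ge0 (fun k => normr_ge0 _) (rsummable_norm su).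
apply: rsummableW s _ => i.
rewrite [leRHS]ger0_norm; first exact/ler_norm_rsum/rsummable_section.
by apply: rsum_ge0.
Qed.

Lemma rsum_pair u : rsummable u -> rsum u = rsum (fun i => rsum (fun j => u (i, j))).
Proof.
move=> su; rewrite (rsum_posneg su).
have [sp ->] := fubini_ge0 (rpos_ge0 u) (rsummable_pos su).
have [sn ->] := fubini_ge0 (rneg_ge0 u) (rsummable_neg su).
rewrite -rsumN// -rsumD//; last exact: rsummableN.
by congr rsum; apply/funext => i; rewrite -rsum_posneg//; exact: rsummable_section.
Qed.

Lemma rsummable_pairP u : (forall k, 0 <= u k) ->
  (forall i, rsummable (fun j => u (i, j))) ->
  rsummable (fun i => rsum (fun j => u (i, j))) -> rsummable u.
Proof.
move=> u0 su s; apply: (rsummable_ge0 u0).2; rewrite esumT_pair//.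
rewrite (@eq_esum _ _ _ _ (fun i => (rsum (fun j => u (i, j)))%:E)); last first.
  by move=> i _; rewrite rsum_ge0E.
by apply: (rsummable_ge0 _).1 => // i; exact: rsum_ge0.
Qed.

End fubini.

End rsum.

(** * Complex-valued families *)

Section complex_modulus.
Context {R : realType}.
Implicit Types (z w : R[i]) (t : R).

(* Preferred to the modulus because it is R-valued and free of square roots:
   it is submultiplicative, but unimodular numbers only have norm at most 2. *)
Definition nm z : R := `|complex.Re z| + `|complex.Im z|.

Lemma nm_ge0 z : 0 <= nm z. Proof. by rewrite addr_ge0. Qed.
Hint Extern 0 (is_true (@Order.le _ _ _ (nm _))) => solve [apply: nm_ge0] : core.

Lemma nm0 : nm 0 = 0. Proof. by rewrite /nm /= normr0 addr0. Qed.

Lemma nmD z w : nm (z + w) <= nm z + nm w.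
Proof.
case: z w => a b [c d]; rewrite /nm /=.
have := ler_normD a c; have := ler_normD b d; lra.
Qed.

Lemma nmN z : nm (- z) = nm z.
Proof. by case: z => a b; rewrite /nm /= !normrN. Qed.

Lemma nmB z w : nm (z - w) <= nm z + nm w.
Proof. by rewrite -(nmN w); exact: nmD. Qed.

Lemma nmM z w : nm (z * w) <= nm z * nm w.
Proof.
case: z w => a b [c d]; rewrite /nm /=.
have := ler_normB (a * c) (b * d); have := ler_normD (a * d) (b * c).
rewrite !normrM; lra.
Qed.

Lemma nm_real t : nm t%:C = `|t|.
Proof. by rewrite /nm /= normr0 addr0. Qed.

Lemma nm1 : nm 1 = 1. Proof. by rewrite -[1]/(1%:C) nm_real normr1. Qed.

Lemma nmX z n : nm (z ^+ n) <= nm z ^+ n.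
Proof.
elim: n => [|n IH]; first by rewrite !expr0 nm1.
by rewrite !exprS; apply: le_trans (nmM _ _) _; apply: ler_wpM2l.
Qed.

Lemma nm_eq0 z : nm z = 0 -> z = 0.
Proof.
case: z => a b; rewrite /nm /= => h.
have := normr_ge0 a; have := normr_ge0 b => b0 a0.
have /normr0_eq0 -> : `|a| = 0 by lra.
by have /normr0_eq0 -> : `|b| = 0 by lra.
Qed.

Lemma nm_conj z : nm z^* = nm z.
Proof. by case: z => a b; rewrite /nm /= normrN. Qed.

Lemma Re_le_nm z : `|complex.Re z| <= nm z. Proof. by rewrite lerDl. Qed.
Lemma Im_le_nm z : `|complex.Im z| <= nm z. Proof. by rewrite lerDr. Qed.

Lemma nm_sum (I : Type) (s : seq I) (u : I -> R[i]) :
  nm (\sum_(i <- s) u i) <= \sum_(i <- s) nm (u i).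
Proof.
elim: s => [|i s IH]; first by rewrite !big_nil nm0.
by rewrite !big_cons; apply: le_trans (nmD _ _) _; rewrite lerD2l.
Qed.

Lemma Re_sum (I : Type) (s : seq I) (u : I -> R[i]) :
  complex.Re (\sum_(i <- s) u i) = \sum_(i <- s) complex.Re (u i).
Proof.
elim: s => [|i s IH]; rewrite ?big_nil// !big_cons -IH.
by case: (u i) => ? ?; case: (\sum_(_ <- s) _).
Qed.

Lemma Im_sum (I : Type) (s : seq I) (u : I -> R[i]) :
  complex.Im (\sum_(i <- s) u i) = \sum_(i <- s) complex.Im (u i).
Proof.
elim: s => [|i s IH]; rewrite ?big_nil// !big_cons -IH.
by case: (u i) => ? ?; case: (\sum_(_ <- s) _).
Qed.

Definition cis t : R[i] := cos t +i* sin t.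

Lemma cis0 : cis 0 = 1. Proof. by rewrite /cis cos0 sin0. Qed.

Lemma cisD s t : cis (s + t) = cis s * cis t.
Proof.
by rewrite /cis cosD sinD; apply/eqP; rewrite eq_complex /= eqxx /=; apply/eqP; ring.
Qed.

Lemma nm_cis t : nm (cis t) <= 2.
Proof.
rewrite /nm /=; have : `|cos t| <= 1 by rewrite ler_norml cos_geN1 cos_le1.
have : `|sin t| <= 1 by rewrite ler_norml sin_geN1 sin_le1.
lra.
Qed.

Lemma cisN t : cis (- t) = (cis t)^*.
Proof. by rewrite /cis cosN sinN. Qed.

Lemma cisNK t : cis (- t) * cis t = 1.
Proof. by rewrite -cisD addNr cis0. Qed.

Lemma cisMn t n : cis (t *+ n) = cis t ^+ n.
Proof. by elim: n => [|n IH]; rewrite ?mulr0n ?cis0// mulrS cisD IH exprS. Qed.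

End complex_modulus.
#[global] Hint Extern 0 (is_true (@Order.le _ _ _ (nm _))) =>
  solve [apply: nm_ge0] : core.

Section csum.
Context {R : realType}.

Definition csummable {I : choiceType} (u : I -> R[i]) : Prop :=
  rsummable (fun i => nm (u i)).

Definition csum {I : choiceType} (u : I -> R[i]) : R[i] :=
  rsum (fun i => complex.Re (u i)) +i* rsum (fun i => complex.Im (u i)).

Section one_index.
Context {I : choiceType}.
Implicit Types u v : I -> R[i].

Lemma csummable_le u (v : I -> R) : (forall i, nm (u i) <= v i) -> rsummable v ->
  csummable u.
Proof.
move=> uv sv; apply: rsummableW sv _ => i.
have v0 := le_trans (nm_ge0 _) (uv i).
by rewrite (ger0_norm (nm_ge0 _)) (ger0_norm v0).
Qed.

Lemma csummable_Re u : csummable u -> rsummable (fun i => complex.Re (u i)).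
Proof.
by move=> su; apply: rsummableW su _ => i; rewrite [leRHS]ger0_norm// Re_le_nm.
Qed.

Lemma csummable_Im u : csummable u -> rsummable (fun i => complex.Im (u i)).
Proof.
by move=> su; apply: rsummableW su _ => i; rewrite [leRHS]ger0_norm// Im_le_nm.
Qed.

Lemma csummableD u v : csummable u -> csummable v -> csummable (fun i => u i + v i).
Proof.
by move=> su sv; apply: csummable_le (rsummableD su sv) => i; exact: nmD.
Qed.

Lemma csummableN u : csummable u -> csummable (fun i => - u i).
Proof. by move=> su; apply: csummable_le su => i; rewrite nmN. Qed.

Lemma csummableB u v : csummable u -> csummable v -> csummable (fun i => u i - v i).
Proof. by move=> su sv; apply: csummableD => //; exact: csummableN. Qed.

Lemma csummableM u B (v : I -> R[i]) : (forall i, nm (v i) <= B) -> csummable u ->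
  csummable (fun i => v i * u i).
Proof.
move=> vB su; apply: csummable_le (rsummableZ B su) => i.
by apply: le_trans (nmM _ _) _; apply: ler_wpM2r.
Qed.

Lemma csumD u v : csummable u -> csummable v ->
  csum (fun i => u i + v i) = csum u + csum v.
Proof.
move=> su sv; rewrite /csum; apply/eqP; rewrite eq_complex /=.
rewrite -(rsumD (csummable_Re su) (csummable_Re sv)).
rewrite -(rsumD (csummable_Im su) (csummable_Im sv)).
by apply/andP; split; apply/eqP; congr rsum; apply/funext => i; case: (u i) => ? ?; case: (v i).
Qed.

Lemma eq_csum u v : u =1 v -> csum u = csum v.
Proof. by move=> /funext ->. Qed.

Lemma csum0 : csum (fun _ : I => 0 : R[i]) = 0.
Proof. by rewrite /csum /= rsum0. Qed.

Lemma csumZ c u : csummable u -> csum (fun i => c * u i) = c * csum u.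
Proof.
move=> su; have sR := csummable_Re su; have sI := csummable_Im su.
case: c => a b; rewrite /csum; apply/eqP; rewrite eq_complex /=.
apply/andP; split; apply/eqP.
  rewrite -!rsumZ// -rsumN; last exact: rsummableZ.
  rewrite -rsumD; [|exact: rsummableZ|exact/rsummableN/rsummableZ].
  by congr rsum; apply/funext => i; case: (u i).
rewrite -!rsumZ// -rsumD; [|exact: rsummableZ|exact: rsummableZ].
by congr rsum; apply/funext => i; case: (u i).
Qed.

Lemma csumN u : csummable u -> csum (fun i => - u i) = - csum u.
Proof.
move=> su; rewrite -mulN1r -csumZ//; apply: eq_csum => i; by rewrite mulN1r.
Qed.

Lemma csumB u v : csummable u -> csummable v ->
  csum (fun i => u i - v i) = csum u - csum v.
Proof. by move=> su sv; rewrite csumD ?csumN//; exact: csummableN. Qed.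

Lemma nm_csum u : csummable u -> nm (csum u) <= rsum (fun i => nm (u i)).
Proof.
move=> su; have sR := csummable_Re su; have sI := csummable_Im su.
rewrite /nm /csum /= rsumD; [|exact: rsummable_norm|exact: rsummable_norm].
by apply: lerD; exact: ler_norm_rsum.
Qed.

Lemma csummable_seq (s : seq I) u : (forall i, i \notin s -> u i = 0) -> csummable u.
Proof. by move=> us; apply: (@rsummable_seq _ _ s) => i /us ->; rewrite nm0. Qed.

Lemma csum_seq (s : seq I) u : uniq s -> (forall i, i \notin s -> u i = 0) ->
  csum u = \sum_(i <- s) u i.
Proof.
move=> us uns; apply/eqP; rewrite eq_complex Re_sum Im_sum /csum /=.
by rewrite !(@rsum_seq _ _ s) ?eqxx// => i /uns ->.
Qed.

Lemma csum_conj u : csummable u -> csum (fun i => (u i)^*) = (csum u)^*.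
Proof.
move=> su; rewrite /csum /=; congr Complex.
  by congr rsum; apply/funext => i; case: (u i).
rewrite -rsumN; last exact: csummable_Im.
by congr rsum; apply/funext => i; case: (u i).
Qed.

Lemma csum_real (u : I -> R) : csum (fun i => (u i)%:C) = (rsum u)%:C.
Proof. by rewrite /csum /= rsum0. Qed.

End one_index.

Lemma csummable_reindex (I J : choiceType) (e : J -> I) (u : I -> R[i]) :
  bijective e -> csummable (fun j => u (e j)) <-> csummable u.
Proof. by move=> be; exact: (rsummable_reindex (fun i => nm (u i)) be). Qed.

Lemma csum_reindex (I J : choiceType) (e : J -> I) (u : I -> R[i]) :
  bijective e -> csum u = csum (fun j => u (e j)).
Proof. by move=> be; rewrite /csum !(rsum_reindex _ be). Qed.

Section fubini.
Context {I J : choiceType}.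
Implicit Type u : I * J -> R[i].

Lemma csummable_section u i : csummable u -> csummable (fun j => u (i, j)).
Proof. exact: (@rsummable_section _ _ _ (fun k => nm (u k))). Qed.

Lemma csummable_csum u : csummable u -> csummable (fun i => csum (fun j => u (i, j))).
Proof.
move=> su; apply: csummable_le (rsummable_rsum su) => i.
exact/nm_csum/csummable_section.
Qed.

Lemma csum_pair u : csummable u -> csum u = csum (fun i => csum (fun j => u (i, j))).
Proof.
move=> su; rewrite /csum /=.
by rewrite (rsum_pair (csummable_Re su)) (rsum_pair (csummable_Im su)).
Qed.

End fubini.

Lemma pair_swap_bij (I J : Type) : bijective (fun k : I * J => (k.2, k.1)).
Proof. by exists (fun k : J * I => (k.2, k.1)) => -[]. Qed.

Lemma csummable_swap (I J : choiceType) (u : I * J -> R[i]) :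
  csummable u -> csummable (fun k : J * I => u (k.2, k.1)).
Proof. by move=> su; apply: (csummable_reindex _ (pair_swap_bij J I)).2. Qed.

Lemma rsum_swap (I J : choiceType) (u : I * J -> R) : rsummable u ->
  rsum (fun i => rsum (fun j => u (i, j))) = rsum (fun j => rsum (fun i => u (i, j))).
Proof.
move=> su; rewrite -rsum_pair// (rsum_reindex u (pair_swap_bij J I)) rsum_pair//.
by apply: (rsummable_reindex _ (pair_swap_bij J I)).2.
Qed.

Lemma csum_swap (I J : choiceType) (u : I * J -> R[i]) : csummable u ->
  csum (fun i => csum (fun j => u (i, j))) = csum (fun j => csum (fun i => u (i, j))).
Proof.
move=> su; rewrite -csum_pair// (csum_reindex u (pair_swap_bij J I)) csum_pair//.
exact: csummable_swap.
Qed.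

Lemma csummable_prod (I J : choiceType) (u : I -> R[i]) (v : J -> R[i]) :
  csummable u -> csummable v -> csummable (fun k : I * J => u k.1 * v k.2).
Proof.
move=> su sv; apply: (@csummable_le _ _ (fun k : I * J => nm (u k.1) * nm (v k.2))).
  by move=> k; exact: nmM.
apply: rsummable_pairP => /=.
- by move=> k; rewrite mulr_ge0.
- by move=> i; exact: rsummableZ.
- under eq_fun do rewrite rsumZ// mulrC.
  exact: rsummableZ.
Qed.

End csum.

(** * The convolution ring l^1(V) *)

Section l1_def.
Variables (R : realType) (V : zmodType).

Definition l1_pred : {pred V -> R[i]} := fun f => `[< csummable f >].

Lemma l1_zmod_closed : zmod_closed l1_pred.
Proof.
split=> [|f g /asboolP sf /asboolP sg]; apply/asboolP.
  by apply: (csummable_seq (s := [::])).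
exact: csummableB.
Qed.

HB.instance Definition _ :=
  GRing.isZmodClosed.Build (V -> R[i]) l1_pred l1_zmod_closed.

Record l1 := L1 { l1_fun :> V -> R[i]; _ : l1_fun \in l1_pred }.

HB.instance Definition _ := [isSub for l1_fun].
HB.instance Definition _ := [Choice of l1 by <:].
HB.instance Definition _ := [SubChoice_isSubZmodule of l1 by <:].

Lemma csummable_l1 (a : l1) : csummable a.
Proof. by case: a => f pf; apply/asboolP. Qed.

Definition mk_l1 f (sf : csummable f) : l1 := L1 (asboolT sf : f \in l1_pred).

Lemma l1P (a b : l1) : a =1 b -> a = b.
Proof. by move=> ab; apply: val_inj; apply/funext. Qed.

Lemma l1D (a b : l1) x : (a + b) x = a x + b x. Proof. by []. Qed.
Lemma l1N (a : l1) x : (- a) x = - a x. Proof. by []. Qed.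
Lemma l1B (a b : l1) x : (a - b) x = a x - b x. Proof. by []. Qed.
Lemma l1_0 x : (0 : l1) x = 0. Proof. by []. Qed.

Lemma shift_bij (z : V) : bijective (fun x : V => x - z).
Proof. by exists (fun x => x + z) => x; rewrite ?addrK ?subrK. Qed.

Lemma flip_bij (z : V) : bijective (fun x : V => z - x).
Proof. by exists (fun x => z - x) => x; rewrite opprB addrC subrK. Qed.

Lemma csummable_shift (a : l1) z : csummable (fun x => a (x - z)).
Proof. by apply: (csummable_reindex a (shift_bij z)).2; exact: csummable_l1. Qed.

Definition l1norm (a : l1) : R := rsum (fun x => nm (a x)).

Lemma l1norm_ge0 a : 0 <= l1norm a. Proof. exact: rsum_ge0. Qed.

Lemma nm_le_l1norm (a : l1) x : nm (a x) <= l1norm a.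
Proof.
have := @rsum_seq_le _ _ [:: x] (fun x => nm (a x)) isT _ (csummable_l1 a).
by rewrite big_seq1; apply.
Qed.

(** The second coordinate is the point where the convolution is evaluated. Summing over the first
    one gives the product, summing over the second one gives the mass. *)
Lemma csummable_conv2 (a b : l1) : csummable (fun k : V * V => a k.1 * b (k.2 - k.1)).
Proof.
apply: (@csummable_le _ _ _ (fun k : V * V => nm (a k.1) * nm (b (k.2 - k.1)))).
  by move=> k; exact: nmM.
apply: rsummable_pairP => /=.
- by move=> k; rewrite mulr_ge0.
- by move=> x; apply/rsummableZ/csummable_shift.
- rewrite (_ : (fun x => _) = (fun x => l1norm b * nm (a x))).
    exact/rsummableZ/csummable_l1.
  apply/funext => x; rewrite rsumZ; last exact: csummable_shift.
  by rewrite mulrC -(rsum_reindex (fun y => nm (b y)) (shift_bij x)).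
Qed.

Lemma csummable_conv1 (a b : l1) z : csummable (fun x => a x * b (z - x)).
Proof. exact: csummable_section (csummable_swap (csummable_conv2 a b)). Qed.

Definition l1conv_fun (a b : l1) z := csum (fun x => a x * b (z - x)).

Lemma csummable_conv (a b : l1) : csummable (l1conv_fun a b).
Proof. exact: csummable_csum (csummable_swap (csummable_conv2 a b)). Qed.

Definition l1conv (a b : l1) : l1 := mk_l1 (csummable_conv a b).

Lemma l1convC : commutative l1conv.
Proof.
move=> a b; apply: l1P => z /=; rewrite /l1conv_fun (csum_reindex _ (flip_bij z)).
by apply: eq_csum => x; rewrite mulrC opprB addrC subrK.
Qed.

Lemma csummable_conv3 (a b c : l1) z :
  csummable (fun k : V * V => a k.1 * (b k.2 * c (z - k.1 - k.2))).
Proof.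
have := csummable_prod (csummable_l1 a) (csummable_l1 b).
move=> /(@csummableM _ _ _ (l1norm c) (fun k : V * V => c (z - k.1 - k.2))) h.
rewrite (_ : (fun k : V * V => _) =
  (fun k : V * V => c (z - k.1 - k.2) * (a k.1 * b k.2))).
  by apply: h => k; exact: nm_le_l1norm.
by apply/funext => k; ring.
Qed.

Lemma l1convA : associative l1conv.
Proof.
move=> a b c; apply: l1P => z /=; rewrite /l1conv_fun /= /l1conv_fun.
transitivity (csum (fun x => csum (fun y => a x * (b y * c (z - x - y))))).
  apply: eq_csum => x; rewrite csumZ//; exact: csummable_conv1.
transitivity (csum (fun w => csum (fun x => a x * (b (w - x) * c (z - w))))); last first.
  apply: eq_csum => w; rewrite mulrC -csumZ; last exact: csummable_conv1.
  by apply: eq_csum => x; ring.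
(* With w = x + y, this shear trades the pair (x, y) for (x, w), the summation order of the
   right-hand side. *)
pose sh (k : V * V) := (k.1, k.2 - k.1).
have bsh : bijective sh.
  by exists (fun k => (k.1, k.2 + k.1)) => -[x y]; rewrite /sh /= ?addrK ?subrK.
have s3 := csummable_conv3 a b c z.
have /= <- := csum_pair s3.
have s3' := (csummable_reindex _ bsh).2 s3.
rewrite (csum_reindex _ bsh) (csum_pair s3') (csum_swap s3').
by apply: eq_csum => w; apply: eq_csum => x /=; rewrite -addrA -opprD [x + _]addrC subrK.
Qed.

Lemma csummable_delta (x : V) (c : R[i]) : csummable (fun y => if y == x then c else 0).
Proof. by apply: (csummable_seq (s := [:: x])) => y; rewrite inE => /negbTE ->. Qed.

Definition delta x c : l1 := mk_l1 (csummable_delta x c).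

Lemma deltaE x c y : delta x c y = if y == x then c else 0. Proof. by []. Qed.

Lemma delta_conv x c (a : l1) z : l1conv (delta x c) a z = c * a (z - x).
Proof.
rewrite /= /l1conv_fun (csum_seq (s := [:: x]))// ?big_seq1 /= ?eqxx//.
by move=> y; rewrite inE => /negbTE ->; rewrite mul0r.
Qed.

Lemma l1conv1 : left_id (delta 0 1) l1conv.
Proof. by move=> a; apply: l1P => z; rewrite delta_conv mul1r subr0. Qed.

Lemma l1convDl : left_distributive l1conv +%R.
Proof.
move=> a b c; apply: l1P => z; rewrite l1D /= /l1conv_fun.
rewrite -csumD; [|exact: csummable_conv1|exact: csummable_conv1].
by apply: eq_csum => x; rewrite l1D mulrDl.
Qed.

Lemma l1_1neq0 : delta 0 1 != 0.
Proof.
apply/eqP => /(congr1 (fun a : l1 => a 0)); rewrite deltaE eqxx l1_0.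
by move/eqP; rewrite oner_eq0.
Qed.

HB.instance Definition _ := GRing.Zmodule_isComNzRing.Build l1
  l1convA l1convC l1conv1 l1convDl l1_1neq0.

Lemma l1ME (a b : l1) z : (a * b) z = csum (fun x => a x * b (z - x)). Proof. by []. Qed.

Lemma l1_1E x : (1 : l1) x = if x == 0 then 1 else 0. Proof. by []. Qed.

Lemma deltaM x y c d : delta x c * delta y d = delta (x + y) (c * d).
Proof.
apply: l1P => z; rewrite [LHS]delta_conv !deltaE subr_eq [y + x]addrC.
by case: ifP; rewrite ?mulr0.
Qed.

Lemma delta_conv_rew x c (a : l1) z : (delta x c * a) z = c * a (z - x).
Proof. exact: delta_conv. Qed.

Lemma l1norm0 : l1norm 0 = 0.
Proof.
by rewrite /l1norm -[RHS](@rsum0 R V); congr rsum; apply/funext => x; rewrite nm0.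
Qed.

Lemma l1normD a b : l1norm (a + b) <= l1norm a + l1norm b.
Proof.
rewrite /l1norm -(rsumD (csummable_l1 a) (csummable_l1 b)).
apply: le_rsum_ge0 => // [x|]; first exact: nmD.
exact: rsummableD (csummable_l1 a) (csummable_l1 b).
Qed.

Lemma l1normN a : l1norm (- a) = l1norm a.
Proof. by rewrite /l1norm; congr rsum; apply/funext => x; rewrite l1N nmN. Qed.

Lemma l1normB a b : l1norm (a - b) <= l1norm a + l1norm b.
Proof. by rewrite -(l1normN b); exact: l1normD. Qed.

Lemma l1normBC a b : l1norm (a - b) = l1norm (b - a).
Proof. by rewrite -l1normN opprB. Qed.

Lemma l1norm_eq0 a : l1norm a <= 0 -> a = 0.
Proof.
move=> h; apply: l1P => x; apply: nm_eq0.
exact: (rsum_eq0 (u := fun x => nm (a x)) _ (csummable_l1 a) h).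
Qed.

Lemma l1normM a b : l1norm (a * b) <= l1norm a * l1norm b.
Proof.
have s2 : rsummable (fun k : V * V => nm (a k.1) * nm (b (k.2 - k.1))).
  apply: rsummable_pairP => /=.
  - by move=> k; rewrite mulr_ge0.
  - by move=> x; apply/rsummableZ/csummable_shift.
  - rewrite (_ : (fun x => _) = (fun x => l1norm b * nm (a x))).
      exact/rsummableZ/csummable_l1.
    apply/funext => x; rewrite rsumZ; last exact: csummable_shift.
    by rewrite mulrC -(rsum_reindex (fun y => nm (b y)) (shift_bij x)).
apply: (@le_trans _ _ (rsum (fun z => rsum (fun x => nm (a x) * nm (b (z - x)))))).
  have s2' := (rsummable_reindex _ (@pair_swap_bij V V)).2 s2.
  have sec z := rsummable_section z s2'.
  apply: le_rsum_ge0 => // [z|]; last exact: rsummable_rsum s2'.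
  rewrite l1ME; apply: le_trans (nm_csum (csummable_conv1 a b z)) _.
  by apply: le_rsum_ge0 => // [x|]; [exact: nmM|exact: (sec z)].
rewrite -(rsum_swap s2) /= le_eqVlt; apply/orP; left; apply/eqP.
rewrite mulrC -rsumZ; last exact: csummable_l1.
congr rsum; apply/funext => x; rewrite rsumZ; last exact: csummable_shift.
by rewrite mulrC -(rsum_reindex (fun y => nm (b y)) (shift_bij x)).
Qed.

Lemma l1norm_delta x c : l1norm (delta x c) = nm c.
Proof.
rewrite /l1norm (@rsum_seq _ _ [:: x])// ?big_seq1 ?deltaE ?eqxx//.
by move=> y; rewrite inE deltaE => /negbTE ->; rewrite nm0.
Qed.

Lemma l1norm1 : l1norm 1 = 1.
Proof. by rewrite [LHS]l1norm_delta nm1. Qed.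

Lemma l1normX a n : l1norm (a ^+ n) <= l1norm a ^+ n.
Proof.
elim: n => [|n IH]; first by rewrite !expr0 l1norm1.
by rewrite !exprS; apply: le_trans (l1normM _ _) _; apply: ler_wpM2l => //; exact: l1norm_ge0.
Qed.

Lemma l1norm_sum (I : Type) (s : seq I) (u : I -> l1) :
  l1norm (\sum_(i <- s) u i) <= \sum_(i <- s) l1norm (u i).
Proof.
elim: s => [|i s IH]; first by rewrite !big_nil l1norm0.
by rewrite !big_cons; apply: le_trans (l1normD _ _) _; rewrite lerD2l.
Qed.

Lemma l1_sumE (I : Type) (s : seq I) (u : I -> l1) x :
  (\sum_(i <- s) u i) x = \sum_(i <- s) u i x.
Proof. by elim: s => [|i s IH]; rewrite ?big_nil// !big_cons l1D IH. Qed.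

(** The augmentation of the group ring, that is, the total mass; it is also the Fourier transform at
    0. *)
Definition aug (a : l1) : R[i] := csum a.

Lemma augD a b : aug (a + b) = aug a + aug b.
Proof. exact: csumD (csummable_l1 a) (csummable_l1 b). Qed.

Lemma augN a : aug (- a) = - aug a.
Proof. exact: csumN (csummable_l1 a). Qed.

Lemma augM a b : aug (a * b) = aug a * aug b.
Proof.
rewrite /aug (csum_swap (csummable_swap (csummable_conv2 a b))) /= mulrC.
rewrite -(csumZ _ (csummable_l1 a)); apply: eq_csum => x.
rewrite csumZ; last exact: csummable_shift.
by rewrite -(csum_reindex b (shift_bij x)) mulrC.
Qed.

Lemma aug_delta x c : aug (delta x c) = c.
Proof.
rewrite /aug (csum_seq (s := [:: x]))// ?big_seq1 ?deltaE ?eqxx//.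
by move=> y; rewrite inE deltaE => /negbTE ->.
Qed.

Lemma aug1 : aug 1 = 1. Proof. exact: aug_delta. Qed.

Lemma augX a n : aug (a ^+ n) = aug a ^+ n.
Proof. by elim: n => [|n IH]; rewrite ?expr0 ?aug1// !exprS augM IH. Qed.

Lemma nm_aug a : nm (aug a) <= l1norm a.
Proof. exact: nm_csum (csummable_l1 a). Qed.

Section modulation.
Variables (chi : V -> R[i]) (B : R).
Hypothesis chiB : forall x, nm (chi x) <= B.

Lemma csummable_mod (a : l1) : csummable (fun x => chi x * a x).
Proof. exact: csummableM chiB (csummable_l1 a). Qed.

Definition l1mod (a : l1) : l1 := mk_l1 (csummable_mod a).

Lemma l1modE a x : l1mod a x = chi x * a x. Proof. by []. Qed.

Lemma l1modD a b : l1mod (a + b) = l1mod a + l1mod b.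
Proof. by apply: l1P => x; rewrite l1D !l1modE l1D mulrDr. Qed.

Lemma l1modN a : l1mod (- a) = - l1mod a.
Proof. by apply: l1P => x; rewrite l1N !l1modE l1N mulrN. Qed.

Lemma l1modM a b : {morph chi : x y / x + y >-> x * y} ->
  l1mod (a * b) = l1mod a * l1mod b.
Proof.
move=> chiM; apply: l1P => z; rewrite l1modE !l1ME.
rewrite -csumZ; last exact: csummable_conv1.
have e x : chi z = chi x * chi (z - x) by rewrite -chiM addrC subrK.
apply: eq_csum => x; rewrite !l1modE (e x); ring.
Qed.

Lemma l1mod_delta x c : l1mod (delta x c) = delta x (chi x * c).
Proof.
by apply: l1P => y; rewrite l1modE !deltaE; case: eqP => [->//|]; rewrite mulr0.
Qed.

Lemma l1norm_mod a : l1norm (l1mod a) <= B * l1norm a.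
Proof.
rewrite -rsumZ; last exact: csummable_l1.
apply: le_rsum_ge0 => // [x|]; last exact/rsummableZ/csummable_l1.
by rewrite l1modE; apply: le_trans (nmM _ _) _; rewrite ler_wpM2r.
Qed.

End modulation.

Lemma csummable_conj (a : l1) : csummable (fun x => (a x)^*).
Proof. by apply: csummable_le (csummable_l1 a) => x; rewrite nm_conj. Qed.

Definition l1conj (a : l1) : l1 := mk_l1 (csummable_conj a).

Lemma l1conjE a x : l1conj a x = (a x)^*. Proof. by []. Qed.

Lemma l1norm_conj a : l1norm (l1conj a) = l1norm a.
Proof. by rewrite /l1norm; congr rsum; apply/funext => x; rewrite nm_conj. Qed.

Lemma l1conjD a b : l1conj (a + b) = l1conj a + l1conj b.
Proof. by apply: l1P => x; rewrite l1D !l1conjE l1D rmorphD. Qed.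

Lemma l1conjN a : l1conj (- a) = - l1conj a.
Proof. by apply: l1P => x; rewrite l1N !l1conjE l1N rmorphN. Qed.

Lemma l1conjM a b : l1conj (a * b) = l1conj a * l1conj b.
Proof.
apply: l1P => z; rewrite l1conjE !l1ME -csum_conj; last exact: csummable_conv1.
by apply: eq_csum => x; rewrite rmorphM.
Qed.

Lemma oppr_bij : bijective (fun x : V => - x).
Proof. by exists (fun x => - x) => x; rewrite opprK. Qed.

Lemma csummable_refl (a : l1) : csummable (fun x => a (- x)).
Proof. by apply: (csummable_reindex a oppr_bij).2; exact: csummable_l1. Qed.

Definition l1refl (a : l1) : l1 := mk_l1 (csummable_refl a).

Lemma l1reflE a x : l1refl a x = a (- x). Proof. by []. Qed.

End l1_def.
Arguments delta {R V}.
Arguments aug {R V}.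
Arguments l1norm {R V}.

(** * Absolutely convergent series and completeness of l^1(V) *)

Section real_series.
Context {R : realType}.

Lemma rsummable_nat (b : nat -> R) B : (forall n, 0 <= b n) ->
  (forall n, \sum_(0 <= k < n) b k <= B) -> rsummable b /\ rsum b <= B.
Proof.
move=> b0 bB; apply: rsummable_bounded => // s us.
have [m sm'] : exists m, forall i, i \in s -> (i < m)%N.
  by exists (\max_(i <- s) i).+1 => i si; rewrite ltnS (leq_bigmax_seq (F := id)).
apply: le_trans (bB m); rewrite /index_iota subn0.
have sm i : i \in s -> i \in iota 0 m.
  by move=> /sm'; rewrite mem_iota add0n.
rewrite [leRHS](bigID (mem s)) /= -[leLHS]addr0; apply: lerD; last exact: sumr_ge0.
rewrite le_eqVlt; apply/orP; left; apply/eqP; rewrite -[RHS]big_filter.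
apply: perm_big; apply: uniq_perm => //; first by rewrite filter_uniq// iota_uniq.
move=> i; rewrite mem_filter /=; case si : (i \in s) => //=.
by rewrite sm.
Qed.

Lemma cvg_rsum (b : nat -> R) : (forall n, 0 <= b n) -> rsummable b ->
  (fun n => \sum_(0 <= k < n) b k) @ \oo --> rsum b.
Proof.
move=> b0 sb; have e : (\sum_(0 <= k <oo) (b k)%:E = (rsum b)%:E)%E.
  by rewrite nneseries_esumT ?rsum_ge0E// => n; rewrite lee_fin.
have : (fun n => \sum_(0 <= k < n) (b k)%:E)%E @ \oo --> (rsum b)%:E.
  by rewrite -e; apply: is_cvg_nneseries => n _ _; rewrite lee_fin.
move=> /fine_cvgP[_]; apply: cvg_trans; apply: near_eq_cvg.
by near=> n; rewrite /= sumEFin.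
Unshelve. all: by end_near. Qed.

Lemma le0_cvg (x : R) (e : nat -> R) : (forall n, x <= e n) -> e @ \oo --> 0 -> x <= 0.
Proof.
move=> xe e0; rewrite -(cvg_lim (@Rhausdorff R) e0).
apply: limr_ge; first by apply/cvg_ex; exists 0.
by near=> n; exact: xe.
Unshelve. all: by end_near. Qed.

Definition rtail (b : nat -> R) n := rsum b - \sum_(0 <= k < n) b k.

Lemma rtail_cvg (b : nat -> R) : (forall n, 0 <= b n) -> rsummable b ->
  rtail b @ \oo --> 0.
Proof.
move=> b0 sb; rewrite -(subrr (rsum b)).
by apply: cvgB; [exact: cvg_cst|exact: cvg_rsum].
Qed.

End real_series.

Section l1_complete.
Context {R : realType} {V : zmodType}.
Implicit Types a h : l1 R V.

(** Completeness in the form that an absolutely convergent series has a sum. Fubini on [nat * V]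
    defines the sum pointwise, and the explicit error replaces a topology on [l1]. *)
Lemma l1_series (u : nat -> l1 R V) (b : nat -> R) :
  (forall n, l1norm (u n) <= b n) -> rsummable b ->
  exists a : l1 R V, forall n, l1norm (a - \sum_(0 <= k < n) u k) <= rtail b n.
Proof.
move=> ub sb.
have b0 n : 0 <= b n by exact: le_trans (l1norm_ge0 _) (ub n).
have sN : rsummable (fun n => l1norm (u n)).
  by apply: rsummableW sb _ => n; rewrite !ger0_norm ?l1norm_ge0.
have s2 : csummable (fun k : nat * V => u k.1 k.2).
  apply: rsummable_pairP => //= i; exact: csummable_l1.
have s2' := csummable_swap s2.
exists (mk_l1 (csummable_csum s2')) => n.
(* The family without its first [n] terms; it sums to the error of the [n]-th partial sum. *)
pose w (k : nat * V) : R[i] := if (k.1 < n)%N then 0 else u k.1 k.2.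
have sw : csummable w.
  by apply: rsummableW s2 _ => k; rewrite /w; case: ifP => _; rewrite ?nm0 ?normr0.
have sw' := csummable_swap sw.
have E x : (mk_l1 (csummable_csum s2') - \sum_(0 <= k < n) u k) x =
    csum (fun k => w (k, x)).
  rewrite l1B l1_sumE /= (_ : \sum_(0 <= k < n) u k x =
      csum (fun k => if (k < n)%N then u k x else 0)).
    have sx := csummable_section x s2'.
    rewrite -csumB//; last first.
      apply: rsummableW sx _ => k; case: ifP => _; by rewrite ?nm0 ?normr0.
    apply: eq_csum => k; rewrite /w /=; case: ifP => _; by rewrite ?subrr ?subr0.
  rewrite (csum_seq (s := index_iota 0 n)) ?iota_uniq//.
    by rewrite !big_seq; apply: eq_bigr => k; rewrite mem_index_iota => /andP[_ ->].
  by move=> k; rewrite mem_index_iota /= => /negbTE ->.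
have sb' : rsummable (fun k => if (k < n)%N then 0 else b k).
  by apply: rsummableW sb _ => k; case: ifP => _; rewrite ?normr0.
have -> : rtail b n = rsum (fun k => if (k < n)%N then 0 else b k).
  have snb : rsummable (fun k => if (k < n)%N then b k else 0).
    by apply: rsummableW sb _ => k; case: ifP => _; rewrite ?normr0.
  rewrite /rtail (_ : \sum_(0 <= k < n) b k = rsum (fun k => if (k < n)%N then b k else 0)).
    rewrite -rsumN// -rsumD//; last exact: rsummableN.
    congr rsum; apply/funext => k; case: ifP => _; by rewrite ?subrr ?subr0.
  rewrite (rsum_seq (s := index_iota 0 n)) ?iota_uniq//.
    by rewrite !big_seq; apply: eq_bigr => k; rewrite mem_index_iota => /andP[_ ->].
  by move=> k; rewrite mem_index_iota /= => /negbTE ->.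
apply: (@le_trans _ _ (rsum (fun x => rsum (fun k => nm (w (k, x)))))).
  apply: le_rsum_ge0 => // [x|]; last exact: rsummable_rsum sw'.
  rewrite E; exact: nm_csum (csummable_section x sw').
rewrite (rsum_swap sw'); apply: le_rsum_ge0 => // [k|k]; first by apply: rsum_ge0.
rewrite /w /=; case: ifP => _; last exact: ub.
by rewrite nm0 rsum0.
Qed.

Lemma l1_eq (a b : l1 R V) (e : nat -> R) :
  (forall n, l1norm (a - b) <= e n) -> e @ \oo --> 0 -> a = b.
Proof.
by move=> ae e0; apply/eqP; rewrite -subr_eq0; apply/eqP/l1norm_eq0/(le0_cvg ae e0).
Qed.

Lemma sum_expr_le (r : R) n : 0 <= r -> r < 1 -> \sum_(0 <= k < n) r ^+ k <= (1 - r)^-1.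
Proof.
move=> r0 r1; rewrite -[leRHS]div1r ler_pdivlMr ?subr_gt0// mulrC.
rewrite big_mkord -[leRHS]/(1 : R) -opprB mulNr -subrX1 opprB lerBlDr lerDl.
exact: exprn_ge0.
Qed.

Lemma l1_neumann h : l1norm h < 1 -> exists g, (1 - h) * g = 1.
Proof.
move=> h1; have h0 := l1norm_ge0 h.
set r := l1norm h in h1 h0.
have [sb _] := rsummable_nat (fun n => exprn_ge0 n h0) (fun n => sum_expr_le n h0 h1).
have [g gP] := l1_series (fun n => l1normX h n) sb.
exists g; apply: (@l1_eq _ _ (fun n => (1 + r) * rtail (fun n => r ^+ n) n + r ^+ n)).
  (* The partial sum S of the geometric series satisfies (1 - h) S = 1 - h ^ n, so only the error of
     S and the power h ^ n remain. *)
  move=> n; have -> : (1 - h) * g - 1 =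
      (1 - h) * (g - \sum_(0 <= k < n) h ^+ k) - h ^+ n.
    rewrite mulrBr -[X in _ = _ - X - _]opprK -mulNr opprB big_mkord -subrX1.
    ring.
  apply: le_trans (l1normB _ _) _; apply: lerD; last exact: l1normX.
  apply: le_trans (l1normM _ _) _.
  apply: (ler_pM (l1norm_ge0 _) (l1norm_ge0 _) _ (gP n)).
  by apply: le_trans (l1normB _ _) _; rewrite l1norm1.
rewrite -[X in _ --> X](addr0 0) -{1}(mulr0 (1 + r)); apply: cvgD; last first.
  by apply: cvg_expr; rewrite ger0_norm.
apply: cvgM; first exact: cvg_cst.
by apply: rtail_cvg => // n; exact: exprn_ge0.
Qed.

End l1_complete.

Section exp_partial_sums.
Variables (A : comNzRingType) (c : nat -> A).
Hypothesis cP : forall n, c n *+ n`! = 1.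

Let T (a : A) i := c i * a ^+ i.

Let c_bin m i : (i <= m)%N -> c m *+ 'C(m, i) = c i * c (m - i)%N.
Proof.
move=> im; have := cP m; rewrite -(bin_fact im) -mulr_natr !natrM => h.
have hi := cP i; have hr := cP (m - i)%N.
rewrite -mulr_natr in hi; rewrite -mulr_natr in hr; rewrite -mulr_natr.
move: (i`!%:R : A) ((m - i)`!%:R : A) ('C(_, _)%:R : A) h hi hr => fi fr b h hi hr.
have -> : c m * b = c m * b * (c i * fi) * (c (m - i)%N * fr).
  by rewrite hi hr !mulr1.
by rewrite -[RHS]mul1r -h; ring.
Qed.

Let T_add m a b : T (a + b) m = \sum_(0 <= i < m.+1) T a i * T b (m - i)%N.
Proof.
rewrite /T exprDn mulr_sumr big_mkord [RHS](reindex_inj rev_ord_inj) /=.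
apply: eq_bigr => i _; have im : (i <= m)%N by rewrite -ltnS.
rewrite subSS subKn// mulrnAr -mulrnAl -bin_sub// c_bin ?leq_subr// subKn//.
ring.
Qed.

(** The defect of the functional equation consists of the terms with i + j >= n. The ring is
    arbitrary because the identity is used twice: in [l1], and in [R] for the norms, where the
    defect is known to tend to 0. *)
Lemma exp_partial_sumM n (a b : A) :
  (\sum_(0 <= i < n) c i * a ^+ i) * (\sum_(0 <= i < n) c i * b ^+ i) -
  \sum_(0 <= i < n) c i * (a + b) ^+ i =
  \sum_(0 <= i < n) \sum_(n - i <= j < n) (c i * a ^+ i) * (c j * b ^+ j).
Proof.
have -> : \sum_(0 <= i < n) c i * (a + b) ^+ i =
    \sum_(0 <= i < n) \sum_(0 <= j < n - i) T a i * T b j.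
  under eq_bigr do rewrite -/(T (a + b) _) T_add.
  elim: n => [|n IH]; first by rewrite !big_nil.
  rewrite !(@big_nat_recr _ _ _ n 0)//= IH subSnn big_nat1 subnn.
  rewrite [X in _ = X + _](eq_big_nat _ _ (F2 := fun i => \sum_(0 <= j < n - i) T a i * T b j +
    T a i * T b (n - i)%N)); last first.
    by move=> i /andP[_ ni]; rewrite subSn ?big_nat_recr// ltnW.
  by rewrite big_split /= addrA.
rewrite big_distrl /= -sumrB; apply: eq_bigr => i _.
by rewrite big_distrr /= (@big_cat_nat _ _ _ (n - i))//= ?leq_subr// addrAC subrr add0r.
Qed.

End exp_partial_sums.

(** * Exponential and logarithm in l^1(V) *)

Section exp_tail.
Context {R : realType}.
Implicit Types x y : R.

Lemma exp_partial_le x n : 0 <= x -> \sum_(0 <= k < n) exp_coeff x k <= expR x.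
Proof.
move=> x0; apply: nondecreasing_cvgn_le; last exact: is_cvg_series_exp_coeff.
by apply/nondecreasing_seqP => k; rewrite /series /= big_nat_recr//= lerDl exp_coeff_ge0.
Qed.

Lemma rsum_exp_coeff x : 0 <= x -> rsummable (exp_coeff x) /\ rsum (exp_coeff x) = expR x.
Proof.
move=> x0; have c0 n := exp_coeff_ge0 n x0.
have [s _] := rsummable_nat c0 (fun n => exp_partial_le n x0).
split=> //; have := cvg_rsum c0 s => /(cvg_lim (@Rhausdorff R)) <-.
by [].
Qed.

Definition exp_tail x n := expR x - \sum_(0 <= k < n) exp_coeff x k.

Lemma exp_tail_cvg x : 0 <= x -> exp_tail x @ \oo --> 0.
Proof.
move=> x0; have [s e] := rsum_exp_coeff x0.
have := rtail_cvg (fun n => exp_coeff_ge0 n x0) s.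
by rewrite /rtail e.
Qed.

Lemma exp_tail2 x : 0 <= x -> x <= 1 / 2 -> exp_tail x 2 <= 2 * x ^+ 2.
Proof.
move=> x0 x1; rewrite /exp_tail /index_iota /= !big_cons big_nil /exp_coeff /=.
rewrite expr0 expr1 fact0 factS fact0 muln1 !divr1 addr0.
have h : expR x * (1 - x) <= 1.
  rewrite -[leRHS](expRxMexpNx_1 x) ler_pM2l ?expR_gt0//.
  by have := expR_ge1Dx (- x).
have : expR x <= (1 - x)^-1 by rewrite -[leRHS]div1r ler_pdivlMr//; lra.
have : (1 - x)^-1 <= 1 + x + 2 * x ^+ 2.
  rewrite -[leLHS]div1r ler_pdivrMr; last by lra.
  nra.
lra.
Qed.

End exp_tail.

Section l1_exp.
Context {R : realType} {V : zmodType}.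
Implicit Types a b : l1 R V.

(** A real scalar as a multiple of the unit: scaling becomes ring multiplication, which ring
    endomorphisms respect. *)
Definition econst (r : R) : l1 R V := delta 0 r%:C.

Lemma l1norm_econst r : l1norm (econst r) = `|r|.
Proof. by rewrite l1norm_delta nm_real. Qed.

Definition ecoef n := econst (n`!%:R^-1).

Lemma ecoefP n : ecoef n *+ n`! = 1.
Proof.
apply: l1P => x; rewrite (_ : ecoef n *+ n`! = \sum_(0 <= k < n`!) ecoef n); last first.
  by rewrite sumr_const_nat subn0.
rewrite l1_sumE sumr_const_nat subn0 /ecoef /econst deltaE l1_1E.
case: ifP => _; last by rewrite mul0rn.
have realMn (r : R) m : r%:C *+ m = (r *+ m)%:C.
  elim: m => [|m IH]; rewrite ?mulr0n// !mulrS IH.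
  by apply/eqP; rewrite eq_complex /= addr0 !eqxx.
by rewrite realMn -(mulr_natr (n`!%:R^-1)) mulVf// pnatr_eq0 -lt0n fact_gt0.
Qed.

Lemma ecoefM n a : l1norm (ecoef n * a ^+ n) <= exp_coeff (l1norm a) n.
Proof.
apply: le_trans (l1normM _ _) _; rewrite l1norm_econst ger0_norm ?invr_ge0//.
by rewrite /exp_coeff /= mulrC ler_wpM2r ?invr_ge0// l1normX.
Qed.

Definition epart n a := \sum_(0 <= i < n) ecoef i * a ^+ i.

Lemma lexp_ex a : exists e : l1 R V,
  forall n, l1norm (e - epart n a) <= exp_tail (l1norm a) n.
Proof.
have [s e] := rsum_exp_coeff (l1norm_ge0 a).
have [g gP] := l1_series (fun n => ecoefM n a) s.
by exists g => n; rewrite /exp_tail -e; exact: gP.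
Qed.

Definition lexp a := sval (cid (lexp_ex a)).

Lemma lexpP a n : l1norm (lexp a - epart n a) <= exp_tail (l1norm a) n.
Proof. by rewrite /lexp; case: cid. Qed.

Lemma epart_norm n a : l1norm (epart n a) <= expR (l1norm a).
Proof.
apply: le_trans (l1norm_sum _ _) _.
apply: le_trans (exp_partial_le n (l1norm_ge0 a)).
by apply: ler_sum => i _; exact: ecoefM.
Qed.

(** As [lexp] is obtained by choice, an identity between exponentials is proved by showing that the
    other side has the same partial sums up to a vanishing error. *)
Lemma lexp_uniq a b e : e @ \oo --> (0 : R) ->
  (forall n, l1norm (b - epart n a) <= e n) -> b = lexp a.
Proof.
move=> e0 be; apply: (@l1_eq _ _ _ _ (fun n => e n + exp_tail (l1norm a) n)).
  move=> n; rewrite -(subrKA (epart n a)); apply: le_trans (l1normD _ _) _.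
  by apply: lerD => //; rewrite l1normBC lexpP.
by rewrite -[X in _ --> X](addr0 0); apply: cvgD => //; exact/exp_tail_cvg/l1norm_ge0.
Qed.

Lemma lexpD a b : lexp (a + b) = lexp a * lexp b.
Proof.
apply/esym; set x := l1norm a; set y := l1norm b.
(* The defect for the real exponentials of the norms. It dominates the norm of the defect for [a]
   and [b], term by term, and tends to 0 by [expRD]. *)
pose D n := (\sum_(0 <= i < n) exp_coeff x i) * (\sum_(0 <= i < n) exp_coeff y i) -
  \sum_(0 <= i < n) exp_coeff (x + y) i.
have x0 : 0 <= x := l1norm_ge0 a.
have y0 : 0 <= y := l1norm_ge0 b.
apply: (@lexp_uniq _ _ (fun n => exp_tail x n * l1norm (lexp b) + expR x * exp_tail y n + D n)).
  rewrite -[X in _ --> X](addr0 0) -{1}(addr0 0) -{1}(mul0r (l1norm (lexp b))).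
  rewrite -{2}(mulr0 (expR x)); apply: cvgD; first apply: cvgD.
  - apply: cvgM; [exact: exp_tail_cvg|exact: cvg_cst].
  - apply: cvgM; [exact: cvg_cst|exact: exp_tail_cvg].
  rewrite -(subrr (expR (x + y))) {1}expRD; apply: cvgB; first apply: cvgM.
  - exact: is_cvg_series_exp_coeff.
  - exact: is_cvg_series_exp_coeff.
  - exact: is_cvg_series_exp_coeff.
move=> n; rewrite (_ : _ - _ = (lexp a - epart n a) * lexp b +
    epart n a * (lexp b - epart n b) + (epart n a * epart n b - epart n (a + b))); last by ring.
apply: le_trans (l1normD _ _) _; apply: lerD.
  apply: le_trans (l1normD _ _) _; apply: lerD; apply: le_trans (l1normM _ _) _.
    by apply: ler_wpM2r; [exact: l1norm_ge0|exact: lexpP].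
  by apply: (ler_pM (l1norm_ge0 _) (l1norm_ge0 _)); [exact: epart_norm|exact: lexpP].
rewrite exp_partial_sumM; last exact: ecoefP.
have fP k : (k`!%:R^-1 : R) *+ k`! = 1.
  by rewrite -(mulr_natr (k`!%:R^-1)) mulVf// pnatr_eq0 -lt0n fact_gt0.
have := exp_partial_sumM fP n x y.
have cE z k : (k`!%:R^-1 : R) * z ^+ k = exp_coeff z k by rewrite mulrC.
rewrite (eq_bigr _ (fun k _ => cE x k)) (eq_bigr _ (fun k _ => cE y k)).
rewrite (eq_bigr _ (fun k _ => cE (x + y) k)) -/(D n) => ->.
apply: le_trans (l1norm_sum _ _) _; apply: ler_sum => i _.
apply: le_trans (l1norm_sum _ _) _; apply: ler_sum => j _.
apply: le_trans (l1normM _ _) _; rewrite !cE.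
by apply: (ler_pM (l1norm_ge0 _) (l1norm_ge0 _)); exact: ecoefM.
Qed.

Lemma lexp_bound2 a : l1norm a <= 1 / 2 -> l1norm (lexp a - 1 - a) <= 2 * l1norm a ^+ 2.
Proof.
move=> a1; apply: le_trans (exp_tail2 (l1norm_ge0 a) a1).
have := lexpP a 2; rewrite /epart /index_iota /= !big_cons big_nil expr0 expr1 mulr1 addr0.
have -> : ecoef 0 = 1 by have := ecoefP 0; rewrite fact0 mulr1n.
have -> : ecoef 1 = 1 by have := ecoefP 1; rewrite factS fact0 muln1 mulr1n.
by rewrite mul1r opprD addrA.
Qed.

Lemma lexp0 : lexp 0 = 1.
Proof.
have := @lexp_bound2 0; rewrite l1norm0 expr0n mulr0 subr0 => h.
by apply/eqP; rewrite -subr_eq0; apply/eqP/l1norm_eq0/h; lra.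
Qed.

Lemma lexpNK a : lexp (- a) * lexp a = 1.
Proof. by rewrite -lexpD addNr lexp0. Qed.

(** The quadratic bound gives |a| <= 2 |a|^2, which forces a = 0 when |a| < 1/2. Hence small
    logarithms are unique. *)
Lemma lexp_eq1 a : l1norm a < 1 / 2 -> lexp a = 1 -> a = 0.
Proof.
move=> a1 e; have := lexp_bound2 (ltW a1); rewrite e subrr add0r l1normN => h.
apply: l1norm_eq0; have := l1norm_ge0 a; rewrite le_eqVlt => /predU1P[<-//|a0].
by exfalso; move: (l1norm a) a1 h a0 {e} => x *; nra.
Qed.

Lemma lexp_inj a b : l1norm (a - b) < 1 / 2 -> lexp a = lexp b -> a = b.
Proof.
move=> h e; apply/eqP; rewrite -subr_eq0; apply/eqP/lexp_eq1 => //.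
by rewrite lexpD e mulrC lexpNK.
Qed.

(** A bounded ring endomorphism passes through the power series. Only real scalars must be fixed, so
    that conjugation qualifies as well as the twists. *)
Lemma lexp_morph (phi : l1 R V -> l1 R V) (B : R) :
  {morph phi : a b / a - b} -> {morph phi : a b / a * b} ->
  (forall r, phi (econst r) = econst r) ->
  (forall a, l1norm (phi a) <= B * l1norm a) -> forall a, phi (lexp a) = lexp (phi a).
Proof.
move=> phiB phiM phiC phiN a.
have phi0 : phi 0 = 0 by rewrite -[X in phi X](subrr 0) phiB subrr.
have phiD : {morph phi : a b / a + b}.
  by move=> u v; rewrite -[v in LHS]opprK phiB -[- v]sub0r phiB phi0 sub0r opprK.
have phi1 : phi 1 = 1.
  by have -> : (1 : l1 R V) = econst 1 by apply: l1P.
have phiX n b : phi (b ^+ n) = phi b ^+ n.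
  by elim: n => [|n IH]; rewrite ?expr0// !exprS phiM IH.
have B0 : 0 <= B.
  by have := phiN 1; rewrite phi1 l1norm1 mulr1; apply: le_trans.
apply: (@lexp_uniq _ _ (fun n => B * exp_tail (l1norm a) n)).
  rewrite -(mulr0 B); apply: cvgM; first exact: cvg_cst.
  exact/exp_tail_cvg/l1norm_ge0.
move=> n; have -> : epart n (phi a) = phi (epart n a).
  rewrite /epart (big_morph phi phiD phi0); apply: eq_bigr => i _.
  by rewrite phiM phiX phiC.
by rewrite -phiB; apply: le_trans (phiN _) _; rewrite ler_wpM2l// lexpP.
Qed.

Lemma econst_ge0 r : 0 <= r -> forall x, 0 <= econst r x.
Proof. by move=> r0 x; rewrite deltaE; case: ifP => //; rewrite lecR. Qed.

Lemma csum_ge0 (I : choiceType) (u : I -> R[i]) : (forall i, 0 <= u i) -> 0 <= csum u.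
Proof.
move=> u0; have uR i : 0 <= complex.Re (u i) by have := u0 i; rewrite lecE => /andP[].
have uI i : complex.Im (u i) = 0 by have := u0 i; rewrite lecE => /andP[/eqP].
rewrite lecE /csum /= rsum_ge0// andbT; apply/eqP.
by rewrite -[RHS](@rsum0 R I); congr rsum; apply/funext.
Qed.

Lemma l1M_ge0 a b : (forall x, 0 <= a x) -> (forall x, 0 <= b x) ->
  forall x, 0 <= (a * b) x.
Proof. by move=> a0 b0 x; rewrite l1ME csum_ge0// => y; rewrite mulr_ge0. Qed.

Lemma lexp_ge0 a : (forall x, 0 <= a x) -> forall x, 0 <= lexp a x.
Proof.
move=> a0 x; have p0 n : 0 <= epart n a x.
  rewrite l1_sumE; apply: sumr_ge0 => i _; apply: l1M_ge0.
    by apply: econst_ge0; rewrite invr_ge0.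
  by elim: i => [|i IH] y; rewrite ?expr0 ?exprS ?l1_1E; [case: ifP|exact: l1M_ge0].
have h n : nm (lexp a x - epart n a x) <= exp_tail (l1norm a) n.
  by rewrite -l1B; apply: le_trans (nm_le_l1norm _ _) (lexpP _ _).
have t0 : exp_tail (l1norm a) @ \oo --> 0 by exact/exp_tail_cvg/l1norm_ge0.
rewrite lecE /=; apply/andP; split.
  rewrite -normr_eq0 eq_le normr_ge0 andbT; apply: (le0_cvg _ t0) => n.
  apply: le_trans (h n); apply: le_trans (Im_le_nm _).
  have := p0 n; rewrite lecE => /andP[/eqP /= e _].
  by case: (lexp a x) (epart n a x) e => ? ? [? ?] /= ->; rewrite subr0.
rewrite -oppr_le0; apply: (le0_cvg _ t0) => n.
apply: le_trans (h n); apply: le_trans (Re_le_nm _).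
have := p0 n; rewrite lecE => /andP[_ /= e].
case: (lexp a x) (epart n a x) e => u ? [v ?] /= v0.
by rewrite -normrN; apply: le_trans (ler_norm _); lra.
Qed.

(** If u = (1 + d) exp(s), then u exp(-(s + d)) - 1 = (1 + d) exp(-d) - 1: the new error depends on
    the old one alone. *)
Let newton (d : l1 R V) := (1 + d) * lexp (- d) - 1.

Let newton_le d : l1norm d <= 1 / 8 -> l1norm (newton d) <= 1 / 2 * l1norm d.
Proof.
move=> d1; have := @lexp_bound2 (- d); rewrite l1normN.
set r := lexp (- d) - 1 - - d => /(_ _) h.
have {}h : l1norm r <= 2 * l1norm d ^+ 2 by apply: h; lra.
(* The linear terms cancel. The norm is at most (3 + 2 |d|) |d|^2, hence at most |d| / 2 as soon as
   |d| <= 1/8. *)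
have -> : newton d = - (d * d) + r + d * r by rewrite /newton /r; ring.
apply: le_trans (l1normD _ _) _; have := l1normD (- (d * d)) r; rewrite l1normN.
have := l1normM d d; have := l1normM d r; have := l1norm_ge0 d; have := l1norm_ge0 r.
move: (l1norm d) (l1norm r) (l1norm (d * d)) (l1norm (d * r)) (l1norm (- (d * d) + r)) d1 h.
move=> x y z w v x8 h y0 x0 w1 z1 v1.
have : x * y <= x * (2 * x ^+ 2) by rewrite ler_wpM2l.
nra.
Qed.

(* Newton's iteration for exp a = u: the error d = u exp(-s) - 1 at the
   approximation s becomes quadratically small once s is replaced by s + d. *)
Lemma lexp_surj u : l1norm (u - 1) <= 1 / 8 ->
  exists2 a, lexp a = u & l1norm a <= 2 * l1norm (u - 1).
Proof.
move=> u1; set e := l1norm (u - 1) in u1 *.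
have e0 : 0 <= e := l1norm_ge0 _.
pose d n := iter n newton (u - 1).
have dle n : l1norm (d n) <= e * (1 / 2) ^+ n.
  elim: n => [|n IH]; first by rewrite expr0 mulr1.
  have le1 : (1 / 2 : R) ^+ n <= 1 by apply: exprn_ile1; lra.
  have p0 : 0 <= (1 / 2 : R) ^+ n by apply: exprn_ge0; lra.
  apply: le_trans (newton_le _) _; first by apply: le_trans IH _; nra.
  rewrite exprS; nra.
have sumle n : \sum_(0 <= k < n) e * (1 / 2) ^+ k = 2 * e - 2 * e * (1 / 2) ^+ n.
  elim: n => [|n IH]; first by rewrite big_nil expr0; ring.
  by rewrite big_nat_recr//= IH exprS; field.
have p0 n : 0 <= (1 / 2 : R) ^+ n by apply: exprn_ge0; lra.
have b0 n : 0 <= e * (1 / 2) ^+ n by rewrite mulr_ge0.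
have [|sb b2] := @rsummable_nat R _ (2 * e) b0.
  by move=> n; rewrite sumle lerBlDr lerDl !mulr_ge0.
have [a aP] := l1_series dle sb.
pose s n := \sum_(0 <= k < n) d k.
have inv n : u = (1 + d n) * lexp (s n).
  elim: n => [|n IH]; first by rewrite /s big_nil lexp0 mulr1 /d /= addrC subrK.
  rewrite /s big_nat_recr//= -/(s n) lexpD mulrA [(_ * lexp (s n))]mulrC -mulrA.
  by rewrite /d /= -/(d n) /newton [1 + _]addrC subrK -mulrA lexpNK mulr1 mulrC.
have tail n : l1norm (s n - a) <= 2 * e * (1 / 2) ^+ n.
  by rewrite l1normBC; apply: le_trans (aP n) _; rewrite /rtail sumle; lra.
exists a; last first.
  by have := tail 0%N; rewrite /s big_nil sub0r l1normN expr0 mulr1.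
(* With q = (1/2) ^ n and t the norm of s n - a, at most 2 e q, the first two terms of the
   decomposition below are at most 2 t each and the last is at most e q: 8 + 1 = 9. *)
apply/esym/(@l1_eq _ _ _ _ (fun n => l1norm (lexp a) * (9 * e * (1 / 2) ^+ n))); last first.
  rewrite -(mulr0 (l1norm (lexp a))) -(mulr0 (9 * e)); apply: cvgM; first exact: cvg_cst.
  apply: cvgM; first exact: cvg_cst.
  by apply: cvg_expr; rewrite ger0_norm; lra.
move=> n; have -> : u - lexp a =
    lexp a * ((1 + d n) * (lexp (s n - a) - 1 - (s n - a)) + (1 + d n) * (s n - a) + d n).
  rewrite {1}(inv n) -{1}(subrK a (s n)) lexpD; ring.
apply: le_trans (l1normM _ _) _; rewrite ler_wpM2l ?l1norm_ge0//.
apply: le_trans (l1normD _ _) _; have := l1normD ((1 + d n) * (lexp (s n - a) - 1 - (s n - a))) ((1 + d n) * (s n - a)).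
have := l1normM (1 + d n) (lexp (s n - a) - 1 - (s n - a)).
have := l1normM (1 + d n) (s n - a).
have := l1normD 1 (d n); rewrite l1norm1.
have := tail n; have := dle n.
have q1 : (1 / 2 : R) ^+ n <= 1 by apply: exprn_ile1; lra.
have q0 := p0 n.
have := @lexp_bound2 (s n - a).
have := l1norm_ge0 (s n - a).
have := l1norm_ge0 (lexp (s n - a) - 1 - (s n - a)).
have := l1norm_ge0 (1 + d n).
set q := (_ ^+ n) in q0 q1 *.
move: (l1norm (s n - a)) (l1norm (lexp (s n - a) - 1 - (s n - a))) (l1norm (1 + d n))
  (l1norm (d n)) (l1norm (_ * (s n - a))) (l1norm (_ * (_ - _ - _)))
  (l1norm ((1 + d n) * (lexp (s n - a) - 1 - (s n - a)) + (1 + d n) * (s n - a))).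
move=> t r D dn Y Z W D0 r0 t0 rb dnb tb Db Yb Zb Wb.
have tq : t <= q / 4 by nra.
have {}rb : r <= 2 * t ^+ 2 by apply: rb; nra.
have rt : r <= t by nra.
have D2 : D <= 2 by nra.
have : D * t <= 2 * t by nra.
have : D * r <= 2 * t by nra.
nra.
Qed.

End l1_exp.

(** * Wiener's lemma *)

Section archimedean_facts.
Context {R : realType}.

(** Divide by [N] and let it grow: this is how means over the first [N] integers are taken without a
    limit. *)
Lemma le_of_natmul (u B C : R) :
  (forall N : nat, N%:R * u <= N%:R * B + C) -> u <= B.
Proof.
move=> h; rewrite leNgt; apply/negP => Bu.
have := archi_boundP (normr_ge0 (C / (u - B))); set N := Num.bound _ => hN.
have : C / (u - B) < N%:R by apply: le_lt_trans hN; exact: ler_norm.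
rewrite ltr_pdivrMr ?subr_gt0// mulrBr => h1.
by have := h N; lra.
Qed.

Lemma poly_expr_small (m : nat) (r : R) : 0 <= r -> r < 1 ->
  exists N : nat, 2 * (N.+1%:R) ^+ m * r ^+ N < 1.
Proof.
rewrite le_eqVlt => /predU1P[<-|r0] r1; first by exists 1%N; rewrite expr1 mulr0.
pose l := - ln r; have l0 : 0 < l by rewrite oppr_gt0 ln_lt0// r0.
have rE N : r ^+ N = (expR (N%:R * l))^-1.
  by rewrite -expRN /l mulrN opprK expRM_natl lnK.
(* N > C makes the term (N l)^(m+1) / (m+1)! of the exponential series exceed 2 (2 N)^m, which is at
   least 2 (N + 1)^m. *)
pose C := 2 * 2 ^+ m * m.+1`!%:R / l ^+ m.+1.
have C0 : 0 <= C by rewrite !mulr_ge0// ?invr_ge0// ?exprn_ge0// ltW.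
have := archi_boundP C0; set N := Num.bound _ => hN.
have N0 : (0 < N%:R :> R) by exact: le_lt_trans hN.
exists N; rewrite rE ltr_pdivrMr ?expR_gt0// mul1r.
have x0 : 0 < N%:R * l by rewrite mulr_gt0.
have lower : (N%:R * l) ^+ m.+1 / m.+1`!%:R <= expR (N%:R * l).
  apply: le_trans (exp_partial_le m.+2 (ltW x0)).
  rewrite big_nat_recr//= lerDr; apply: sumr_ge0 => i _.
  by apply: exp_coeff_ge0; exact: ltW.
apply: lt_le_trans lower.
rewrite ltr_pdivlMr ?ltr0n ?fact_gt0//.
have e1 : N.+1%:R ^+ m <= (2 * N%:R) ^+ m :> R.
  apply: lerXn2r; rewrite ?nnegrE ?mulr_ge0//.
  have : 1 <= N%:R :> R by rewrite ler1n -(ltr0n R).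
  by rewrite -natr1; lra.
have lm : 0 < l ^+ m.+1 by rewrite exprn_gt0.
have : C * l ^+ m.+1 < N%:R * l ^+ m.+1 by rewrite ltr_pM2r.
rewrite /C divfK ?gt_eqF// => h.
rewrite exprMn [X in _ < X * _]exprS.
apply: (@le_lt_trans _ _ ((2 * N%:R) ^+ m * (2 * m.+1`!%:R))).
  by rewrite mulrAC [leLHS]mulrC ler_wpM2r// mulr_ge0.
rewrite exprMn; have Nm : 0 < N%:R ^+ m :> R by rewrite exprn_gt0.
rewrite -(ltr_pM2l Nm) in h.
rewrite [ltRHS](_ : _ = N%:R ^+ m * (N%:R * l ^+ m.+1)); last by ring.
by apply: le_lt_trans h; rewrite le_eqVlt; apply/orP; left; apply/eqP; ring.
Qed.

End archimedean_facts.

Section twist.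
Context {R : realType} {V : zmodType} (a : V -> R).
Hypothesis aD : {morph a : x y / x + y}.
Implicit Types F G p q h : l1 R V.

Lemma a0 : a 0 = 0.
Proof. by have := aD 0 0; rewrite addr0; lra. Qed.

Lemma aN x : a (- x) = - a x.
Proof. by apply/eqP; rewrite -subr_eq0 opprK -aD addNr a0. Qed.

(** Translation of the Fourier transform: the transform of [tw t F] at s is that of [F] at s + t.
    The constant 2 in its norm bound comes from [nm_cis]. *)
Definition tw (t : R) F : l1 R V := l1mod (fun x => nm_cis (t * a x)) F.

Lemma twE t F x : tw t F x = cis (t * a x) * F x. Proof. by []. Qed.

Lemma twD t : {morph tw t : F G / F + G}.
Proof. by move=> F G; exact: l1modD. Qed.

Lemma twN t F : tw t (- F) = - tw t F.
Proof. exact: l1modN. Qed.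

Lemma twB t : {morph tw t : F G / F - G}.
Proof. by move=> F G; rewrite twD twN. Qed.

Lemma twM t : {morph tw t : F G / F * G}.
Proof. by move=> F G; apply: l1modM => x y; rewrite aD mulrDr cisD. Qed.

Lemma tw_delta0 t c : tw t (delta 0 c) = delta 0 c.
Proof. by rewrite [LHS]l1mod_delta a0 mulr0 cis0 mul1r. Qed.

Lemma tw1 t : tw t 1 = 1. Proof. exact: tw_delta0. Qed.

Lemma twX t F n : tw t (F ^+ n) = tw t F ^+ n.
Proof. by elim: n => [|n IH]; rewrite ?expr0 ?tw1// !exprS twM IH. Qed.

Lemma tw_norm t F : l1norm (tw t F) <= 2 * l1norm F.
Proof. exact: l1norm_mod. Qed.

Lemma tw_tw s t F : tw s (tw t F) = tw (s + t) F.
Proof. by apply: l1P => x; rewrite !twE mulrA -cisD mulrDl. Qed.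

Lemma tw0 F : tw 0 F = F.
Proof. by apply: l1P => x; rewrite twE mul0r cis0 mul1r. Qed.

Lemma twK t F : tw (- t) (tw t F) = F.
Proof. by rewrite tw_tw addNr tw0. Qed.

Lemma tw_lexp t F : tw t (lexp F) = lexp (tw t F).
Proof.
apply: (@lexp_morph _ _ (tw t) 2); [exact: twB|exact: twM| |exact: tw_norm].
by move=> r; exact: tw_delta0.
Qed.

Definition ft (t : R) F := aug (tw t F).

Lemma ftD t F G : ft t (F + G) = ft t F + ft t G.
Proof. by rewrite /ft twD augD. Qed.

Lemma ftN t F : ft t (- F) = - ft t F.
Proof. by rewrite /ft twN augN. Qed.

Lemma ftM t F G : ft t (F * G) = ft t F * ft t G.
Proof. by rewrite /ft twM augM. Qed.

Lemma ftX t F n : ft t (F ^+ n) = ft t F ^+ n.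
Proof. by rewrite /ft twX augX. Qed.

Lemma nm_ft t F : nm (ft t F) <= 2 * l1norm F.
Proof. exact: le_trans (nm_aug _) (tw_norm _ _). Qed.

Lemma ft_conj_refl t F : ft t (l1refl (l1conj F)) = (ft t F)^*.
Proof.
rewrite /ft /aug (csum_reindex _ (oppr_bij V)) -csum_conj; last exact: csummable_l1.
apply: eq_csum => x; rewrite !twE l1reflE l1conjE opprK aN mulrN cisN.
by rewrite rmorphM.
Qed.

Lemma csummable_restr (s : seq V) F : csummable (fun x => if x \in s then F x else 0).
Proof. by apply: (csummable_seq (s := s)) => x /negbTE ->. Qed.

Definition restr (s : seq V) F : l1 R V := mk_l1 (csummable_restr s F).

Lemma restrE s F x : restr s F x = if x \in s then F x else 0. Proof. by []. Qed.

Lemma restr_approx F (e : R) : 0 < e ->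
  exists2 s : seq V, uniq s & l1norm (F - restr s F) <= e.
Proof.
move=> e0; have [s us h] := rsum_approx (fun x => nm_ge0 (F x)) (csummable_l1 F) e0.
exists s => //; apply: le_trans h; rewrite /l1norm.
rewrite (_ : (fun x => _) = (fun x => if x \in s then 0 else nm (F x)))//.
by apply/funext => x; rewrite l1B restrE; case: ifP => _; rewrite ?subrr ?nm0 ?subr0.
Qed.

Lemma l1norm_seq F (s : seq V) : uniq s -> (forall x, x \notin s -> F x = 0) ->
  l1norm F = \sum_(x <- s) nm (F x).
Proof. by move=> us Fs; rewrite /l1norm (rsum_seq us)// => x /Fs ->; rewrite nm0. Qed.

Lemma ft_seq t F (s : seq V) : uniq s -> (forall x, x \notin s -> F x = 0) ->
  ft t F = \sum_(x <- s) cis (t * a x) * F x.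
Proof.
by move=> us Fs; rewrite /ft /aug (csum_seq us)// => x /Fs; rewrite twE => ->; rewrite mulr0.
Qed.

Lemma nm_geom (z : R) : cis z != 1 ->
  exists C : R, forall N, nm (\sum_(0 <= n < N) cis (n%:R * z)) <= C.
Proof.
move=> z1; exists (3 * nm (cis z - 1)^-1) => N.
have z10 : cis z - 1 != 0 by rewrite subr_eq0.
have -> : \sum_(0 <= n < N) cis (n%:R * z) = (cis (N%:R * z) - 1) * (cis z - 1)^-1.
  apply: (canRL (mulfK z10)); rewrite mulr_natl cisMn subrX1 mulrC big_mkord.
  by congr (_ * _); apply: eq_bigr => i _; rewrite mulr_natl cisMn.
apply: le_trans (nmM _ _) _; apply: ler_wpM2r => //.
apply: le_trans (nmB _ _) _; rewrite nm1; have := nm_cis (N%:R * z); lra.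
Qed.

(** The values of [a] at nonzero points avoid the multiples of 2 pi, so that the integer times
    already separate the points of [V]. *)
Hypothesis a_inj : forall x, x != 0 -> cis (a x) != 1.

(* The coefficient at x0 is the mean of ft n p * cis (- n * a x0) over n. *)
Lemma coef_le p (s : seq V) (B : R) : uniq s -> (forall x, x \notin s -> p x = 0) ->
  (forall n : nat, nm (ft n%:R p) <= B) -> forall x, nm (p x) <= 2 * B.
Proof.
move=> us ps pB x0; have [x0s|/ps ->] := boolP (x0 \in s); last first.
  by rewrite nm0; have := le_trans (nm_ge0 _) (pB 0%N); lra.
have /choice[C CP] (x : V) : exists C : R, x != x0 ->
    forall N, nm (\sum_(0 <= n < N) cis (n%:R * (a x - a x0))) <= C.
  have [->|xx0] := eqVneq x x0; first by exists 0.
  have := a_inj (x := x - x0); rewrite subr_eq0 aD aN => /(_ xx0)/nm_geom[C CP].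
  by exists C.
apply: (@le_of_natmul _ _ _ (\sum_(x <- s | x != x0) nm (p x) * C x)) => N.
have E : \sum_(0 <= n < N) cis (- (n%:R * a x0)) * ft n%:R p =
    N%:R * p x0 + \sum_(x <- s | x != x0) p x * \sum_(0 <= n < N) cis (n%:R * (a x - a x0)).
  under eq_bigr do rewrite (ft_seq _ us ps) mulr_sumr.
  rewrite exchange_big /= (bigD1_seq x0)//=; congr (_ + _).
    under eq_bigr do rewrite mulrA cisNK mul1r.
    by rewrite sumr_const_nat subn0 mulr_natl.
  apply: eq_bigr => x _; rewrite mulr_sumr; apply: eq_bigr => n _.
  by rewrite mulrA -cisD mulrC mulrBr addrC.
have : nm (N%:R * p x0) <= nm (\sum_(0 <= n < N) cis (- (n%:R * a x0)) * ft n%:R p) +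
    nm (\sum_(x <- s | x != x0) p x * \sum_(0 <= n < N) cis (n%:R * (a x - a x0))).
  by rewrite E -{1}[N%:R * p x0](addrK (\sum_(x <- s | x != x0)
    p x * \sum_(0 <= n < N) cis (n%:R * (a x - a x0)))); exact: nmB.
have -> : nm (N%:R * p x0) = N%:R * nm (p x0).
  elim: N {E} => [|N IH]; first by rewrite !mul0r nm0.
  case: (p x0) => u v; rewrite /nm; rewrite !mulr_natl.
  have -> : ((u +i* v) *+ N.+1) = (u *+ N.+1) +i* (v *+ N.+1).
    by elim: N.+1 => [|k IHk]; rewrite ?mulr0n// !mulrS IHk.
  by rewrite /= !normrMn mulrnDl.
move=> h; apply: le_trans h _; apply: lerD.
  apply: le_trans (nm_sum _ _) _.
  rewrite -[X in X%:R * _](subn0 N) mulr_natl -sumr_const_nat.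
  apply: ler_sum => n _; apply: le_trans (nmM _ _) _.
  by apply: ler_pM => //; exact: nm_cis.
rewrite -big_filter -[leRHS]big_filter; apply: le_trans (nm_sum _ _) _.
rewrite big_seq [leRHS]big_seq; apply: ler_sum => x.
rewrite mem_filter => /andP[xx0 _]; apply: le_trans (nmM _ _) _.
by apply: ler_wpM2l => //; exact: CP.
Qed.

(** Contains the support of the [k]-th power of any element supported on [s]. What matters is that
    its size is polynomial in [k]. *)
Definition bounded_combs (s : seq V) (k : nat) : seq V :=
  undup [seq \sum_(i < size s) s`_i *+ (f i : nat) | f : {ffun 'I_(size s) -> 'I_k.+1}].

Lemma size_bounded_combs s k : (size (bounded_combs s k) <= k.+1 ^ size s)%N.
Proof.
apply: leq_trans (size_undup _) _.
by rewrite size_map -cardE card_ffun !card_ord.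
Qed.

Lemma supp_expr q (s : seq V) k : (forall x, x \notin s -> q x = 0) ->
  forall x, x \notin bounded_combs s k -> (q ^+ k) x = 0.
Proof.
move=> qs x; apply: contraNeq => qx.
suff [f [fk ->]] : exists f : 'I_(size s) -> nat,
    (forall i, (f i <= k)%N) /\ x = \sum_(i < size s) s`_i *+ f i.
  rewrite mem_undup; apply/mapP; exists [ffun i => inord (f i)]; first by rewrite mem_enum.
  by apply: eq_bigr => i _; rewrite ffunE inordK// ltnS.
elim: k x qx => [|k IH] x.
  rewrite expr0 l1_1E; have [-> _|_ /eqP//] := eqVneq x 0.
  by exists (fun=> 0%N); split=> //; rewrite big1// => i _; rewrite mulr0n.
rewrite exprS l1ME => /eqP h.
have [y [qy qxy]] : exists y, q y <> 0 /\ (q ^+ k) (x - y) <> 0.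
  apply: contrapT => hn; apply: h; rewrite -(@csum0 R V); apply: eq_csum => y.
  have [e|/eqP q1] := eqVneq (q y) 0; first by rewrite e mul0r.
  have [e|/eqP q2] := eqVneq ((q ^+ k) (x - y)) 0; first by rewrite e mulr0.
  by exfalso; apply: hn; exists y.
have [f [fk fE]] := IH _ (introN eqP qxy).
have ys : y \in s by apply: contra_notT qy => /qs.
have iy : (index y s < size s)%N by rewrite index_mem.
exists (fun i => f i + (i == Ordinal iy))%N; split.
  by move=> i; rewrite -addn1 leq_add// leq_b1.
rewrite -[LHS](subrK y) fE.
under [RHS]eq_bigr do rewrite mulrnDr.
rewrite big_split /=; congr (_ + _).
rewrite (bigD1 (Ordinal iy))//= eqxx mulr1n nth_index// big1 ?addr0//.
by move=> i /negbTE ->; rewrite mulr0n.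
Qed.

(** For a finitely supported [q], [coef_le] bounds each coefficient of [q ^ k] by twice the [k]-th
    power of a bound of the transform, and there are only polynomially many of them. The general
    case follows by the binomial formula, [h] being such a [q] up to a small error. *)
Lemma spectral_radius h (rho : R) : rho < 1 -> (forall n : nat, nm (ft n%:R h) <= rho) ->
  exists N, l1norm (h ^+ N) < 1.
Proof.
move=> rho1 hrho; have rho0 : 0 <= rho := le_trans (nm_ge0 _) (hrho 0%N).
(* The transform of the truncation [q] exceeds rho by at most 2 e, and the remainder adds another e;
   rho + 3 e is still below 1. *)
pose e := (1 - rho) / 4; have e0 : 0 < e by rewrite divr_gt0// subr_gt0.
have [s us hs] := restr_approx h e0.
set q := restr s h in hs; pose r := rho + 2 * e.
have r0 : 0 <= r by rewrite /r; lra.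
have qs x : x \notin s -> q x = 0 by rewrite restrE => /negbTE ->.
have qr n : nm (ft n%:R q) <= r.
  have := ftD n%:R h (q - h); rewrite addrC subrK => ->.
  apply: le_trans (nmD _ _) _; apply: lerD => //.
  apply: le_trans (nm_ft _ _) _; by rewrite ler_pM2l// l1normBC.
have qk k : l1norm (q ^+ k) <= 2 * k.+1%:R ^+ size s * r ^+ k.
  have ub := undup_uniq [seq \sum_(i < size s) s`_i *+ (f i : nat) | f : {ffun 'I_(size s) -> 'I_k.+1}].
  have sb := supp_expr (k := k) qs.
  rewrite (l1norm_seq ub sb).
  apply: (@le_trans _ _ (\sum_(x <- bounded_combs s k) 2 * r ^+ k)).
    apply: ler_sum => x _; apply: (coef_le ub sb) => n.
    by rewrite ftX; apply: le_trans (nmX _ _) _; apply: lerXn2r; rewrite ?nnegrE.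
  rewrite big_const_seq count_predT iter_addr_0 -[leLHS]mulr_natl mulrCA mulrA.
  rewrite ler_wpM2r ?exprn_ge0// ler_wpM2l// -natrX ler_nat.
  exact: size_bounded_combs.
have re1 : r + e < 1 by rewrite /r /e; lra.
have re0 : 0 <= r + e by rewrite addr_ge0// ltW.
have [N NP] := poly_expr_small (size s) re0 re1.
exists N; apply: le_lt_trans NP.
rewrite -(subrK q h) addrC exprDn; apply: le_trans (l1norm_sum _ _) _.
rewrite exprDn mulr_sumr; apply: ler_sum => i _.
set d := h - q in hs *.
have im : (N - i <= N)%N by exact: leq_subr.
have natmul (A : l1 R V) k : l1norm (A *+ k) <= l1norm A *+ k.
  elim: k => [|k IH]; rewrite ?mulr0n ?l1norm0// !mulrS.
  by apply: le_trans (l1normD _ _) _; rewrite lerD2l.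
apply: le_trans (natmul _ _) _; rewrite mulrnAr lerMn2r; apply/orP; right.
apply: le_trans (l1normM _ _) _.
rewrite mulrA; apply: (ler_pM (l1norm_ge0 _) (l1norm_ge0 _)).
  apply: le_trans (qk _) _; apply: ler_wpM2r; first exact: exprn_ge0.
  by rewrite ler_wpM2l// lerXn2r ?nnegrE// ler_nat.
apply: le_trans (l1normX _ _) _.
by apply: lerXn2r; rewrite ?nnegrE ?l1norm_ge0// ltW.
Qed.

Lemma wiener_real G (d M : R) (r : nat -> R) : 0 < d ->
  (forall n, ft n%:R G = (r n)%:C) -> (forall n, d <= r n <= M) ->
  exists G', G * G' = 1.
Proof.
move=> d0 Gr rdM; have /andP[dr rM] := rdM 0%N.
have M0 : 0 < M by lra.
pose h := 1 - econst M^-1 * G.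
have ft1 n : ft n%:R h = (1 - M^-1 * r n)%:C.
  rewrite /h ftD ftN ftM Gr /ft tw1 aug1 tw_delta0 aug_delta.
  by apply/eqP; rewrite eq_complex /=; apply/andP; split; apply/eqP; ring.
have rho1 : 1 - M^-1 * d < 1 by rewrite ltrBlDr ltrDl mulr_gt0// invr_gt0.
have [n|N hN] := spectral_radius rho1 (h := h).
  rewrite ft1 nm_real ger0_norm.
    by rewrite lerD2l lerN2 ler_pM2l ?invr_gt0//; have /andP[] := rdM n.
  rewrite subr_ge0 mulrC ler_pdivrMr// mul1r; by have /andP[] := rdM n.
have [g gP] := l1_neumann hN.
(* [g] inverts 1 - h ^ N, which is 1 - h, that is G / M, times the geometric sum. *)
exists (econst M^-1 * (\sum_(i < N) h ^+ i) * g).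
have : (1 - h) * (\sum_(i < N) h ^+ i) = 1 - h ^+ N.
  by rewrite -opprB mulNr -subrX1 opprB.
rewrite {1}/h opprB addrC subrK => e.
by rewrite -gP -e; ring.
Qed.

(* Wiener's lemma: the product of F and its conjugate reflection has a real
   transform with values in some [d, M], so that, once divided by M, it differs
   from 1 by an element of spectral radius less than 1. *)
Lemma wiener F (d : R) : 0 < d ->
  (forall n : nat, d <= complex.Re (ft n%:R F) ^+ 2 + complex.Im (ft n%:R F) ^+ 2) ->
  exists G, F * G = 1.
Proof.
move=> d0 Fd; pose r n := complex.Re (ft n%:R F) ^+ 2 + complex.Im (ft n%:R F) ^+ 2.
have ftr n : ft n%:R (F * l1refl (l1conj F)) = (r n)%:C.
  rewrite ftM ft_conj_refl /r; case: (ft n%:R F) => u v /=.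
  by apply/eqP; rewrite eq_complex /=; apply/andP; split; apply/eqP; ring.
have [n|G GP] := wiener_real d0 ftr (M := (2 * l1norm F) ^+ 2).
  rewrite Fd /=; have := nm_ft n%:R F; rewrite /r; case: (ft n%:R F) => u v /=.
  rewrite /nm /= => h; apply: (@le_trans _ _ ((`|u| + `|v|) ^+ 2)).
    rewrite -[u ^+ 2]real_normK ?num_real// -[v ^+ 2]real_normK ?num_real//.
    have := normr_ge0 u; have := normr_ge0 v; nra.
  by apply: lerXn2r; rewrite ?nnegrE ?addr_ge0 ?mulr_ge0 ?l1norm_ge0.
by exists (l1refl (l1conj F) * G); rewrite mulrA.
Qed.

End twist.

(** * Exponential form of invertible elements *)

Section finite_representatives.

Lemma finite_repr (T : Type) (I : finType) (g : T -> I) (D : set T) :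
  exists ts : seq T, forall t, D t -> exists2 t', List.In t' ts & D t' /\ g t = g t'.
Proof.
suff [ts tsP] : exists ts : seq T, forall i, i \in enum I -> forall t, D t -> g t = i ->
    exists2 t', List.In t' ts & D t' /\ g t' = i.
  exists ts => t Dt; have [|t' t1 [t2 t3]] := tsP (g t) _ t Dt erefl.
    by rewrite mem_enum.
  by exists t'.
elim: (enum I) => [|i s [ts IH]]; first by exists [::].
have [[t [Dt ti]]|hn] := pselect (exists t, D t /\ g t = i).
  exists (t :: ts) => j; rewrite inE => /predU1P[->|js] u Du uj.
    by exists t => //; left.
  by have [t' t1 t2] := IH j js u Du uj; exists t' => //; right.
exists ts => j; rewrite inE => /predU1P[->|js] u Du uj; last exact: IH js u Du uj.
by exfalso; apply: hn; exists u.
Qed.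

End finite_representatives.

(** * Almost periodicity: the twists of a summable family form a totally bounded set *)

Section total_boundedness.
Context {R : realType} {V : zmodType} (a : V -> R).
Implicit Types F G : l1 R V.

Lemma cell_lt (M : nat) (u : R) : -1 <= u <= 1 ->
  (Num.truncn ((u + 1) * M%:R) < (2 * M).+1)%N.
Proof.
move=> /andP[u1 u2]; rewrite ltnS -(ler_nat R).
have h : 0 <= (u + 1) * M%:R by rewrite mulr_ge0//; lra.
rewrite -(truncn_le ((u + 1) * M%:R)) in h; apply: le_trans h _.
by rewrite natrM ler_wpM2r//; lra.
Qed.

Lemma cell_close (M : nat) (u v : R) : -1 <= u <= 1 -> -1 <= v <= 1 -> (0 < M)%N ->
  Num.truncn ((u + 1) * M%:R) = Num.truncn ((v + 1) * M%:R) -> `|u - v| <= M%:R^-1.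
Proof.
move=> /andP[u1 u2] /andP[v1 v2] M0 e.
have h (w : R) : -1 <= w -> 0 <= (w + 1) * M%:R by move=> w1; rewrite mulr_ge0//; lra.
have /andP[hu1 hu2] := truncn_itv (h u u1).
have /andP[hv1 hv2] := truncn_itv (h v v1).
have M1 : 0 < M%:R :> R by rewrite ltr0n.
rewrite -[leRHS]div1r ler_pdivlMr// -[X in _ * X](ger0_norm (ltW M1)) -normrM.
rewrite e in hu1 hu2; rewrite -natr1 in hu2; rewrite -natr1 in hv2.
rewrite ler_norml; apply/andP; split; lra.
Qed.

Lemma tw_approx (s : seq V) F (e c t t' : R) : uniq s ->
  l1norm (F - restr s F) <= e ->
  0 <= c -> (forall x, x \in s -> nm (cis (t * a x) - cis (t' * a x)) <= c) ->
  l1norm (tw a t F - tw a t' F) <= c * l1norm F + 4 * e.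
Proof.
move=> us se c0 sc.
rewrite (_ : _ - _ = (tw a t (restr s F) - tw a t' (restr s F)) +
   (tw a t (F - restr s F) - tw a t' (F - restr s F))); last first.
  by rewrite !twB; ring.
apply: le_trans (l1normD _ _) _; apply: lerD; last first.
  apply: le_trans (l1normB _ _) _.
  have := tw_norm a t (F - restr s F); have := tw_norm a t' (F - restr s F).
  by lra.
rewrite (l1norm_seq us); last first.
  by move=> x /negbTE xs; rewrite l1B !twE restrE xs !mulr0 subr0.
rewrite /l1norm.
apply: le_trans (_ : _ <= \sum_(x <- s) c * nm (F x)) _.
  rewrite big_seq [leRHS]big_seq; apply: ler_sum => x xs.
  rewrite l1B !twE restrE xs -mulrBl; apply: le_trans (nmM _ _) _.
  by apply: ler_wpM2r => //; exact: sc.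
rewrite -mulr_sumr.
by apply: ler_wpM2l => //; apply: rsum_seq_le => //; exact: csummable_l1.
Qed.

(** Up to a small tail [F] has finite support, and its twist is then given by finitely many points
    of the circle, which are sorted into finitely many cells. Representatives are taken in [D], so
    integer times get integer representatives. *)
Lemma tw_totally_bounded F (e : R) (D : set R) : 0 < e ->
  exists ts : seq R, forall t, D t ->
    exists2 t', List.In t' ts & D t' /\ l1norm (tw a t F - tw a t' F) <= e.
Proof.
move=> e0; have e8 : 0 < e / 8 by rewrite divr_gt0.
have [s us se] := restr_approx F e8.
set n1 := l1norm F; have n0 : 0 <= n1 := l1norm_ge0 F.
(* Sharing all cells costs at most 2 / M at each point of [s], hence e / 2 in norm; the tails cost 4
   (e / 8). *)
pose M := (Num.bound (4 * n1 / e)).+1.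
have M0 : 0 < M%:R :> R by rewrite ltr0n.
have MP : 4 * n1 / e <= M%:R.
  have h0 : 0 <= 4 * n1 / e by rewrite divr_ge0 ?mulr_ge0// ltW.
  by apply: le_trans (ltW (archi_boundP h0)) _; rewrite ler_nat.
pose cell (u : R) : 'I_(2 * M).+1 := inord (Num.truncn ((u + 1) * M%:R)).
pose g (t : R) : {ffun 'I_(size s) -> 'I_(2 * M).+1 * 'I_(2 * M).+1} :=
  [ffun i : 'I_(size s) => (cell (cos (t * a s`_i)), cell (sin (t * a s`_i)))].
have [ts tsP] := finite_repr g D.
exists ts => t Dt; have [t' t'ts [Dt' gt]] := tsP t Dt; exists t' => //; split=> //.
have cosb (z : R) : -1 <= cos z <= 1 by rewrite cos_geN1 cos_le1.
have sinb (z : R) : -1 <= sin z <= 1 by rewrite sin_geN1 sin_le1.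
have cellP u v : -1 <= u <= 1 -> -1 <= v <= 1 -> cell u = cell v -> `|u - v| <= M%:R^-1.
  move=> hu hv /(congr1 val) /=; rewrite !inordK; try exact: cell_lt.
  exact: cell_close.
apply: le_trans (tw_approx (c := 2 / M%:R) us se _ _) _.
- by rewrite divr_ge0// ltW.
- move=> x xs; have ix : (index x s < size s)%N by rewrite index_mem.
  have := congr1 (fun f : {ffun _ -> _} => f (Ordinal ix)) gt.
  rewrite !ffunE /= nth_index// => -[c1 c2].
  have h1 := cellP _ _ (cosb _) (cosb _) c1.
  have h2 := cellP _ _ (sinb _) (sinb _) c2.
  by rewrite /nm /cis /=; lra.
- have : 2 / M%:R * n1 <= e / 2.
    rewrite mulrAC ler_pdivrMr//; move: MP; rewrite ler_pdivrMr//; lra.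
  rewrite -/n1; lra.
Qed.

Lemma cis_continuous0 (c : R) : 0 < c ->
  exists2 d : R, 0 < d & forall u, `|u| <= d -> nm (cis u - 1) <= c.
Proof.
move=> c0; have c2 : 0 < c / 2 by rewrite divr_gt0.
have /cvgrPdist_le/(_ _ c2)/nbhs_ballP[d1 /= d10 h1] := @continuous_cos R 0.
have /cvgrPdist_le/(_ _ c2)/nbhs_ballP[d2 /= d20 h2] := @continuous_sin R 0.
exists (Num.min d1 d2 / 2); first by rewrite divr_gt0// lt_min d10.
move=> u; rewrite ler_pdivlMr// => ud.
have d12 : 0 < Num.min d1 d2 by rewrite lt_min d10.
have um : `|u| < Num.min d1 d2.
  by have := normr_ge0 u; rewrite le_eqVlt => /predU1P[<-//|]; lra.
move: um; rewrite lt_min => /andP[u1 u2].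
have := h1 u; have := h2 u; rewrite /ball /= sub0r normrN cos0 sin0 sub0r normrN.
move=> /(_ u2) s2 /(_ u1) s1.
by rewrite /nm /= subr0 distrC; lra.
Qed.

Lemma tw_continuous F (e : R) : 0 < e ->
  exists2 d : R, 0 < d & forall t, `|t| <= d -> l1norm (tw a t F - F) <= e.
Proof.
move=> e0; have e8 : 0 < e / 8 by rewrite divr_gt0.
have [s us se] := restr_approx F e8.
set n1 := l1norm F in se *; have n0 : 0 <= n1 := l1norm_ge0 F.
pose A := \sum_(x <- s) `|a x|; have A0 : 0 <= A by exact: sumr_ge0.
pose c := e / (2 * (n1 + 1)).
have c0 : 0 < c by rewrite divr_gt0// mulr_gt0//; lra.
have [d d0 dP] := cis_continuous0 c0.
exists (d / (A + 1)); first by rewrite divr_gt0//; lra.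
move=> t; rewrite ler_pdivlMr; last by lra.
move=> td; rewrite -{2}(tw0 a F).
apply: le_trans (tw_approx us se (ltW c0) _) _.
  move=> x xs; rewrite mul0r cis0; apply: dP; rewrite normrM; apply: le_trans td.
  apply: ler_wpM2l => //; apply: (@le_trans _ _ A); last by lra.
  by rewrite /A (big_rem x)//= lerDl; exact: sumr_ge0.
have : c * n1 <= e / 2.
  have : c * (2 * (n1 + 1)) = e by rewrite /c divfK// gt_eqF// mulr_gt0//; lra.
  nra.
rewrite -/n1; lra.
Qed.

End total_boundedness.

(** * From small logarithms of the quotients T_t F / F to a logarithm of F *)

Section exponential_form.
Context {R : realType} {V : zmodType} (a : V -> R).
Hypothesis aD : {morph a : x y / x + y}.
Hypothesis a_inj : forall x, x != 0 -> cis (a x) != 1.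
Implicit Types F G : l1 R V.

Let T := tw a.

Section fixed_F.
Variables F G : l1 R V.
Hypothesis FG : F * G = 1.
Hypothesis T1F : l1norm (T 1 F - F) * l1norm G <= 1 / 32.

(** Nearness to a period puts T_t F * G within 1/32 of 1, so that its logarithm has norm at most
    1/16. In [consistency] the four terms then add up to at most 6/16, below the bound 1/2 of
    [lexp_inj]. *)
Let near t := l1norm (T t F - F) * l1norm G <= 1 / 32.

Let sigma_ex t : exists s : l1 R V, near t ->
  lexp s = T t F * G /\ l1norm s <= 1 / 16.
Proof.
have [nt|] := pselect (near t); last by exists 0.
have h : l1norm (T t F * G - 1) <= 1 / 32.
  rewrite -FG -mulrBl; exact: le_trans (l1normM _ _) nt.
have [|s s1 s2] := @lexp_surj _ _ (T t F * G); first by lra.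
by exists s => _; split => //; lra.
Qed.

Let sigma t := sval (cid (sigma_ex t)).

Let sigmaP t : near t -> lexp (sigma t) = T t F * G.
Proof. by move=> nt; rewrite /sigma; case: cid => /= s /(_ nt)[]. Qed.

Let sigma_le t : near t -> l1norm (sigma t) <= 1 / 16.
Proof. by move=> nt; rewrite /sigma; case: cid => /= s /(_ nt)[]. Qed.

Let s1 := sigma 1.

Let near1 : near 1. Proof. exact: T1F. Qed.

Let TFG t : T t F * T t G = 1.
Proof. by rewrite -twM// FG tw1. Qed.

(** T 1 (sigma t) + s1 and T t s1 + sigma t are both small logarithms of T_(t+1) F / F, so they
    coincide. *)
Let consistency t : near t -> T 1 (sigma t) - sigma t = T t s1 - s1.
Proof.
move=> nt; suff : T 1 (sigma t) + s1 = T t s1 + sigma t.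
  by move=> e; apply/eqP; rewrite subr_eq addrAC -e addrK.
apply: lexp_inj.
  apply: le_lt_trans (l1normB _ _) _.
  have := l1normD (T 1 (sigma t)) s1; have := l1normD (T t s1) (sigma t).
  have := tw_norm a 1 (sigma t); have := tw_norm a t s1.
  have := sigma_le nt; have := sigma_le near1; rewrite /T -/s1.
  move: (l1norm (tw _ _ _)) (l1norm (tw _ _ _)) (l1norm s1) (l1norm (sigma t))
    (l1norm (_ + _)) (l1norm (_ + _)) => *; lra.
rewrite !lexpD /T -!(tw_lexp aD) sigmaP// (sigmaP near1) !(twM aD) -/T.
rewrite /T !tw_tw -/T [1 + t]addrC.
transitivity (T (t + 1) F * G * (T 1 F * T 1 G)); first by ring.
by rewrite TFG -(TFG t); ring.
Qed.

(** The coordinatewise solution of T_1 lam - lam = s1. At 0 the divisor vanishes; the coordinate s1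
    0 is carried by the constant in [s1_lam]. *)
Let lam_fun x : R[i] := if x == 0 then 0 else s1 x / (cis (a x) - 1).

Let sigma_lam t x : near t -> x != 0 -> sigma t x = (cis (t * a x) - 1) * lam_fun x.
Proof.
move=> nt x0; rewrite /lam_fun (negbTE x0) mulrA.
have z0 : cis (a x) - 1 != 0 by rewrite subr_eq0 a_inj.
apply: (canRL (mulfK z0)).
have := congr1 (fun b : l1 R V => b x) (consistency nt).
by rewrite !l1B !twE mul1r mulrBl mul1r mulrBr mulr1 mulrC.
Qed.

(** The part over [X] of the norm of T_t lam - lam. Finite sets are used because the summability of
    [lam_fun] is what has to be proved. *)
Let NX (X : seq V) t := \sum_(x <- X) nm ((cis (t * a x) - 1) * lam_fun x).

Let NX_near X t : uniq X -> near t -> NX X t <= 1 / 16.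
Proof.
move=> uX nt; apply: le_trans (sigma_le nt).
apply: le_trans (rsum_seq_le uX (fun x => nm_ge0 (sigma t x)) (csummable_l1 (sigma t))).
apply: ler_sum => x _; have [->|x0] := eqVneq x 0.
  by rewrite {1}/lam_fun eqxx mulr0 nm0.
by rewrite (sigma_lam nt x0).
Qed.

Let NX_add X s t : NX X (s + t) <= 2 * NX X s + NX X t.
Proof.
rewrite /NX mulr_sumr -big_split; apply: ler_sum => x _ /=.
have -> : (cis ((s + t) * a x) - 1) * lam_fun x =
    cis (t * a x) * ((cis (s * a x) - 1) * lam_fun x) + (cis (t * a x) - 1) * lam_fun x.
  by rewrite [(s + t) * a x]mulrDl cisD; ring.
apply: le_trans (nmD _ _) _; rewrite lerD2r.
by apply: le_trans (nmM _ _) _; rewrite ler_wpM2r// nm_cis.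
Qed.

Let NX_nat X n : uniq X -> NX X n%:R <= n%:R / 8.
Proof.
move=> uX; elim: n => [|n IH].
  rewrite mul0r /NX big1// => x _; by rewrite mul0r cis0 subrr mul0r nm0.
(* Writing 1 + n puts the factor 2 of [NX_add] on the step 1, so that the growth is linear. *)
rewrite -natr1 addrC; apply: le_trans (NX_add _ _ _) _.
by have := NX_near uX near1; lra.
Qed.

(** Every integer n has a representative m, among finitely many, with T_n F close to T_m F. Then n -
    m is near a period and costs 1/16, while m costs at most m / 8; the bound depends neither on [X]
    nor on n. *)
Let NX_bounded : exists B, forall X n, uniq X -> NX X n%:R <= B.
Proof.
(* Twisting back by - m doubles the distance, and 2 e times the norm of [G] must not exceed 1/32. *)
pose e := (64 * (l1norm G + 1))^-1.
have g0 := l1norm_ge0 G.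
have e0 : 0 < e by rewrite invr_gt0 mulr_gt0//; lra.
have eP : e * (64 * (l1norm G + 1)) = 1.
  by rewrite /e mulVf// gt_eqF// mulr_gt0//; lra.
have [ts tsP] := tw_totally_bounded a F [set t | exists n : nat, t = n%:R] e0.
exists (1 / 8 + \sum_(t <- ts) `|t|) => X n uX.
have [t' t'ts [[m mE] h]] := tsP n%:R (ex_intro _ n erefl).
rewrite {t'}mE in t'ts h.
have nt : near (n%:R - m%:R).
  rewrite /near; have -> : T (n%:R - m%:R) F - F = T (- m%:R) (T n%:R F - T m%:R F).
    by rewrite /T twB !tw_tw addNr tw0 [- m%:R + _]addrC.
  have h2 : l1norm (T (- m%:R) (T n%:R F - T m%:R F)) <= 2 * e.
    by apply: le_trans (tw_norm _ _ _) _; rewrite ler_pM2l.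
  apply: le_trans (ler_wpM2r g0 h2) _; nra.
rewrite -(subrK m%:R n%:R); apply: le_trans (NX_add _ _ _) _.
have := NX_near uX nt; have := NX_nat m uX.
have : m%:R <= \sum_(t <- ts) `|t|.
  elim: (ts) t'ts => [//|t ts' IH] /= [->|/IH {}IH]; rewrite big_cons.
    by rewrite ger0_norm// lerDl sumr_ge0.
  by apply: le_trans IH _; rewrite lerDr.
have : 0 <= m%:R :> R by [].
lra.
Qed.

(** For x != 0 the numbers cis(n a(x)) have mean 0 over n, so lam(x) is minus the mean of (cis(n
    a(x)) - 1) lam(x). Averaging the bound on [NX] over n therefore bounds every finite sum of
    |lam|. *)
Let csummable_lam : csummable lam_fun.
Proof.
have [B BP] := NX_bounded.
apply: (proj1 (@rsummable_bounded R V (fun x => nm (lam_fun x)) B _ _)) => // X uX.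
have /choice[C CP] (x : V) : exists C : R, x != 0 ->
    forall N, nm (\sum_(0 <= n < N) cis (n%:R * a x)) <= C.
  have [->|/a_inj/nm_geom[C CP]] := eqVneq x 0; first by exists 0.
  by exists C.
apply: (@le_of_natmul _ _ _ (\sum_(x <- X) nm (lam_fun x) * C x)) => N.
have natnm z : nm (z *+ N) = nm z *+ N.
  case: z => u v; have -> : (u +i* v) *+ N = (u *+ N) +i* (v *+ N).
    by elim: N => [|k IHk]; rewrite ?mulr0n// !mulrS IHk.
  by rewrite /nm /= !normrMn mulrnDl.
have key x : nm (lam_fun x) *+ N <=
    \sum_(0 <= n < N) nm ((cis (n%:R * a x) - 1) * lam_fun x) + nm (lam_fun x) * C x.
  have [->|x0] := eqVneq x 0.
    rewrite /lam_fun eqxx nm0 mul0r mul0rn addr0; exact: sumr_ge0.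
  rewrite -natnm.
  have -> : lam_fun x *+ N = lam_fun x * (\sum_(0 <= n < N) cis (n%:R * a x)) -
      \sum_(0 <= n < N) (cis (n%:R * a x) - 1) * lam_fun x.
    rewrite -mulr_suml sumrB sumr_const_nat subn0 mulrC -mulrBl opprB addrC subrK.
    by rewrite mulr_natl.
  apply: le_trans (nmB _ _) _; rewrite addrC; apply: lerD; first exact: nm_sum.
  by apply: le_trans (nmM _ _) _; apply: ler_wpM2l => //; exact: CP.
rewrite mulr_natl -sumrMnl; apply: le_trans (ler_sum _ (fun x _ => key x)) _.
rewrite big_split /= lerD2r exchange_big /=.
rewrite -[X in X%:R * _](subn0 N) mulr_natl -sumr_const_nat.
by apply: ler_sum => n _; exact: BP.
Qed.

Let lam : l1 R V := mk_l1 csummable_lam.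

(** A family fixed by T_1 lives at 0, because cis(a x) != 1 elsewhere; the exponential of a fixed
    family is fixed. *)
Let lexp_delta0 z : exists w, lexp (delta 0 z : l1 R V) = delta 0 w.
Proof.
exists (lexp (delta 0 z : l1 R V) 0); apply: l1P => x; rewrite deltaE; case: eqVneq => [->//|x0].
have := congr1 (fun b : l1 R V => b x) (tw_lexp aD 1 (delta 0 z : l1 R V)).
rewrite /= tw_delta0// mul1r => /eqP; rewrite -subr_eq0 -{2}[lexp _ x]mul1r -mulrBl.
by rewrite mulf_eq0 subr_eq0 (negbTE (a_inj x0)) => /eqP.
Qed.

Let s1_lam : exists z, s1 = delta 0 z + (T 1 lam - lam).
Proof.
exists (s1 0); apply: l1P => x; rewrite l1D l1B deltaE twE mul1r /=.
have [->|x0] := eqVneq x 0.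
  by rewrite /lam_fun eqxx mulr0 subr0 addr0.
by rewrite add0r (sigma_lam near1 x0) mul1r mulrBl mul1r.
Qed.

(* Q = F exp (- lam) satisfies T 1 Q = w Q, so that the character x |-> cis (a x)
   is constant on its support, which is therefore a single point. *)
Let F_lam : exists g c, F = delta g c * lexp lam.
Proof.
have [z s1E] := s1_lam; have [w wE] := lexp_delta0 z.
pose Q := F * lexp (- lam).
have QF : Q * lexp lam = F by rewrite /Q -mulrA lexpNK mulr1.
have T1E : T 1 F = F * lexp s1.
  by rewrite (sigmaP near1) mulrCA FG mulr1.
have TQ : T 1 Q = delta 0 w * Q.
  rewrite /Q /T (twM aD) (tw_lexp aD) -/T T1E s1E !lexpD wE.
  have e : T 1 (- lam) = - T 1 lam by exact: twN.
  rewrite e; have := lexpNK (T 1 lam); set u := lexp (- T 1 lam) => uE.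
  transitivity (delta 0 w * (F * lexp (- lam)) * (u * lexp (T 1 lam))); first by ring.
  by rewrite uE mulr1.
have TQx x : cis (a x) * Q x = w * Q x.
  have := congr1 (fun b : l1 R V => b x) TQ.
  by rewrite twE mul1r delta_conv_rew subr0.
have [g Qg] : exists g, Q g != 0.
  apply: contrapT => h; have Q0 : Q = 0.
    by apply: l1P => x; apply/eqP; apply: contrapT => /negP hx; apply: h; exists x.
  by move: FG; rewrite -QF Q0 !mul0r => /eqP; rewrite eq_sym oner_eq0.
exists g, (Q g); rewrite -{1}QF; congr (_ * _); apply: l1P => x; rewrite deltaE.
have [->//|xg] := eqVneq x g.
apply/eqP; apply: contrapT => /negP Qx.
have ex : cis (a x) = cis (a g).
  by rewrite (mulIf Qx (TQx x)) (mulIf Qg (TQx g)).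
have := a_inj (x := x - g); rewrite subr_eq0 xg => /(_ isT).
rewrite aD (aN aD) cisD cisN ex -cisN mulrC cisNK.
by rewrite eqxx.
Qed.

Hypothesis Freal : l1conj F = F.

Let conj1 : l1conj 1 = 1 :> l1 R V.
Proof. by apply: l1P => x; rewrite l1conjE l1_1E; case: ifP => _; rewrite ?rmorph1 ?rmorph0. Qed.

Let Greal : l1conj G = G.
Proof.
have : F * l1conj G = 1 by rewrite -{1}Freal -l1conjM FG conj1.
by move=> e; rewrite -[LHS]mulr1 -FG mulrCA mulrA e mul1r.
Qed.

Let conj_lexp u : l1conj (lexp u) = lexp (l1conj u) :> l1 R V.
Proof.
apply: (@lexp_morph _ _ (@l1conj R V) 1).
- by move=> b c; rewrite l1conjD l1conjN.
- by move=> b c; rewrite l1conjM.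
- move=> r; apply: l1P => x; rewrite l1conjE deltaE; case: ifP => _; rewrite ?rmorph0//.
  by apply/eqP; rewrite eq_complex /= oppr0 !eqxx.
- by move=> b; rewrite l1norm_conj mul1r.
Qed.

Let conj_tw t u : l1conj (T t u) = T (- t) (l1conj u).
Proof. by apply: l1P => x; rewrite !l1conjE !twE rmorphM mulNr cisN. Qed.

(** For real F, the conjugate of s1 is a logarithm of T_(-1) F / F, and T_(-1) s1 is one of F /
    T_(-1) F. Both are small, so they are opposite. *)
Let conj_s1 : l1conj s1 = - T (- 1) s1.
Proof.
have n1 := sigma_le near1.
apply: lexp_inj.
  apply: le_lt_trans (l1normB _ _) _; rewrite l1normN l1norm_conj.
  by have := tw_norm a (-1) s1; rewrite -/T -/s1 in n1 *; lra.
rewrite -conj_lexp (sigmaP near1) l1conjM Greal conj_tw Freal.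
set v := lexp (- _).
have vE : v * lexp (T (- 1) s1) = 1 by rewrite /v lexpNK.
rewrite /T -(tw_lexp aD) (sigmaP near1) (twM aD) twK in vE.
rewrite -[LHS]mul1r -vE.
transitivity (v * (F * G) * (T (-1) F * T (-1) G)); first by rewrite /T; ring.
by rewrite FG TFG !mulr1.
Qed.

Let lam_real : l1conj lam = lam.
Proof.
apply: l1P => x; rewrite l1conjE.
have [->|x0] := eqVneq x 0; first by rewrite /= /lam_fun eqxx; apply/eqP; rewrite eq_complex /= oppr0 !eqxx.
have z0 : cis (a x) - 1 != 0 by rewrite subr_eq0 a_inj.
have c0 : cis (- a x) - 1 != 0.
  rewrite subr_eq0; apply: contra z0 => /eqP ce.
  by have := cisNK (a x); rewrite ce mul1r => ->; rewrite subrr.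
have lE : lam x * (cis (a x) - 1) = s1 x by rewrite /= /lam_fun (negbTE x0) divfK.
have := congr1 (fun b : l1 R V => b x) conj_s1.
rewrite l1conjE l1N twE mulN1r -lE => e.
have {}e : conjc (lam x * (cis (a x) - 1)) = - (cis (- a x) * (lam x * (cis (a x) - 1))).
  exact: e.
have cM (z w : R[i]) : conjc (z * w) = conjc z * conjc w by exact: rmorphM.
have cE : conjc (cis (a x) - 1) = cis (- a x) - 1.
  by rewrite cisN; apply/eqP; rewrite eq_complex /= eqxx /=; apply/eqP; ring.
move: e; rewrite cM cE; have := cisNK (a x).
move: (cis (- a x)) (cis (a x)) (lam x) c0 => v u l v0 vu e.
apply: (mulIf v0); rewrite e.
(* Since v u = 1, the right-hand side is l (v - 1); cancelling v - 1 leaves that l equals its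
   conjugate. *)
transitivity (l * (v - v * u)); first by ring.
by rewrite vu.
Qed.

Lemma exponential_form : exists lam g c, l1conj lam = lam /\ F = delta g c * lexp lam.
Proof. by have [g [c FE]] := F_lam; exists lam, g, c. Qed.

End fixed_F.
End exponential_form.

(** * Probability measures on row vectors *)

Section measurable_rows.
Context {R : realType} {m : nat}.
Local Notation W := 'rV[R]_m.

Lemma measurable_row (i : 'I_m) : measurable_fun [set: W] (fun v : W => v ord0 i).
Proof.
move=> _ Y mY; rewrite setTI; apply: sub_sigma_algebra => /=.
rewrite -bigcup_seq/=; exists i => /=; first by rewrite mem_index_enum.
by exists Y => //; rewrite setTI.
Qed.

Lemma measurable_fun_row d (T : measurableType d) (f : T -> W) :
  (forall i, measurable_fun [set: T] (fun t => f t ord0 i)) -> measurable_fun [set: T] f.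
Proof.
move=> mf.
have : g_sigma_preimage (fun i => (fun v : W => v ord0 i) \o f) `<=` measurable.
  apply: smallest_sub; first exact: sigma_algebra_measurable.
  rewrite -bigcup_seq => A [i _ [B mB <-]]; exact: mf.
by rewrite g_sigma_preimage_comp => h _ A mA; apply: h; exists A.
Qed.

Lemma measurable_addrow : measurable_fun [set: W * W] (fun p : W * W => p.1 + p.2).
Proof.
apply: measurable_fun_row => i.
rewrite (_ : (fun t => _) = (fun t : W * W => t.1 ord0 i + t.2 ord0 i)); last first.
  by apply/funext => t; rewrite mxE.
apply: measurable_funD.
  by apply: (measurableT_comp (measurable_row i)); exact: measurable_fst.
by apply: (measurableT_comp (measurable_row i)); exact: measurable_snd.
Qed.

Lemma measurable_le_row (i : 'I_m) (r : R) : measurable [set v : W | v ord0 i <= r].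
Proof.
have := @measurable_row i measurableT _ (measurable_itv `]-oo, r]).
rewrite setTI (_ : _ @^-1` _ = [set v : W | v ord0 i <= r])//.
Qed.

Lemma measurable_orthant (x : W) : measurable (orthant x).
Proof.
rewrite (_ : orthant x = \bigcap_(i in [set: 'I_m]) [set v : W | v ord0 i <= x ord0 i]).
  by apply: fin_bigcap_measurable => // i _; exact: measurable_le_row.
by apply/seteqP; split => v /= h i; [move=> _; exact: h|exact: h].
Qed.

Lemma measurable_set1_row (x : W) : measurable [set x].
Proof.
rewrite (_ : [set x] = \bigcap_(i in [set: 'I_m]) [set v : W | v ord0 i = x ord0 i]).
  apply: fin_bigcap_measurable => // i _.
  have := @measurable_row i measurableT _ (measurable_set1 (x ord0 i)).
  by rewrite setTI.
apply/seteqP; split => [v /= -> //|v h].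
by apply/rowP => i; exact: (h i).
Qed.

Lemma measurable_countable_row (A : set W) : countable A -> measurable A.
Proof. by apply: countable_measurable => t; exact: measurable_set1_row. Qed.

Definition orthants : set (set W) := [set orthant x | x in [set: W]].

Lemma sigma_orthants : @measurable _ W = <<s orthants >>.
Proof.
apply/seteqP; split; last first.
  apply: smallest_sub; first exact: sigma_algebra_measurable.
  by move=> _ [x _ <-]; exact: measurable_orthant.
apply: smallest_sub; first exact: smallest_sigma_algebra.
rewrite -bigcup_seq => _ [i _ [B mB <-]]; rewrite setTI.
have le r : <<s orthants >> [set v : W | v ord0 i <= r].
  (* A half-space is the union of the orthants whose other coordinates go to infinity. *)
  pose z (n : nat) : W := \row_j (if j == i then r else n%:R).
  rewrite (_ : [set v : W | _] = \bigcup_n orthant (z n)).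
    apply: sigma_algebra_bigcup => n; apply: sub_sigma_algebra; by exists (z n).
  apply/seteqP; split=> v /=; last first.
    by move=> [n _ /(_ i)]; rewrite mxE eqxx.
  move=> vi; exists (Num.bound (\sum_j `|v ord0 j|)) => // j; rewrite mxE.
  case: eqP => [->//|_]; apply: le_trans (ler_norm _) _.
  apply: (@le_trans _ _ (\sum_j `|v ord0 j|)).
    by rewrite (bigD1 j)//= lerDl; exact: sumr_ge0.
  by apply/ltW/archi_boundP; exact: sumr_ge0.
move: B mB; apply: smallest_sub.
  split; first by rewrite preimage_set0; exact: sigma_algebra0.
    by move=> A mA; rewrite setTD -preimage_setC; exact: sigma_algebraC.
  move=> A mA; rewrite preimage_bigcup; exact: sigma_algebra_bigcup.
move=> _ [[a b] _ <-].
rewrite (_ : _ @^-1` _ = [set v : W | v ord0 i <= b] `\` [set v : W | v ord0 i <= a]).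
  pose S : sigmaRingType _ := g_sigma_algebraType orthants.
  by apply: (@measurableD _ S); exact: le.
apply/seteqP; split=> v /=; rewrite in_itv /=.
  by move=> /andP[av vb]; split => //; apply/negP; rewrite -ltNge.
by move=> [vb /negP]; rewrite -ltNge => ->.
Qed.

(** Probabilities are functions on all sets, but a distribution function determines them on
    measurable sets only; this is the equality used for laws. *)
Definition eqm (mu nu : set W -> \bar R) := forall A, measurable A -> mu A = nu A.

Lemma eqm_trans mu nu k : eqm mu nu -> eqm nu k -> eqm mu k.
Proof. by move=> h g A mA; rewrite h// g. Qed.

Lemma eqm_df mu nu : eqm mu nu -> df mu = df nu.
Proof. by move=> h; apply/funext => x; apply: h; exact: measurable_orthant. Qed.

Lemma df_eqm (mu nu : probability W R) : df mu = df nu -> eqm mu nu.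
Proof.
move=> h A mA; apply: (measure_unique orthants (fun n => orthant (const_mx n%:R))) => //.
- exact: sigma_orthants.
- move=> _ _ [x _ <-] [y _ <-]; exists (\row_i Num.min (x ord0 i) (y ord0 i)) => //.
  apply/seteqP; split=> v /=.
    by move=> hv; split=> i; have := hv i; rewrite mxE le_min => /andP[].
  by move=> [h1 h2] i; rewrite mxE le_min h1 h2.
- by move=> n; exists (const_mx n%:R).
- apply/seteqP; split=> // v _; exists (Num.bound (\sum_j `|v ord0 j|)) => // j.
  rewrite mxE; apply: le_trans (ler_norm _) _.
  apply: (@le_trans _ _ (\sum_j `|v ord0 j|)).
    by rewrite (bigD1 j)//= lerDl; exact: sumr_ge0.
  by apply/ltW/archi_boundP; exact: sumr_ge0.
- by move=> _ [x _ <-]; exact: (congr1 (fun f => f x) h).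
- by move=> n; rewrite (le_lt_trans (probability_le1 _ _)) ?ltry//; exact: measurable_orthant.
Qed.

Lemma df_measureP (mu : probability W R) : eqm (df_measure (df mu)) mu.
Proof.
apply: df_eqm; rewrite /df_measure.
by have := @getPex _ [set nu : probability W R | df mu = df nu] (ex_intro _ mu erefl).
Qed.

Let addp : W * W -> W := fun p => p.1 + p.2.

HB.instance Definition _ := isMeasurableFun.Build _ _ _ _ addp measurable_addrow.

(** The factors are ordered so that Fubini yields an integral over [nu] of translates of [mu], the
    shape of [df_conv]. *)
Definition conv (mu nu : probability W R) : probability W R :=
  distribution (nu \x mu)%E addp.

Lemma convE mu nu A : conv mu nu A = (\int[nu]_y mu [set z | A (z + y)%R])%E.
Proof.
rewrite /conv /distribution /pushforward /= /product_measure1.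
apply: eq_integral => y _ /=; congr (mu _); apply/seteqP.
by split=> z; rewrite /xsection /= inE /addp /= addrC.
Qed.

Lemma df_convE (mu nu : probability W R) : df_conv (df mu) (df nu) = df (conv mu nu).
Proof.
apply/funext => x; rewrite /df_conv /df convE.
rewrite (eq_measure_integral nu); last by move=> A mA _; apply: (df_measureP nu mA).
apply: eq_integral => y _; congr (mu _); apply/seteqP; split=> z /= h i; have := h i.
  by rewrite !mxE lerBrDr.
by rewrite !mxE lerBrDr.
Qed.

Lemma measurable_shift_set (A : set W) y : measurable A -> measurable [set z : W | A (z + y)].
Proof.
move=> mA; have mf : measurable_fun [set: W] (fun z : W => z + y).
  have mp : measurable_fun [set: W] (fun z : W => (z, y)) by exact: measurable_fun_pair.
  exact: (measurableT_comp measurable_addrow mp).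
by have := mf measurableT _ mA; rewrite setTI.
Qed.

Lemma measurable_fun_shift (mu : probability W R) A : measurable A ->
  measurable_fun [set: W] (fun y => mu [set z | A (z + y)]).
Proof.
move=> mA; have mB : measurable (addp @^-1` A).
  by have := measurable_addrow measurableT mA; rewrite setTI.
have := measurable_fun_xsection mu mB.
rewrite (_ : mu \o _ = (fun y => mu [set z | A (z + y)]))//.
apply/funext => y /=; congr (mu _); apply/seteqP.
by split=> z; rewrite /xsection /= inE /addp /= addrC.
Qed.

Lemma eqm_conv (mu nu mu' nu' : probability W R) : eqm mu mu' -> eqm nu nu' ->
  eqm (conv mu nu) (conv mu' nu').
Proof.
move=> h1 h2 A mA; rewrite !convE.
rewrite (eq_measure_integral nu'); last by move=> B mB _; exact: h2.
by apply: eq_integral => y _; apply: h1; exact: measurable_shift_set.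
Qed.

(* The (n+1)-fold convolution power. *)
Fixpoint convn (mu : probability W R) n : probability W R :=
  if n is n'.+1 then conv mu (convn mu n') else mu.

Lemma df_convXE (mu : probability W R) n : df_convX (df mu) n.+1 = df (convn mu n).
Proof.
rewrite /df_convX /iterop; elim: n => [//|n IH].
by rewrite iteriS IH df_convE.
Qed.

(** The index is shifted: [convn nu n] has n + 1 factors, so [n] runs over all positive powers. *)
Definition idm (mu : probability W R) := forall n, exists nu, eqm mu (convn nu n).

Lemma idm_df (mu : probability W R) : infinitely_divisible (df mu) <-> idm mu.
Proof.
split=> [[_ h] n|h].
  have [Gn [[nu ->]]] := h n.+1 isT; rewrite df_convXE => /df_eqm e.
  by exists nu.
split; first by exists mu.
case=> // n _; have [nu e] := h n; exists (df nu); split; first by exists nu.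
by rewrite df_convXE; exact: eqm_df.
Qed.

Definition qidm (mu : probability W R) :=
  exists m1 m2 : probability W R, [/\ idm m1, idm m2 & eqm m1 (conv mu m2)].

Lemma qidm_df (mu : probability W R) : quasi_infinitely_divisible (df mu) <-> qidm mu.
Proof.
split=> [[_ [G1 [G2 [h1 h2 e]]]]|[m1 [m2 [h1 h2 e]]]].
  have [[m1 E1] _] := h1; have [[m2 E2] _] := h2.
  rewrite E1 in h1 e; rewrite E2 in h2 e.
  exists m1, m2; split; [exact/idm_df|exact/idm_df|].
  by apply: df_eqm; rewrite -df_convE.
split; first by exists mu.
exists (df m1), (df m2); split; [exact/idm_df|exact/idm_df|].
by rewrite df_convE; exact: eqm_df.
Qed.

End measurable_rows.
Arguments conv {R m} mu nu : simpl never.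

(** * Images of measures under maps that are additive on a carrier *)

Section push.
Context {R : realType} {m k : nat}.
Local Notation W := 'rV[R]_m.
Local Notation W' := 'rV[R]_k.

Definition mfun_of (f : W -> W') (mf : measurable_fun [set: W] f) : {mfun W >-> W'} :=
  HB.pack f (isMeasurableFun.Build _ _ _ _ f mf).

Definition push (f : W -> W') (mf : measurable_fun [set: W] f) (mu : probability W R) :
  probability W' R := distribution mu (mfun_of mf).

Lemma pushE (f : W -> W') (mf : measurable_fun [set: W] f) mu A : push mf mu A = mu (f @^-1` A).
Proof. by []. Qed.

Lemma eqm_push (f : W -> W') (mf : measurable_fun [set: W] f) (mu nu : probability W R) :
  eqm mu nu -> eqm (push mf mu) (push mf nu).
Proof.
move=> h A mA; rewrite !pushE; apply: h.
by have := mf measurableT A mA; rewrite setTI.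
Qed.

Lemma prob1_setC (mu : probability W R) S : measurable S -> mu S = 1%E -> mu (~` S) = 0%E.
Proof. by move=> mS S1; rewrite probability_setC// S1 subee. Qed.

Lemma prob1_setI (mu : probability W R) S A : measurable S -> measurable A -> mu S = 1%E ->
  mu (A `&` S) = mu A.
Proof.
move=> mS mA S1; rewrite [RHS](measureDI mu mA mS) [X in (X + _)%E](_ : _ = 0%E) ?add0e//.
apply: (subset_measure0 (B := ~` S)); [exact: measurableD|exact: measurableC| |].
  by move=> x [].
exact: prob1_setC.
Qed.

Lemma prob1_eq (mu : probability W R) S A B : measurable S -> measurable A -> measurable B ->
  mu S = 1%E -> (forall x, S x -> A x <-> B x) -> mu A = mu B.
Proof.
move=> mS mA mB S1 AB; rewrite -(prob1_setI mS mA S1) -(prob1_setI mS mB S1).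
by congr (mu _); apply/seteqP; split=> x [Ax Sx]; split => //; apply/(AB x Sx).
Qed.

(** Additivity is required only on a set [S] of full measure, since the map that undoes a generic
    projection is additive on a countable set only. *)
Lemma push_conv (f : W -> W') (mf : measurable_fun [set: W] f) (mu nu : probability W R) S :
  measurable S -> mu S = 1%E -> nu S = 1%E ->
  (forall x y, S x -> S y -> f (x + y) = f x + f y) ->
  eqm (push mf (conv mu nu)) (conv (push mf mu) (push mf nu)).
Proof.
move=> mS muS nuS fD A mA; rewrite pushE !convE.
have mfA B : measurable B -> measurable (f @^-1` B).
  by move=> mB; have := mf measurableT _ mB; rewrite setTI.
rewrite ge0_integral_distribution//; last exact: measurable_fun_shift.
apply: ge0_ae_eq_integral => //.
- exact: (measurable_fun_shift mu (mfA _ mA)).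
- exact: (measurableT_comp (measurable_fun_shift (push mf mu) mA) mf).
- exists (~` S); split; first exact: measurableC.
    exact: prob1_setC.
  move=> y /= h Sy; apply: h => _; rewrite pushE.
  apply: (prob1_eq mS) => //.
  + exact: (measurable_shift_set y (mfA _ mA)).
  + by apply: mfA; exact: measurable_shift_set.
  + by move=> x Sx /=; rewrite fD.
Qed.

(** [S] is closed under addition so that it carries every convolution power; the second conclusion
    feeds the induction. *)
Lemma push_convn (f : W -> W') (mf : measurable_fun [set: W] f) (mu : probability W R) S n :
  measurable S -> mu S = 1%E -> (forall x y, S x -> S y -> S (x + y)) ->
  (forall x y, S x -> S y -> f (x + y) = f x + f y) ->
  eqm (push mf (convn mu n)) (convn (push mf mu) n) /\ convn mu n S = 1%E.
Proof.
move=> mS muS SD fD; elim: n => [|n [IH IH1]]; first by split.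
split.
  apply: eqm_trans (push_conv mf mS muS IH1 fD) _.
  exact: eqm_conv.
rewrite -[convn mu n.+1]/(conv mu (convn mu n)) convE.
rewrite (@ge0_ae_eq_integral _ _ _ _ _ _ (cst 1%E)) ?integral_cst ?mul1e//.
- exact: probability_setT.
- exact: measurable_fun_shift.
- exists (~` S); split; [exact: measurableC|exact: prob1_setC|].
  move=> y /= h Sy; apply: h => _ /=; rewrite -muS.
  apply/eqP; rewrite eq_le muS probability_le1//=; last exact: measurable_shift_set.
  rewrite -[leLHS]muS; apply: le_measure; rewrite ?inE//; first exact: measurable_shift_set.
  by move=> z Sz /=; exact: SD.
Qed.

End push.

(** * Discrete laws and their families of atoms *)

Section discrete_probability.
Context {R : realType} {m : nat}.
Local Notation W := 'rV[R]_m.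

Lemma discrete_probability (w : nat -> R) (pts : nat -> W) : (forall n, 0 <= w n) ->
  (\sum_(0 <= n <oo) (w n)%:E = 1)%E ->
  exists mu : probability W R, forall A,
    mu A = (\sum_(0 <= n <oo) (w n)%:E * \d_(pts n) A)%E.
Proof.
move=> w0 w1; pose u n : {nonneg R} := NngNum (w0 n).
pose M := mseries (fun n => mscale (u n) (dirac (pts n))) 0.
have MT : M setT = 1%E.
  rewrite -w1; apply: eq_eseriesr => n _.
  by transitivity ((w n)%:E * \d_(pts n) (@setT W))%E => //; rewrite diracT mule1.
(* Normalization supplies the probability structure; as the total mass is 1, it changes no value. *)
exists (mnormalize M (dirac (0 : W))) => A.
have key (z : \bar R) : z = 1%E -> (if (z == 0%E) || (z == +oo%E)
    then fun U : set W => \d_(0 : W) U else fun U : set W => (M U * (fine z)^-1%:E)%E) A = M A.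
  by move=> ->; rewrite eqe oner_eq0 /= invr1 mule1.
exact: (key _ MT).
Qed.

End discrete_probability.

Section concentrated.
Context {R : realType} {m : nat} {V : zmodType}.
Local Notation W := 'rV[R]_m.
Variables (io : V -> W) (e : nat -> V).
Hypothesis ioD : {morph io : x y / x + y}.
Hypothesis io_inj : injective io.
Hypothesis e_bij : bijective e.
Implicit Types mu nu : probability W R.

Lemma io0 : io 0 = 0.
Proof. by apply: (addrI (io 0)); rewrite -ioD !addr0. Qed.

Lemma ioB x y : io (x - y) = io x - io y.
Proof. by apply: (addIr (io y)); rewrite -ioD !subrK. Qed.

Let rangeE : range io = \bigcup_n [set io (e n)].
Proof.
have [e' eK e'K] := e_bij.
apply/seteqP; split=> [_ [v _ <-]|x [n _ ->]]; last by exists (e n).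
by exists (e' v) => //=; rewrite e'K.
Qed.

Lemma measurable_range_io : measurable (range io).
Proof. by rewrite rangeE; apply: bigcupT_measurable => n; exact: measurable_set1_row. Qed.
Let mD := measurable_range_io.

Definition conc mu := mu (range io) = 1%E.

Lemma integral_conc mu (g : W -> \bar R) : conc mu -> measurable_fun [set: W] g ->
  (forall x, (0 <= g x)%E) ->
  (\int[mu]_x g x = \esum_(v in [set: V]) (g (io v) * mu [set (io v)]))%E.
Proof.
move=> cmu mg g0.
rewrite (@ge0_negligible_integral _ _ _ mu _ (~` range io))//; last first.
  exact: prob1_setC.
  exact: measurableC.
rewrite setTD setCK rangeE ge0_integral_bigcup//; last first.
- move=> i j _ _ [x [/= -> /io_inj]]; exact: bij_inj.
- by apply: measurable_funTS.
- by move=> n; exact: measurable_set1_row.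
rewrite (@reindex_esum R nat V [set: nat] [set: V] e); last by rewrite setTT_bijective.
rewrite -nneseries_esumT; last by move=> n; rewrite mule_ge0.
apply: eq_eseriesr => n _.
rewrite (eq_integral (cst (g (io (e n))))); last by move=> x; rewrite inE => ->.
by rewrite integral_cst//; exact: measurable_set1_row.
Qed.

Lemma measure_conc mu A : conc mu -> measurable A ->
  mu A = (\esum_(v in [set: V]) ((\1_A (io v))%:E * mu [set (io v)]))%E.
Proof.
move=> cmu mA; rewrite -(integral_conc cmu (g := fun x => (\1_A x)%:E)).
- by rewrite integral_indic// setIT.
- exact/measurable_EFinP/measurable_indic.
- by move=> x; rewrite lee_fin.
Qed.

Lemma conc_eqm mu nu : conc mu -> conc nu ->
  (forall v, mu [set (io v)] = nu [set (io v)]) -> eqm mu nu.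
Proof.
move=> cmu cnu h A mA; rewrite (measure_conc cmu mA) (measure_conc cnu mA).
by apply: eq_esum => v _; rewrite h.
Qed.

Definition atom mu (v : V) : R := fine (mu [set (io v)]).

Lemma atomE mu v : (atom mu v)%:E = mu [set (io v)].
Proof.
rewrite /atom fineK// ge0_fin_numE//; apply: le_lt_trans (probability_le1 _ _) (ltry _).
exact: measurable_set1_row.
Qed.

Lemma atom_ge0 mu v : 0 <= atom mu v. Proof. exact: fine_ge0. Qed.

Lemma rsummable_atom mu : rsummable (atom mu) /\ (conc mu -> rsum (atom mu) = 1).
Proof.
have le1 : (esumT (atom mu) <= 1)%E.
  apply: ge_ereal_sup => _ [X [finX _] <-].
  rewrite (eq_fsbigr (fun v => mu [set (io v)])); last by move=> v _; rewrite atomE.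
  rewrite -measure_fin_bigcup//; last 2 first.
  - move=> i j _ _ [x [/= -> /io_inj]]; by [].
  - by move=> i _; exact: measurable_set1_row.
  apply: probability_le1; apply: fin_bigcup_measurable => // i _.
  exact: measurable_set1_row.
have s : rsummable (atom mu).
  by apply: (rsummable_ge0 (atom_ge0 mu)).2; exact: le_lt_trans le1 (ltry _).
split=> // cmu; apply: EFin_inj; rewrite rsum_ge0E//; last exact: atom_ge0.
rewrite -[RHS](probability_setT mu) (measure_conc cmu measurableT).
by apply: eq_esum => v _; rewrite atomE indicT mul1e.
Qed.

Lemma csummable_atom mu : csummable (fun v => (atom mu v)%:C).
Proof.
apply: rsummableW (rsummable_atom mu).1 _ => v.
by rewrite nm_real normr_id.
Qed.

Definition atoms mu : l1 R V := mk_l1 (csummable_atom mu).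

Lemma atomsE mu v : atoms mu v = (atom mu v)%:C. Proof. by []. Qed.

Lemma aug_atoms mu : conc mu -> aug (atoms mu) = 1.
Proof. by move=> cmu; rewrite /aug csum_real (rsummable_atom mu).2. Qed.

Lemma atoms_eqm mu nu : conc mu -> conc nu -> atoms mu = atoms nu -> eqm mu nu.
Proof.
move=> cmu cnu h; apply: conc_eqm => // v.
by have [e1] := congr1 (fun a : l1 R V => a v) h; rewrite -!atomE e1.
Qed.

Lemma eqm_conc mu nu : eqm mu nu -> conc mu -> conc nu.
Proof. by move=> h; rewrite /conc h. Qed.

Lemma conc_conv mu nu : conc mu -> conc nu -> conc (conv mu nu).
Proof.
move=> cmu cnu; rewrite /conc convE (integral_conc cnu)//; last exact: measurable_fun_shift.
rewrite -[RHS](probability_setT nu) (measure_conc cnu measurableT).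
apply: eq_esum => v _; congr (_ * _)%E; rewrite indicT -cmu.
congr (mu _); apply/seteqP; split=> z /=.
  by move=> [u _ uE]; exists (u - v) => //; rewrite ioB uE addrK.
by move=> [u _ <-]; exists (u + v) => //; rewrite ioD.
Qed.

Lemma atoms_conv mu nu : conc mu -> conc nu -> atoms (conv mu nu) = atoms mu * atoms nu.
Proof.
move=> cmu cnu; rewrite mulrC; apply: l1P => x; rewrite atomsE l1ME.
have cM (p q : R) : p%:C * q%:C = (p * q)%:C.
  by apply/eqP; rewrite eq_complex /=; apply/andP; split; apply/eqP; ring.
transitivity (csum (fun v => (atom nu v * atom mu (x - v))%:C)); last first.
  by apply: eq_csum => v; rewrite !atomsE cM.
rewrite csum_real; congr (_%:C); apply: EFin_inj.
have p0 v : 0 <= atom nu v * atom mu (x - v) by rewrite mulr_ge0// atom_ge0.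
rewrite rsum_ge0E//; last first.
  apply: rsummableW (csummable_conv1 (atoms nu) (atoms mu) x) _ => v.
  by rewrite !atomsE cM nm_real normr_id.
rewrite atomE convE (integral_conc cnu)//; last first.
  by apply: measurable_fun_shift; exact: measurable_set1_row.
apply: eq_esum => v _; rewrite EFinM !atomE muleC; congr (_ * _)%E.
congr (mu _); apply/seteqP; split=> z /=; rewrite ioB.
  by move=> <-; rewrite addrK.
by move=> ->; rewrite subrK.
Qed.

(** Laws carried by [V] thus correspond to nonnegative elements of augmentation 1, and convolution
    roots may be sought in the ring. In [R[i]], [0 <= a v] includes that [a v] is real. *)
Lemma atoms_surj (a : l1 R V) : (forall v, 0 <= a v) -> aug a = 1 ->
  exists mu, conc mu /\ atoms mu = a.
Proof.
move=> a0 a1.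
have aR v : a v = (complex.Re (a v))%:C.
  have := a0 v; rewrite lecE => /andP[/eqP h _]; case: (a v) h => x y /= ->.
  by [].
have R0 v : 0 <= complex.Re (a v) by have := a0 v; rewrite lecE => /andP[].
have sR : rsummable (fun v => complex.Re (a v)) := csummable_Re (csummable_l1 a).
have rs1 : rsum (fun v => complex.Re (a v)) = 1 by have [] := a1.
have [|mu muE] := @discrete_probability R m (fun n => complex.Re (a (e n)))
    (fun n => io (e n)) (fun n => R0 (e n)).
  rewrite nneseries_esumT; last by move=> n; rewrite lee_fin.
  rewrite -[RHS]/((1 : R)%:E) -rs1 rsum_ge0E// /esumT.
  by rewrite (@reindex_esum R nat V [set: nat] [set: V] e)// setTT_bijective.
have ME A : mu A = (\esum_(v in [set: V]) ((complex.Re (a v))%:E * \d_(io v) A))%E.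
  rewrite muE (@reindex_esum R nat V [set: nat] [set: V] e); last by rewrite setTT_bijective.
  by rewrite -nneseries_esumT// => n; rewrite mule_ge0// lee_fin.
exists mu; split.
  rewrite /conc ME -[RHS]/((1 : R)%:E) -rs1 rsum_ge0E//.
  by apply: eq_esum => v _; rewrite diracE mem_set ?mule1//; exists v.
apply: l1P => v; rewrite atomsE /atom ME aR; congr (_%:C).
rewrite (esumID [set v]); last by move=> u _; rewrite mule_ge0// lee_fin.
rewrite setTI esum_set1; last by rewrite mule_ge0// lee_fin.
rewrite diracE mem_set// mule1 esum1 ?adde0// => u [_ /= uv].
by rewrite diracE memNset ?mule0// => /io_inj.
Qed.

End concentrated.

(** * Characteristic functions *)

Section expectation.
Context {R : realType} {m : nat}.
Local Notation W := 'rV[R]_m.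
Implicit Types (mu nu : probability W R) (f g : W -> R).

Definition bm (d : measure_display) (T : measurableType d) (f : T -> R) :=
  measurable_fun [set: T] f /\ exists B, forall x, `|f x| <= B.

Lemma bm_integrable d (T : measurableType d) (P : probability T R) (f : T -> R) :
  bm f -> P.-integrable [set: T] (EFin \o f).
Proof.
move=> [mf [B fB]]; apply: measurable_bounded_integrable => //.
  exact: le_lt_trans (probability_le1 P measurableT) (ltry _).
exists B; split; first exact: num_real.
by move=> r /ltW Br x _; apply: le_trans Br.
Qed.

Lemma bm_comp d d' (T : measurableType d) (T' : measurableType d') (h : T' -> T) (f : T -> R) :
  measurable_fun [set: T'] h -> bm f -> bm (fun x => f (h x)).
Proof.
move=> mh [mf [B fB]]; split; first exact: (measurableT_comp mf mh).
by exists B => x; exact: fB.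
Qed.

Lemma bmD d (T : measurableType d) (f g : T -> R) : bm f -> bm g -> bm (fun x => f x + g x).
Proof.
move=> [mf [B fB]] [mg [C gC]]; split; first exact: measurable_funD.
by exists (B + C) => x; apply: le_trans (ler_normD _ _) _; exact: lerD.
Qed.

Lemma bmZ d (T : measurableType d) c (f : T -> R) : bm f -> bm (fun x => c * f x).
Proof.
move=> [mf [B fB]]; split; first exact: measurable_funM.
by exists (`|c| * B) => x; rewrite normrM ler_wpM2l.
Qed.

Lemma bm_cst d (T : measurableType d) c : bm (fun _ : T => c).
Proof. by split; [exact: measurable_cst|exists `|c|]. Qed.

Definition Ex mu f : R := \int[mu]_x f x.

Lemma ExD mu f g : bm f -> bm g -> Ex mu (fun x => f x + g x) = Ex mu f + Ex mu g.
Proof. by move=> bf bg; rewrite /Ex RintegralD//; exact: bm_integrable. Qed.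

Lemma ExZ mu c f : bm f -> Ex mu (fun x => c * f x) = c * Ex mu f.
Proof. by move=> bf; rewrite /Ex RintegralZl//; exact: bm_integrable. Qed.

Lemma Ex_cst mu c : Ex mu (fun=> c) = c.
Proof.
by rewrite /Ex Rintegral_cst// [X in fine X](_ : _ = 1%E) ?mulr1//; exact: probability_setT.
Qed.

Lemma Ex_le mu f g : bm f -> bm g -> (forall x, f x <= g x) -> Ex mu f <= Ex mu g.
Proof. by move=> bf bg fg; apply: le_Rintegral => //; exact: bm_integrable. Qed.

Lemma Ex_eqm mu nu f : eqm mu nu -> Ex mu f = Ex nu f.
Proof.
move=> h; rewrite /Ex /Rintegral; congr fine.
by apply: (eq_measure_integral nu) => A mA _; exact: h.
Qed.

Lemma EFin_Ex mu f : bm f -> (Ex mu f)%:E = (\int[mu]_x (f x)%:E)%E.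
Proof.
move=> bf; rewrite /Ex /Rintegral fineK//.
exact: integrable_fin_num (bm_integrable mu bf).
Qed.

Lemma Ex_conv mu nu f : bm f ->
  Ex (conv mu nu) f = Ex nu (fun y => Ex mu (fun x => f (x + y))) /\
  bm (fun y : W => Ex mu (fun x => f (x + y))).
Proof.
move=> bf; have [mf [B fB]] := bf.
have b2 : bm (fun p : W * W => f (p.1 + p.2)).
  exact: (bm_comp measurable_addrow bf).
have i2 := bm_integrable (product_measure1 nu mu) b2.
have bs (y : W) : bm (fun x : W => f (x + y)).
  apply: bm_comp bf; have mp : measurable_fun [set: W] (fun z : W => (z, y)).
    exact: measurable_fun_pair.
  exact: (measurableT_comp measurable_addrow mp).
have E (y : W) : (Ex mu (fun x => f (x + y)))%:E = (\int[mu]_x (f (y + x))%:E)%E.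
  by rewrite EFin_Ex//; apply: eq_integral => x _; rewrite addrC.
have bE : bm (fun y : W => Ex mu (fun x => f (x + y))).
  split.
    apply/measurable_EFinP.
    rewrite (_ : EFin \o _ = fubini_F mu (EFin \o (fun p : W * W => f (p.1 + p.2)))).
      exact: (measurable_fubini_F i2).
    by apply/funext => y /=; rewrite E.
  exists B => y; have nB : bm (fun _ : W => B) by exact: bm_cst.
  rewrite ler_norml; apply/andP; split.
    rewrite -(Ex_cst mu (- B)); apply: Ex_le => // [|x]; first exact: bm_cst.
    by have := fB (x + y); rewrite ler_norml => /andP[].
  rewrite -(Ex_cst mu B); apply: Ex_le => // x.
  by have := fB (x + y); rewrite ler_norml => /andP[].
split=> //; apply: EFin_inj; rewrite !EFin_Ex//.
rewrite integral_distribution//; last exact/measurable_EFinP.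
rewrite -integral12_prod_meas1//; apply: eq_integral => y _.
by rewrite E.
Qed.

Lemma Ex_dist d (T : measurableType d) (P : probability T R) (X : {mfun T >-> W}) f : bm f ->
  Ex (distribution P X) f = \int[P]_x f (X x).
Proof.
move=> bf; have [mf _] := bf.
rewrite /Ex /Rintegral; congr fine; rewrite integral_distribution//.
  exact/measurable_EFinP.
apply: (bm_integrable P (f := fun x => f (X x))); apply: bm_comp bf.
exact: measurable_funP.
Qed.

End expectation.

Section charfun.
Context {R : realType}.
Local Notation W := 'rV[R]_1.
Implicit Types (mu nu : probability W R) (s t : R).

Definition crd (v : W) : R := v ord0 ord0.

Lemma crdD v w : crd (v + w) = crd v + crd w. Proof. by rewrite /crd mxE. Qed.

Lemma bm_cos t : bm (fun v : W => cos (t * crd v)).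
Proof.
split; last by exists 1 => x; rewrite ler_norml cos_geN1 cos_le1.
have mc : measurable_fun [set: R] (fun u : R => cos (t * u)).
  apply: continuous_measurable_fun => u.
  apply: (@continuous_comp _ _ _ (fun u => t * u) cos); first exact: mulrl_continuous.
  exact: continuous_cos.
exact: (measurableT_comp mc (measurable_row ord0)).
Qed.

Lemma bm_sin t : bm (fun v : W => sin (t * crd v)).
Proof.
split; last by exists 1 => x; rewrite ler_norml sin_geN1 sin_le1.
have mc : measurable_fun [set: R] (fun u : R => sin (t * u)).
  apply: continuous_measurable_fun => u.
  apply: (@continuous_comp _ _ _ (fun u => t * u) sin); first exact: mulrl_continuous.
  exact: continuous_sin.
exact: (measurableT_comp mc (measurable_row ord0)).
Qed.

Definition cc mu t := Ex mu (fun v => cos (t * crd v)).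
Definition sc mu t := Ex mu (fun v => sin (t * crd v)).
(** The squared modulus of the characteristic function. By [cc_symz] it is itself an integral of
    cosines, so inequalities between cosines can be integrated. *)
Definition chf2 mu t := cc mu t ^+ 2 + sc mu t ^+ 2.

Lemma cc_conv mu nu t : cc (conv mu nu) t = cc mu t * cc nu t - sc mu t * sc nu t.
Proof.
rewrite /cc /sc (Ex_conv mu nu (bm_cos t)).1.
rewrite (_ : (fun y => _) = (fun y => Ex mu (fun v => cos (t * crd v)) * cos (t * crd y) +
    (- Ex mu (fun v => sin (t * crd v))) * sin (t * crd y))); last first.
  apply/funext => y; rewrite mulNr.
  rewrite (_ : (fun x => _) = (fun x : W => cos (t * crd y) * cos (t * crd x) +
    (- sin (t * crd y)) * sin (t * crd x))); last first.
    by apply/funext => x; rewrite crdD mulrDr cosD; ring.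
  rewrite ExD; [|exact/bmZ/bm_cos|exact/bmZ/bm_sin].
  rewrite !ExZ; [|exact: bm_sin|exact: bm_cos]; ring.
rewrite ExD; [|exact/bmZ/bm_cos|exact/bmZ/bm_sin].
rewrite !ExZ; [|exact: bm_sin|exact: bm_cos]; ring.
Qed.

Lemma sc_conv mu nu t : sc (conv mu nu) t = sc mu t * cc nu t + cc mu t * sc nu t.
Proof.
rewrite /cc /sc (Ex_conv mu nu (bm_sin t)).1.
rewrite (_ : (fun y => _) = (fun y => Ex mu (fun v => sin (t * crd v)) * cos (t * crd y) +
    Ex mu (fun v => cos (t * crd v)) * sin (t * crd y))); last first.
  apply/funext => y.
  rewrite (_ : (fun x => _) = (fun x : W => cos (t * crd y) * sin (t * crd x) +
    sin (t * crd y) * cos (t * crd x))); last first.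
    by apply/funext => x; rewrite crdD mulrDr sinD; ring.
  rewrite ExD; [|exact/bmZ/bm_sin|exact/bmZ/bm_cos].
  rewrite !ExZ; [|exact: bm_cos|exact: bm_sin]; ring.
rewrite ExD; [|exact/bmZ/bm_cos|exact/bmZ/bm_sin].
rewrite !ExZ; [|exact: bm_sin|exact: bm_cos]; ring.
Qed.

Lemma chf2_conv mu nu t : chf2 (conv mu nu) t = chf2 mu t * chf2 nu t.
Proof. by rewrite /chf2 cc_conv sc_conv; ring. Qed.

Lemma chf2_convn mu n t : chf2 (convn mu n) t = chf2 mu t ^+ n.+1.
Proof.
elim: n => [|n IH]; first by rewrite expr1.
by rewrite -[convn mu n.+1]/(conv mu (convn mu n)) chf2_conv IH -exprS.
Qed.

Lemma eqm_chf2 mu nu t : eqm mu nu -> chf2 mu t = chf2 nu t.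
Proof. by move=> h; rewrite /chf2 /cc /sc !(Ex_eqm _ h). Qed.

Lemma measurable_opprow : measurable_fun [set: W] (fun v : W => - v).
Proof.
apply: measurable_fun_row => i.
have -> : (fun t : W => (- t) ord0 i) = (fun t : W => - (t ord0 i)).
  by apply/funext => t; rewrite mxE.
exact: (measurable_funN (measurable_row i)).
Qed.

Definition symz mu := conv mu (push measurable_opprow mu).

Lemma cc_symz mu t : cc (symz mu) t = chf2 mu t.
Proof.
have cN : cc (push measurable_opprow mu) t = cc mu t.
  rewrite /cc (Ex_dist _ _ (bm_cos t)) /Ex; apply: eq_Rintegral => v _ /=.
  by rewrite /crd mxE mulrN cosN.
have sN : sc (push measurable_opprow mu) t = - sc mu t.
  rewrite /sc (Ex_dist _ _ (bm_sin t)) -[RHS]mulN1r -(ExZ mu (-1) (bm_sin t)) /Ex.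
  by apply: eq_Rintegral => v _ /=; rewrite /crd mxE mulrN sinN mulN1r.
by rewrite /symz cc_conv cN sN /chf2; ring.
Qed.

Lemma chf2_ge0 mu t : 0 <= chf2 mu t.
Proof. by rewrite addr_ge0// sqr_ge0. Qed.

Lemma chf2_le1 mu t : chf2 mu t <= 1.
Proof.
rewrite -cc_symz -[leRHS](Ex_cst (symz mu) 1); apply: Ex_le => [||v].
- exact: bm_cos.
- exact: bm_cst.
- exact: cos_le1.
Qed.

(** Integrate 1 - cos(2 u) = 2 (1 - cos u) (1 + cos u) <= 4 (1 - cos u) against the symmetrized
    law. *)
Lemma chf2_double mu t : 1 - chf2 mu (2 * t) <= 4 * (1 - chf2 mu t).
Proof.
rewrite -!cc_symz; set nu := symz mu.
have : Ex nu (fun v => 1 + (-1) * cos (2 * t * crd v)) <=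
       Ex nu (fun v => 4 + (-4) * cos (t * crd v)).
  apply: Ex_le => [||v].
  - by apply: bmD; [exact: bm_cst|exact/bmZ/bm_cos].
  - by apply: bmD; [exact: bm_cst|exact/bmZ/bm_cos].
  have -> : 2 * t * crd v = t * crd v + t * crd v by ring.
  rewrite cosD; have := cos2Dsin2 (t * crd v).
  have := cos_le1 (t * crd v); have := cos_geN1 (t * crd v).
  by move: (cos _) (sin _) => x y; nra.
rewrite !ExD; try exact: bm_cst; try exact/bmZ/bm_cos.
rewrite !Ex_cst !ExZ; try exact: bm_cos.
rewrite /cc; lra.
Qed.

(** The second difference of the cosine is 2 cos(t v) (cos(s v) - 1), bounded by 2 (1 - cos(s v))
    whatever [t] is. *)
Lemma chf2_second_difference mu s t :
  `|chf2 mu (t + s) + chf2 mu (t - s) - 2 * chf2 mu t| <= 2 * (1 - chf2 mu s).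
Proof.
rewrite -!cc_symz; set nu := symz mu.
have bL : bm (fun v : W => cos ((t + s) * crd v) + cos ((t - s) * crd v)).
  by apply: bmD; exact: bm_cos.
have bR : bm (fun v : W => 2 + (-2) * cos (s * crd v)).
  by apply: bmD; [exact: bm_cst|exact/bmZ/bm_cos].
have b3 k : bm (fun v : W => k * cos (t * crd v)) by exact/bmZ/bm_cos.
have key v : `|cos ((t + s) * crd v) + cos ((t - s) * crd v) - 2 * cos (t * crd v)| <=
    2 - 2 * cos (s * crd v).
  have -> : cos ((t + s) * crd v) + cos ((t - s) * crd v) - 2 * cos (t * crd v) =
      2 * cos (t * crd v) * (cos (s * crd v) - 1).
    by rewrite mulrDl mulrBl cosD cosB; ring.
  have := cos_le1 (s * crd v); have := cos_le1 (t * crd v); have := cos_geN1 (t * crd v).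
  by move: (cos _) (cos _) => x y *; rewrite ler_norml; apply/andP; split; nra.
have h1 : Ex nu (fun v => (cos ((t + s) * crd v) + cos ((t - s) * crd v)) + (-2) * cos (t * crd v)) <=
    Ex nu (fun v : W => 2 + (-2) * cos (s * crd v)).
  by apply: Ex_le => // [|v]; [exact: bmD|have := key v; rewrite ler_norml; lra].
have h2 : Ex nu (fun v => 2 * cos (t * crd v)) <=
    Ex nu (fun v : W => (2 + (-2) * cos (s * crd v)) + (cos ((t + s) * crd v) + cos ((t - s) * crd v))).
  by apply: Ex_le => // [|v]; [exact: bmD|have := key v; rewrite ler_norml; lra].
have e1 : Ex nu (fun v => cos ((t + s) * crd v) + cos ((t - s) * crd v)) =
    cc nu (t + s) + cc nu (t - s) by rewrite ExD//; exact: bm_cos.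
have e2 : Ex nu (fun v : W => 2 + (-2) * cos (s * crd v)) = 2 - 2 * cc nu s.
  rewrite ExD; [|exact: bm_cst|exact/bmZ/bm_cos].
  by rewrite Ex_cst ExZ ?mulNr//; exact: bm_cos.
have e3 k : Ex nu (fun v : W => k * cos (t * crd v)) = k * cc nu t.
  by rewrite ExZ//; exact: bm_cos.
rewrite (ExD nu bL (b3 (-2))) e1 e3 e2 in h1.
rewrite (ExD nu bR bL) e3 e1 e2 in h2.
rewrite ler_norml; apply/andP; split; lra.
Qed.

(** Continuity at 0 along the halvings of [t], the sequence on which [idm_chf2_double] climbs back
    to [t]. *)
Lemma chf2_cvg mu t : (fun k : nat => chf2 mu (t / 2 ^+ k)) @ \oo --> (1 : R).
Proof.
under eq_fun do rewrite -cc_symz.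
set nu := symz mu.
pose f_ (k : nat) (v : W) := (cos (t / 2 ^+ k * crd v))%:E.
have b1 : bm (fun _ : W => 1 : R) by exact: bm_cst.
have cf v : f_ k v @[k --> \oo] --> (1 : R)%:E.
  apply: cvg_EFin; first by near=> k.
  rewrite (_ : fine \o _ = (fun k : nat => cos (t * crd v * (1 / 2) ^+ k))); last first.
    by apply/funext => k /=; congr cos; rewrite expr_div_n expr1n; field; rewrite expf_neq0.
  have c0 : (fun k : nat => t * crd v * (1 / 2) ^+ k) @ \oo --> (0 : R).
    rewrite -(mulr0 (t * crd v)); apply: cvgM; first exact: cvg_cst.
    by apply: cvg_expr; rewrite ger0_norm; lra.
  by rewrite -[X in _ --> X]cos0; exact: (cvg_comp _ _ c0 (@continuous_cos R 0)).
have : (\int[nu]_v f_ n v)%E @[n --> \oo] --> (\int[nu]_v (1 : R)%:E)%E.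
  apply: (@dominated_cvg _ _ _ nu _ measurableT f_ (fun=> (1 : R)%:E) (fun=> (1 : R)%:E)) => //.
  - by move=> n; apply/measurable_EFinP; exact: (bm_cos _).1.
  - exact: (bm_integrable nu b1).
  - by move=> n v _; rewrite lee_fin cos_max.
rewrite -(EFin_Ex nu b1) Ex_cst => /fine_cvgP[_]; apply: cvg_trans; apply: near_eq_cvg.
by near=> n; rewrite /= -(EFin_Ex nu (bm_cos _)).
Unshelve. all: by end_near. Qed.

End charfun.

(** * Characteristic functions of infinitely divisible laws *)

Section infinitely_divisible_charfun.
Context {R : realType}.
Local Notation W := 'rV[R]_1.
Implicit Types (mu nu : probability W R) (s t : R).

Lemma chf2_root mu n : idm mu -> exists nu, forall t, chf2 mu t = chf2 nu t ^+ n.+1.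
Proof.
move=> h; have [nu e] := h n; exists nu => t.
by rewrite (eqm_chf2 t e) chf2_convn.
Qed.

(** A convolution root of high enough order has [chf2] above 3/4 at [t]; the doubling inequality
    then keeps it positive at 2 t, since 4 (1 - 3/4) = 1. *)
Lemma idm_chf2_double mu t : idm mu -> 0 < chf2 mu t -> 0 < chf2 mu (2 * t).
Proof.
move=> h c0; have [n nP] : exists n, (3 / 4) ^+ n.+1 < chf2 mu t.
  have [N NP] := @poly_expr_small R 0 (3 / 4) ltac:(lra) ltac:(lra).
  have c34 : `|3 / 4 : R| < 1 by rewrite ger0_norm; lra.
  have /cvgrPdist_lt/(_ _ c0) := cvg_expr c34.
  move=> [n _ /(_ n.+1 (leqnSn n))]; rewrite /= sub0r normrN ger0_norm.
    by move=> ?; exists n.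
  by apply: exprn_ge0; lra.
have [nu nuP] := chf2_root n h.
have n34 : 3 / 4 < chf2 nu t.
  rewrite ltNge; apply/negP => le34; move: nP; rewrite nuP ltNge => /negP; apply.
  by apply: lerXn2r; rewrite ?nnegrE ?chf2_ge0//; lra.
rewrite nuP exprn_gt0//; have := chf2_double nu t; lra.
Qed.

Lemma idm_chf2_gt0 mu t : idm mu -> 0 < chf2 mu t.
Proof.
move=> h.
have /cvgrPdist_lt/(_ (1 / 2)) := chf2_cvg mu t.
move=> /(_ ltac:(lra))[k _ /(_ k (leqnn k))] /=; rewrite ltr_norml => /andP[_ hk].
have {hk} : 0 < chf2 mu (t / 2 ^+ k) by lra.
elim: k => [|k IH]; first by rewrite expr0 divr1.
move=> hk; apply: IH; rewrite (_ : t / 2 ^+ k = 2 * (t / 2 ^+ k.+1)).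
  exact: idm_chf2_double.
by rewrite exprS; field; rewrite expf_neq0.
Qed.

Definition lchf mu t := ln (chf2 mu t).

Lemma lchf_le0 mu t : lchf mu t <= 0.
Proof. by rewrite /lchf ln_le0// chf2_le1. Qed.

Lemma exp_lin (z : R) : 0 <= z -> 1 - z <= expR (- z) <= 1 - z + z ^+ 2.
Proof.
move=> z0; apply/andP; split; first exact: expR_ge1Dx.
rewrite expRN; have h : 1 + z <= expR z := expR_ge1Dx z.
have z1 : 0 < 1 + z by lra.
apply: (@le_trans _ _ (1 + z)^-1); first by rewrite lef_pV2 ?posrE ?expR_gt0.
rewrite -[leLHS]div1r ler_pdivrMr//; nra.
Qed.

(* With chf2 mu = (chf2 nu) ^ N, the second difference bound for nu, multiplied
   by N, passes to the limit since N (1 - chf2 nu) --> - ln (chf2 mu). *)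
Lemma lchf_second_difference mu s t : idm mu ->
  `|lchf mu (t + s) + lchf mu (t - s) - 2 * lchf mu t| <= - 2 * lchf mu s.
Proof.
move=> h; pose y u := - lchf mu u; have y0 u : 0 <= y u by rewrite oppr_ge0 lchf_le0.
(* N (1 - exp(- y / N)) differs from y by at most y^2 / N. Multiplied by N, these errors stay
   bounded, and [C] collects them. *)
pose C := y (t + s) ^+ 2 + y (t - s) ^+ 2 + 2 * y t ^+ 2.
have C0 : 0 <= C by rewrite !addr_ge0// ?mulr_ge0// sqr_ge0.
apply: (@le_of_natmul _ _ _ C); case=> [|n].
  by rewrite !mul0r add0r.
have [nu nuP] := chf2_root n h; set N : R := n.+1%:R.
have N0 : 0 < N by rewrite ltr0n.
have x0 u : 0 < chf2 nu u.
  have := idm_chf2_gt0 u h; rewrite nuP; have := chf2_ge0 nu u.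
  by rewrite le_eqVlt => /predU1P[<-|//]; rewrite expr0n ltxx.
have xE u : chf2 nu u = expR (- (y u / N)).
  rewrite -[LHS]lnK ?posrE//; congr expR.
  rewrite /y /lchf nuP lnXn// -[in RHS]mulr_natr -/N mulNr opprK mulfK//.
  by rewrite gt_eqF.
have D u : y u - y u ^+ 2 / N <= N * (1 - chf2 nu u) <= y u.
  have z0 : 0 <= y u / N by rewrite divr_ge0// ltW.
  have := exp_lin z0; rewrite -xE; set x := chf2 nu u => /andP[h1 h2].
  have e1 : N * (y u / N) = y u by rewrite mulrC divfK// gt_eqF.
  have e2 : N * (y u / N) ^+ 2 = y u ^+ 2 / N by field; rewrite gt_eqF.
  have g (z w : R) : 1 - z <= w -> w <= 1 - z + z ^+ 2 -> z - z ^+ 2 <= 1 - w /\ 1 - w <= z.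
    by move=> *; split; lra.
  have [g1 g2] := g _ _ h1 h2; rewrite -(ler_pM2l N0) in g1; rewrite -(ler_pM2l N0) in g2.
  by rewrite mulrBr e1 e2 in g1; rewrite e1 in g2; rewrite g1.
have cN : (y (t + s) ^+ 2 / N + y (t - s) ^+ 2 / N + 2 * (y t ^+ 2 / N)) * N = C.
  by rewrite /C; field; rewrite gt_eqF.
have q0 u : 0 <= y u ^+ 2 / N by rewrite divr_ge0// ?sqr_ge0// ltW.
have lE u : lchf mu u = - y u by rewrite opprK.
have := chf2_second_difference nu s t.
have /andP[] := D (t + s); have /andP[] := D (t - s); have /andP[] := D t; have /andP[] := D s.
have := q0 (t + s); have := q0 (t - s); have := q0 t.
rewrite !lE -cN {cN D q0 lE C0 C xE nuP}.
move: (chf2 nu (t + s)) (chf2 nu (t - s)) (chf2 nu t) (chf2 nu s) => xp xm x z.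
move: (y (t + s)) (y (t - s)) (y t) (y s) (_ / N) (_ / N) (_ / N) (_ / N).
move=> yp ym yt ys qs qp qm q q0 qm0 qp0 Ds1 Ds2 Dt1 Dt2 Dm1 Dm2 Dp1 Dp2.
rewrite ler_norml => /andP[h1 h2].
have h3 : N * (xp + xm - 2 * x) <= N * (2 * (1 - z)) by rewrite ler_pM2l.
have h4 : N * - (2 * (1 - z)) <= N * (xp + xm - 2 * x) by rewrite ler_pM2l.
have h5 : `|- yp - ym - 2 * - yt| <= 2 * ys + (qp + qm + 2 * q).
  by rewrite ler_norml; apply/andP; split; lra.
have -> : N * (- 2 * - ys) + (qp + qm + 2 * q) * N = N * (2 * ys + (qp + qm + 2 * q)) by ring.
by rewrite ler_pM2l.
Qed.

(* If f = g1 / g2 with g1 and g2 infinitely divisible then the second difference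
   of ln |f|^2 with step s is bounded, uniformly in t. *)
Lemma quotient_lchf mu m1 m2 : idm m1 -> idm m2 -> eqm m1 (conv mu m2) ->
  (forall t, 0 < chf2 mu t) /\
  forall s t, 2 * lchf mu t + 2 * (lchf m1 s + lchf m2 s) <= lchf mu (t - s).
Proof.
move=> h1 h2 e.
have cE t : chf2 m1 t = chf2 mu t * chf2 m2 t by rewrite (eqm_chf2 t e) chf2_conv.
have c0 t : 0 < chf2 mu t.
  have := idm_chf2_gt0 t h1; rewrite cE; have := chf2_ge0 mu t.
  by rewrite le_eqVlt => /predU1P[<-|//]; rewrite mul0r ltxx.
split=> // s t.
have lE u : lchf m1 u = lchf mu u + lchf m2 u.
  by rewrite /lchf cE lnM ?posrE//; exact: idm_chf2_gt0.
have := lchf_second_difference s t h1; have := lchf_second_difference s t h2.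
rewrite !ler_norml => /andP[_ a2] /andP[a1 _].
(* Subtracting the two second differences bounds that of [lchf mu] from below; dropping the
   nonpositive value at t + s leaves a bound at t - s. *)
have := lchf_le0 mu (t + s); rewrite !lE in a1 *; lra.
Qed.

End infinitely_divisible_charfun.

(** * Rational span and generic vectors *)

Section rational_span.
Variables (R : realType) (d : nat) (x : nat -> 'rV[R]_d).
Local Notation W := 'rV[R]_d.

(* Rational combinations are encoded by polynomials, 'X^k standing for x k. *)
Definition comb (p : {poly rat}) : W := \sum_(i < size p) ratr p`_i *: x i.

Lemma combE n (p : {poly rat}) : (size p <= n)%N -> comb p = \sum_(i < n) ratr p`_i *: x i.
Proof.
move=> pn; rewrite /comb (big_ord_widen n (fun i => ratr p`_i *: x i) pn) big_mkcond /=.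
apply: eq_bigr => i _; case: ltnP => // ip.
by rewrite (nth_default 0 ip) rmorph0 scale0r.
Qed.

Lemma combB p q : comb (p - q) = comb p - comb q.
Proof.
pose n := maxn (size (p - q)%R) (maxn (size p) (size q)).
rewrite !(@combE n) ?leq_max ?leqnn ?orbT// -sumrB.
by apply: eq_bigr => i _; rewrite coefB rmorphB scalerBl.
Qed.

Lemma combZ (r : rat) p : comb (r *: p) = ratr r *: comb p.
Proof.
rewrite (@combE (size p)) ?size_scale_leq// /comb scaler_sumr.
by apply: eq_bigr => i _; rewrite coefZ rmorphM scalerA.
Qed.

Lemma comb_mono k : comb 'X^k = x k.
Proof.
rewrite /comb size_polyXn (bigD1 ord_max)//= coefXn eqxx rmorph1 scale1r big1 ?addr0// => i ik.
by rewrite coefXn (negbTE (ik : nat_of_ord i != k)) rmorph0 scale0r.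
Qed.

Definition span_pred : {pred W} := fun v => `[< exists p, comb p = v >].

Lemma span_zmod_closed : zmod_closed span_pred.
Proof.
split=> [|_ _ /asboolP[p <-] /asboolP[q <-]]; apply/asboolP.
  by exists 0; rewrite /comb size_poly0 big_ord0.
by exists (p - q); exact: combB.
Qed.

HB.instance Definition _ := GRing.isZmodClosed.Build W span_pred span_zmod_closed.

Record qspan := QSpan { qval :> W; _ : qval \in span_pred }.

HB.instance Definition _ := [isSub for qval].
HB.instance Definition _ := [Choice of qspan by <:].
HB.instance Definition _ := [SubChoice_isSubZmodule of qspan by <:].

Definition mkspan p : qspan := QSpan (asboolT (ex_intro _ p erefl) : comb p \in span_pred).

Lemma mkspanE p : qval (mkspan p) = comb p. Proof. by []. Qed.

Lemma qspanP (v : qspan) : exists p, v = mkspan p.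
Proof. by case: v => v pv; have /asboolP[p pE] := pv; exists p; apply: val_inj. Qed.

Lemma qvalD : {morph qval : u v / u + v}. Proof. by []. Qed.
Lemma qvalMn u n : qval (u *+ n) = qval u *+ n.
Proof. by elim: n => [|n IH]; rewrite ?mulr0n// !mulrS qvalD IH. Qed.

Lemma qval_inj : injective qval. Proof. exact: val_inj. Qed.

Lemma qspan_div (v : qspan) n : exists u : qspan, u *+ n.+1 = v.
Proof.
have [p ->] := qspanP v; exists (mkspan (n.+1%:R^-1 *: p)).
apply: qval_inj; rewrite qvalMn /= combZ -scaler_nat scalerA.
by rewrite fmorphV /= rmorph_nat mulfV ?scale1r// pnatr_eq0.
Qed.

Hypothesis x_inj : injective x.

(** Countable as an image of [{poly rat}], infinite because it contains the distinct points
    [x k]. *)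
Lemma qspan_enum : exists e : nat -> qspan, bijective e.
Proof.
have cnt : countable [set: qspan].
  have -> : [set: qspan] = mkspan @` [set: {poly rat}].
    by apply/seteqP; split=> // v _; have [p ->] := qspanP v; exists p.
  apply: sub_countable (card_image_le _ _) _; exact: countableP.
have inf : infinite_set [set: qspan].
  move=> fin; apply: infinite_nat.
  rewrite -(preimage_setT (fun k => mkspan 'X^k)); apply: finite_preimage => // i j _ _.
  by move=> /(congr1 qval); rewrite !mkspanE !comb_mono => /x_inj.
have /pcard_eqP/unsquash g := eq_card_nat cnt inf.
have : bijective g by rewrite -setTT_bijective; exact: bij.
by move=> [e ge eg]; exists e; exists g.
Qed.

End rational_span.

(** * Generic scales and directions, avoiding countably many bad values *)

Section generic_directions.
Context {R : realType}.

Lemma countable_avoid (A : set R) (d : R) : countable A -> 0 < d ->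
  exists2 r, 0 < r < d & ~ A r.
Proof.
move=> cA d0; apply: contrapT => h.
have sub : `]0, d[ `<=` A.
  move=> r; rewrite /= in_itv /= => rd; apply: contrapT => Ar; apply: h; by exists r.
have : lebesgue_measure `]0, d[%classic = 0%E.
  apply: countable_lebesgue_measure0; apply: sub_countable cA; exact: subset_card_le.
rewrite lebesgue_measure_itv /= lte_fin d0 sube0 => -[d00].
by rewrite d00 ltxx in d0.
Qed.

Lemma cis_eq1 (w : R) : 0 < w < 1 -> cis w != 1.
Proof.
move=> /andP[w0 w1]; apply/eqP => /(congr1 (@complex.Re R)) /= c1.
have pi2 := @pi_ge2 R.
have : cos w < cos 0.
  by rewrite ltr_cos ?in_itv //=; apply/andP; split; lra.
by rewrite c1 cos0 ltxx.
Qed.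

Lemma cis_neq1 (w : R) : w != 0 -> `|w| < 1 -> cis w != 1.
Proof.
move=> w0; have [w1|w1] := leP 0 w => h.
  by apply: cis_eq1; rewrite lt_def w0 w1 -(ger0_norm w1).
have : cis (- w) != 1 by apply: cis_eq1; rewrite oppr_gt0 w1 -(ltr0_norm w1).
apply: contra => /eqP e; have := cisNK w; rewrite e mulr1 => ->.
exact: eqxx.
Qed.

(** By [cis_neq1] two distinct solutions have r u and s u at distance at least 1, so the floor of r
    u tells them apart. *)
Lemma countable_cis1 (u : R) : u != 0 -> countable [set r | cis (r * u) = 1].
Proof.
move=> u0; apply/countable_injP.
exists (fun r => pickle (Num.floor (r * u))) => r s; rewrite !inE /= => r1 s1.
move=> /(pcan_inj pickleK) fl; apply/eqP; rewrite -subr_eq0; apply/negP => /negP rs.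
have rs0 : (r - s) * u != 0 by rewrite mulf_neq0.
have : `|(r - s) * u| < 1.
  have := floor_itv (r * u); have := floor_itv (s * u).
  rewrite fl intrD => /andP[a1 a2] /andP[b1 b2].
  rewrite ltr_norml mulrBl; apply/andP; split; lra.
move=> /(cis_neq1 rs0); rewrite mulrBl cisD r1 mul1r => /eqP; apply.
by have := cisNK (s * u); rewrite s1 mulr1.
Qed.

(** Scaling moves the nonzero values of [a] off the multiples of 2 pi; the bound [d] allows a scale
    as small as desired. *)
Lemma generic_scale (V : zmodType) (e : nat -> V) (a : V -> R) (d : R) : bijective e ->
  (forall v, v != 0 -> a v != 0) -> 0 < d ->
  exists2 r, 0 < r < d & forall v, v != 0 -> cis (r * a v) != 1.
Proof.
move=> [e' _ e'K] a0 d0.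
pose A := \bigcup_(n in [set n | e n != 0]) [set r | cis (r * a (e n)) = 1].
have cA : countable A.
  by apply: bigcup_countable => // n en; apply: countable_cis1; exact: a0.
have [r rd Ar] := countable_avoid cA d0; exists r => // v v0.
by apply/eqP => h; apply: Ar; exists (e' v); rewrite /= e'K.
Qed.

(** Take [c] on the moment curve (1, s, ..., s^(d-1)). The scalar product with a nonzero vector is a
    nonzero polynomial in s, so each vector excludes finitely many s. *)
Lemma generic_vector (d : nat) (V : Type) (e : nat -> V) (f : V -> 'rV[R]_d) : bijective e ->
  exists c : 'rV[R]_d, forall v, f v != 0 -> \sum_(i < d) c ord0 i * f v ord0 i != 0.
Proof.
move=> [e' _ e'K].
pose P v : {poly R} := \poly_(i < d) (if insub i is Some j then f v ord0 j else 0).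
pose c (s : R) : 'rV[R]_d := \row_i s ^+ i.
have PE v s : (P v).[s] = \sum_(i < d) c s ord0 i * f v ord0 i.
  rewrite horner_poly; apply: eq_bigr => i _; rewrite mxE mulrC.
  by rewrite valK.
have P0 v : f v != 0 -> P v != 0.
  apply: contra => /eqP Pv; apply/eqP/rowP => i; rewrite mxE.
  by have := congr1 (fun p : {poly R} => p`_i) Pv; rewrite coef_poly ltn_ord valK coef0.
pose A := \bigcup_(n in [set n | f (e n) != 0]) [set s | root (P (e n)) s].
have cA : countable A.
  apply: bigcup_countable => // n en; apply: finite_set_countable.
  apply: contrapT => /(infinite_set_fset (size (P (e n)))) [B sB].
  have rB : all (root (P (e n))) (finmap.enum_fset B) by apply/allP => y /sB.
  have := max_poly_roots (P0 _ en) rB (finmap.fset_uniq B).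
  by rewrite ltnNge => /negP.
have [s _ As] := countable_avoid cA (@ltr01 R).
exists (c s) => v v0; rewrite -PE; apply/negP => h; apply: As.
by exists (e' v); rewrite /= e'K.
Qed.

End generic_directions.

(** * Transfer from a generic projection *)

Section normalized_exponential.
Context {R : realType} {V : zmodType}.
Implicit Types a b : l1 R V.

Lemma aug_lexp_neq0 a : aug (lexp a) != 0.
Proof.
apply/eqP => h; have := congr1 aug (lexpNK a); rewrite augM h mulr0 aug1.
by move/eqP; rewrite eq_sym oner_eq0.
Qed.

(** For nonnegative [a], the atoms of the compound Poisson law with jump measure [a]. *)
Definition nexp a : l1 R V := delta 0 (aug (lexp a))^-1 * lexp a.

Lemma aug_nexp a : aug (nexp a) = 1.
Proof. by rewrite augM aug_delta mulVf ?aug_lexp_neq0. Qed.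

Lemma nexpD a b : nexp (a + b) = nexp a * nexp b.
Proof.
rewrite /nexp lexpD augM invfM mulrACA; congr (_ * _).
by rewrite deltaM addr0.
Qed.

Lemma nexpMn a n : nexp (a *+ n.+1) = nexp a ^+ n.+1.
Proof. by elim: n => [|n IH]; rewrite ?mulr1n ?expr1// mulrS nexpD IH -exprS. Qed.

Lemma nexp_ge0 a : (forall x, 0 <= a x) -> forall x, 0 <= nexp a x.
Proof.
move=> a0 x; rewrite delta_conv_rew mulr_ge0 ?invr_ge0//; last exact: lexp_ge0.
by apply: csum_ge0; exact: lexp_ge0.
Qed.

Lemma delta1X g n : (delta g 1 : l1 R V) ^+ n = delta (g *+ n) 1.
Proof. by elim: n => [|n IH] //; rewrite exprS IH deltaM mulr1 -mulrS. Qed.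

Lemma l1_divn a n : exists b, b *+ n.+1 = a /\ ((forall x, 0 <= a x) -> forall x, 0 <= b x).
Proof.
exists (delta 0 (n.+1%:R^-1) * a); split; last first.
  by move=> a0 x; rewrite delta_conv_rew mulr_ge0 ?invr_ge0 ?ler0n.
have E b k x : (b *+ k : l1 R V) x = b x *+ k by elim: k => [|k IH] //; rewrite !mulrS l1D IH.
apply: l1P => x; rewrite E delta_conv_rew subr0 -mulrnAl -mulr_natr mulVf ?mul1r//.
Qed.

Lemma l1_real_split a : l1conj a = a ->
  exists b c : l1 R V, [/\ (forall x, 0 <= b x), (forall x, 0 <= c x) & a = b - c].
Proof.
move=> ar; pose f x := complex.Re (a x).
have fs : rsummable f := csummable_Re (csummable_l1 a).
have sb : csummable (fun x => (rpos f x)%:C).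
  by apply: rsummableW fs _ => x; rewrite nm_real normr_id; exact: rpos_le.
have sc : csummable (fun x => (rneg f x)%:C).
  by apply: rsummableW fs _ => x; rewrite nm_real normr_id; exact: rneg_le.
exists (mk_l1 sb), (mk_l1 sc); split=> [x|x|].
- by rewrite /= ler0c rpos_ge0.
- by rewrite /= ler0c rneg_ge0.
apply: l1P => x; rewrite l1B /= -rmorphB /=.
have := congr1 (fun h : V -> R => h x) (rposneg f) => /= <-.
have := congr1 (fun h : l1 R V => h x) ar; rewrite l1conjE /f.
case: (a x) => u v /= [] /eqP; rewrite -subr_eq0 -opprD oppr_eq0 -mulr2n mulrn_eq0 /=.
by move/eqP => ->.
Qed.

End normalized_exponential.

Section concentrated_roots.
Context {R : realType} {m : nat} {V : zmodType}.
Local Notation W := 'rV[R]_m.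
Variables (io : V -> W) (e : nat -> V).
Hypothesis ioD : {morph io : x y / x + y}.
Hypothesis io_inj : injective io.
Hypothesis e_bij : bijective e.
Implicit Types mu nu : probability W R.

Lemma atoms_convn mu n : conc io mu ->
  conc io (convn mu n) /\ atoms io_inj e_bij (convn mu n) = atoms io_inj e_bij mu ^+ n.+1.
Proof.
move=> cmu; elim: n => [|n [IH1 IH2]]; first by rewrite expr1.
rewrite -[convn mu n.+1]/(conv mu (convn mu n)); split.
  exact: (conc_conv ioD io_inj e_bij).
by rewrite (atoms_conv ioD io_inj e_bij)// IH2 -exprS.
Qed.

Lemma idm_atoms mu : conc io mu ->
  (forall n, exists q : l1 R V, [/\ forall v, 0 <= q v, aug q = 1 &
     q ^+ n.+1 = atoms io_inj e_bij mu]) -> idm mu.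
Proof.
move=> cmu h n; have [q [q0 q1 qX]] := h n.
have [nu [cnu nuE]] := atoms_surj io_inj e_bij q0 q1.
exists nu; have [c1 E1] := atoms_convn n cnu.
apply: (atoms_eqm (io_inj := io_inj) (e_bij := e_bij) cmu c1).
by rewrite E1 nuE qX.
Qed.

Hypothesis V_div : forall (v : V) n, exists u, u *+ n.+1 = v.

(** With lam = b - b' and b, b' nonnegative, convolving mu with the law of [nexp b'] gives the law
    of [nexp b] shifted by [g]. Both have roots of every order: divide b and b' by n + 1, and [g] by
    [V_div]. *)
Lemma qidm_exponential mu lam g c : conc io mu -> l1conj lam = lam ->
  atoms io_inj e_bij mu = delta g c * lexp lam -> qidm mu.
Proof.
move=> cmu lamr muE.
have [b [b' [b0 b'0 lamE]]] := l1_real_split lamr.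
have muN : atoms io_inj e_bij mu = delta g 1 * nexp lam.
  rewrite muE /nexp mulrA deltaM addr0 mul1r; congr (delta g _ * _).
  (* Total mass 1 forces [c] to be the normalizing factor of [nexp lam]. *)
  apply: (mulIf (aug_lexp_neq0 lam)); rewrite mulVf ?aug_lexp_neq0//.
  by rewrite -(aug_atoms io_inj e_bij cmu) muE augM aug_delta.
have d0 (h : V) v : 0 <= (delta h 1 : l1 R V) v by rewrite deltaE; case: eqP.
have [m2 [cm2 m2E]] := atoms_surj io_inj e_bij (nexp_ge0 b'0) (aug_nexp b').
have [m1 [cm1 m1E]] := atoms_surj io_inj e_bij (l1M_ge0 (d0 g) (nexp_ge0 b0))
  ltac:(by rewrite augM aug_delta mul1r aug_nexp).
exists m1, m2; split.
- apply: idm_atoms => // n; have [h hE] := V_div g n; have [q [qE q0]] := l1_divn b n.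
  exists (delta h 1 * nexp q); split.
  + by apply: l1M_ge0; [exact: d0|exact: nexp_ge0 (q0 b0)].
  + by rewrite augM aug_delta mul1r aug_nexp.
  + by rewrite exprMn delta1X hE -nexpMn qE m1E.
- apply: idm_atoms => // n; have [q [qE q0]] := l1_divn b' n.
  exists (nexp q); split; [exact: nexp_ge0 (q0 b'0)|exact: aug_nexp|].
  by rewrite -nexpMn qE m2E.
have cc := conc_conv ioD io_inj e_bij cmu cm2.
apply: (atoms_eqm (io_inj := io_inj) (e_bij := e_bij) cm1 cc).
rewrite (atoms_conv ioD io_inj e_bij)// m1E m2E muN -mulrA -nexpD lamE.
by rewrite subrK.
Qed.

End concentrated_roots.

Section transforms_of_projections.
Context {R : realType} {m : nat} {V : zmodType}.
Local Notation W := 'rV[R]_m.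
Variables (io : V -> W) (e : nat -> V).
Hypothesis ioD : {morph io : x y / x + y}.
Hypothesis io_inj : injective io.
Hypothesis e_bij : bijective e.
Implicit Types mu nu : probability W R.

Lemma Ex_conc mu (g : W -> R) : conc io mu -> bm g ->
  Ex mu g = rsum (fun v => g (io v) * atom io mu v).
Proof.
move=> cmu bg; have [mg [B gB]] := bg.
have [sa a1] := rsummable_atom io_inj e_bij mu; have {}a1 := a1 cmu.
have B0 : 0 <= B by apply: le_trans (gB 0); exact: normr_ge0.
(* Adding the bound [B] makes the integrand nonnegative, as [integral_conc] requires; its
   contribution is removed at the end. *)
have gB0 x : 0 <= B + g x by have := gB x; rewrite ler_norml => /andP[]; lra.
have bB : bm (fun x => B + g x) by apply: bmD => //; exact: bm_cst.
have sg : rsummable (fun v => g (io v) * atom io mu v).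
  apply: (rsummableW (rsummableZ B sa)) => v.
  by rewrite !normrM ler_wpM2r// (ger0_norm B0).
have p0 v : 0 <= (B + g (io v)) * atom io mu v by rewrite mulr_ge0// atom_ge0.
have E : Ex mu (fun x => B + g x) = rsum (fun v => (B + g (io v)) * atom io mu v).
  apply: EFin_inj; rewrite (EFin_Ex mu bB) (integral_conc io_inj e_bij cmu)//.
  - rewrite rsum_ge0E//; first by apply: eq_esum => v _; rewrite EFinM atomE.
    rewrite (_ : (fun v => _) = (fun v => B * atom io mu v + g (io v) * atom io mu v)).
      by apply: rsummableD => //; exact: rsummableZ.
    by apply/funext => v; rewrite mulrDl.
  - by apply/measurable_EFinP; case: bB.
have := E; rewrite ExD//; last exact: bm_cst.
rewrite Ex_cst (_ : (fun v => _) = (fun v => B * atom io mu v + g (io v) * atom io mu v)).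
  by rewrite rsumD//; [rewrite rsumZ// a1 mulr1 => /addrI|exact: rsummableZ].
by apply/funext => v; rewrite mulrDl.
Qed.

Lemma chf2_push mu (f : W -> 'rV[R]_1) (mf : measurable_fun [set: W] f) t : conc io mu ->
  let z := ft (fun v => crd (f (io v))) t (atoms io_inj e_bij mu) in
  chf2 (push mf mu) t = complex.Re z ^+ 2 + complex.Im z ^+ 2.
Proof.
move=> cmu; rewrite /chf2 /cc /sc /push (Ex_dist _ _ (bm_cos t)) (Ex_dist _ _ (bm_sin t)).
have -> : \int[mu]_x cos (t * crd (mfun_of mf x)) = Ex mu (fun x => cos (t * crd (f x))) by [].
have -> : \int[mu]_x sin (t * crd (mfun_of mf x)) = Ex mu (fun x => sin (t * crd (f x))) by [].
rewrite (Ex_conc cmu (bm_comp mf (bm_cos t))) (Ex_conc cmu (bm_comp mf (bm_sin t))).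
congr (_ ^+ 2 + _ ^+ 2); rewrite /= ; congr rsum; apply/funext => v /=.
  by rewrite mulr0 subr0.
by rewrite mulr0 add0r.
Qed.

End transforms_of_projections.

Section quotient_bounded_below.
Context {R : realType} {V : zmodType} (a : V -> R).
Hypothesis aD : {morph a : x y / x + y}.

Lemma qidm_chf2_bounded_below (mu : probability 'rV[R]_1 R) (F : l1 R V) : aug F = 1 ->
  (forall t, chf2 mu t = complex.Re (ft a t F) ^+ 2 + complex.Im (ft a t F) ^+ 2) ->
  qidm mu -> exists2 d, 0 < d & forall t, d <= chf2 mu t.
Proof.
move=> F1 muF [m1 [m2 [h1 h2 em]]].
have [pos hK] := quotient_lchf h1 h2 em.
(* The precision 1/4 is doubled by a twist; the transform then stays within 1/2 of its value 1 at
   time 0. *)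
have [ts tsP] := @tw_totally_bounded _ _ a F (1 / 4) setT ltac:(lra).
pose K s := - (2 * (lchf m1 s + lchf m2 s)).
have K0 s : 0 <= K s by have := lchf_le0 m1 s; have := lchf_le0 m2 s; rewrite /K; lra.
have Kle s : List.In s ts -> K s <= \sum_(s <- ts) K s.
  elim: ts {tsP} => [|s' ts IH] //= [->|/IH h]; rewrite big_cons.
    by rewrite lerDl sumr_ge0.
  by apply: le_trans h _; rewrite lerDr.
exists (expR (2 * ln (1 / 4) - \sum_(s <- ts) K s)); first exact: expR_gt0.
(* A representative of - t, rather than of t, makes T_(t + t') F close to F. *)
move=> t; have [t' t'ts [_ close]] := tsP (- t) I.
have Re_ge : 1 / 2 <= complex.Re (ft a (t + t') F).
  have : nm (ft a (t + t') F - 1) <= 1 / 2.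
    rewrite /ft -F1 -augN -augD; apply: le_trans (nm_aug _) _.
    have -> : tw a (t + t') F - F = tw a t (tw a t' F - tw a (- t) F).
      by rewrite twB !tw_tw subrr tw0.
    apply: le_trans (tw_norm _ _ _) _; rewrite l1normBC; lra.
  move/(le_trans (Re_le_nm _)); rewrite ler_norml; case: (ft _ _ _) => u v /= /andP[]; lra.
have c4 : 1 / 4 <= chf2 mu (t + t').
  rewrite muF; apply: (@le_trans _ _ ((1 / 2) ^+ 2)); first by lra.
  rewrite -[leLHS]addr0 lerD ?sqr_ge0// lerXn2r ?nnegrE//; lra.
(* A step t' back from t + t', where the modulus is large, lands on t; the cost K t' takes finitely
   many values. *)
have := hK t' (t + t'); rewrite addrK; have := Kle _ t'ts => k1 k2.
have k3 : ln (1 / 4) <= lchf mu (t + t') by rewrite ler_ln ?posrE ?pos//; lra.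
rewrite -[leRHS](@lnK R) ?posrE ?pos// ler_expR.
change (2 * ln (1 / 4) - \sum_(s <- ts) K s <= lchf mu t).
move: k1; rewrite {1}/K; lra.
Qed.

End quotient_bounded_below.

Section transfer_quotients.
Context {R : realType} {m : nat} {V : zmodType}.
Local Notation W := 'rV[R]_m.
Variables (io : V -> W) (e : nat -> V).
Hypothesis ioD : {morph io : x y / x + y}.
Hypothesis io_inj : injective io.
Hypothesis e_bij : bijective e.
Hypothesis V_div : forall (v : V) n, exists u, u *+ n.+1 = v.

Lemma ft_scale (r t : R) (a : V -> R) (F : l1 R V) : ft (fun v => r * a v) t F = ft a (t * r) F.
Proof. by rewrite /ft; congr aug; apply: l1P => v; rewrite !twE mulrA. Qed.

Lemma qidm_push_inj (mu : probability W R) (f : W -> 'rV[R]_1) (mf : measurable_fun [set: W] f) :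
  conc io mu -> {morph f : x y / x + y} -> (forall v, v != 0 -> crd (f (io v)) != 0) ->
  qidm (push mf mu) -> qidm mu.
Proof.
move=> cmu fD f0 q; set F := atoms io_inj e_bij mu.
pose a v := crd (f (io v)).
have aD : {morph a : x y / x + y} by move=> x y; rewrite /a ioD fD /crd mxE.
have rD r : {morph (fun v => r * a v) : x y / x + y} by move=> x y; rewrite aD mulrDr.
have F1 : aug F = 1 := aug_atoms io_inj e_bij cmu.
have [d d0 dle] := qidm_chf2_bounded_below F1 (fun t => chf2_push io_inj e_bij mf t cmu) q.
(* First scale: any one at which the integer times separate the points of [V], for Wiener's
   lemma. *)
have [r1 _ r1P] := generic_scale e_bij f0 (@ltr01 R).
have [n|G FG] := @wiener _ _ _ (rD r1) r1P F d d0.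
  rewrite ft_scale; have := dle (n%:R * r1); by rewrite (chf2_push io_inj e_bij).
(* Second scale: with [G] known, it must also be small enough for one unit of time to move [F] by at
   most 1/32 relative to [G]. *)
have [|dl dl0 dlP] := @tw_continuous _ _ a F ((1 / 32) / (l1norm G + 1)).
  by rewrite divr_gt0 ?ltr_wpDl ?l1norm_ge0//; lra.
have [r /andP[r0 rdl] rP] := generic_scale e_bij f0 dl0.
have [||lam [g [c [lamr FE]]]] := @exponential_form _ _ _ (rD r) rP F G FG.
- have -> : tw (fun v => r * a v) 1 F = tw a r F.
    by apply: l1P => v; rewrite !twE mul1r.
  have G0 := l1norm_ge0 G.
  have := dlP r; rewrite gtr0_norm// => /(_ (ltW rdl)).
  rewrite ler_pdivlMr; last by rewrite ltr_wpDl.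
  apply: le_trans; rewrite ler_wpM2l ?l1norm_ge0//; lra.
- by apply: l1P => v; rewrite l1conjE atomsE conjc_real.
exact: (qidm_exponential ioD V_div cmu lamr FE).
Qed.

End transfer_quotients.

Section additive_images.
Context {R : realType} {m k : nat}.
Variables (f : 'rV[R]_m -> 'rV[R]_k) (mf : measurable_fun [set: 'rV[R]_m] f).
Hypothesis fD : {morph f : x y / x + y}.

Lemma idm_push (mu : probability 'rV[R]_m R) : idm mu -> idm (push mf mu).
Proof.
move=> h n; have [nu e] := h n; exists (push mf nu).
apply: eqm_trans (eqm_push mf e) _.
have [] := @push_convn _ _ _ f mf nu setT n => //; exact: probability_setT.
Qed.

Lemma qidm_push (mu : probability 'rV[R]_m R) : qidm mu -> qidm (push mf mu).
Proof.
move=> [m1 [m2 [h1 h2 e]]]; exists (push mf m1), (push mf m2).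
split; [exact: idm_push|exact: idm_push|].
apply: eqm_trans (eqm_push mf e) _.
apply: (@push_conv _ _ _ f mf mu m2 setT) => //; exact: probability_setT.
Qed.

End additive_images.

(** * Convolution roots of laws carried by a countable divisible subgroup *)

Section convolution_roots.
Context {R : realType} {m : nat}.
Local Notation W := 'rV[R]_m.
Implicit Types mu nu : probability W R.

Lemma prob0_setC nu A : measurable A -> nu (~` A) = 0%E -> nu A = 1%E.
Proof.
move=> mA h; have := probability_setC nu (measurableC mA).
by rewrite setCK h sube0.
Qed.

(** The sum is (n+1) z in particular when all n + 1 summands equal z. *)
Lemma convn_atom nu n (z : W) : (nu [set z] ^+ n.+1 <= convn nu n [set (z *+ n.+1)%R])%E.
Proof.
elim: n => [|n IH]; first by rewrite mulr1n.
rewrite -[convn nu n.+1]/(conv nu (convn nu n)) convE expeS.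
apply: (@le_trans _ _ (\int[convn nu n]_(y in [set (z *+ n.+1)%R]) nu [set z])%E).
  rewrite integral_cst; last exact: measurable_set1_row.
  by rewrite lee_wpmul2l.
have mz : measurable [set z *+ n.+2] by exact: measurable_set1_row.
apply: (@le_trans _ _ (\int[convn nu n]_(y in [set (z *+ n.+1)%R])
    nu [set w | [set (z *+ n.+2)%R] (w + y)%R])%E).
  rewrite le_eqVlt; apply/orP; left; apply/eqP; apply: eq_integral => y.
  rewrite inE /= => ->; congr (nu _); apply/seteqP; split=> w /=.
    by move=> ->; rewrite -mulrS.
  by rewrite [in RHS]mulrS => /addIr.
apply: ge0_subset_integral => //; first exact: measurable_set1_row.
exact: measurable_fun_shift.
Qed.

(** A nonnegative function with zero integral against a probability vanishes at some point [y]. *)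
Lemma conv_null mu nu A : measurable A -> conv mu nu A = 0%E ->
  exists y, mu [set z | A (z + y)] = 0%E.
Proof.
move=> mA; rewrite convE => h; have mg := measurable_fun_shift mu mA.
apply: contrapT => ne.
have : (\int[nu]_y `|mu [set z | A (z + y)%R]| = 0)%E.
  by rewrite -[RHS]h; apply: eq_integral => y _; rewrite gee0_abs.
move/(ae_eq_integral_abs nu measurableT mg) => [N [mN N0]] sub.
suff : nu setT = 0%E.
  have -> : nu setT = 1%E by exact: probability_setT.
  by move/eqP; rewrite onee_eq0.
apply: (subset_measure0 _ mN) => // y _; apply: sub => /= /(_ I) h0.
by apply: ne; exists y.
Qed.

Variables (V : zmodType) (io : V -> W) (e : nat -> V).
Hypothesis ioD : {morph io : x y / x + y}.
Hypothesis io_inj : injective io.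
Hypothesis e_bij : bijective e.
Hypothesis V_div : forall (v : V) n, exists u, u *+ n.+1 = v.

Lemma ioMn u n : io (u *+ n) = io u *+ n.
Proof. by elim: n => [|n IH]; rewrite ?mulr0n ?io0// !mulrS ioD IH. Qed.

Lemma range_div n w : range io (w *+ n.+1) -> range io w.
Proof.
move=> [v _ vE]; have [u uE] := V_div v n; exists u => //.
have : io u *+ n.+1 = w *+ n.+1 by rewrite -ioMn uE vE.
rewrite -(scaler_nat n.+1 (io u)) -(scaler_nat n.+1 w) => /(scalerI _); apply.
by rewrite pnatr_eq0.
Qed.

(** Countability comes first: some translate of the range carries [nu], so [nu] is determined by its
    atoms. An atom outside the range would, by [range_div], give the power an atom outside the
    range. *)
Lemma conc_convn nu n : conc io (convn nu n) -> conc io nu.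
Proof.
have mS : measurable (range io) := measurable_range_io io e_bij.
case: n => [//|n] cn.
have [y y0] : exists y, nu [set z | (~` range io) (z + y)] = 0%E.
  apply: (@conv_null _ (convn nu n)); first exact: measurableC.
  exact: (prob1_setC mS cn).
pose T0 := [set z | range io (z + y)].
have mT0 : measurable T0 by exact: measurable_shift_set.
have T1 : nu T0 = 1%E.
  by apply: prob0_setC.
suff h0 : nu (~` range io) = 0%E.
  exact: prob0_setC.
have null z : ~ range io z -> nu [set z] = 0%E.
  move=> zS; apply/eqP; rewrite eq_le measure_ge0 andbT leNgt; apply/negP => z0.
  have : (0 < convn nu n.+1 [set (z *+ n.+2)%R])%E.
    by apply: lt_le_trans (convn_atom nu n.+1 z); rewrite expe_gt0.
  rewrite (@subset_measure0 _ _ _ _ _ (~` range io)) ?ltxx//.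
  - exact: measurable_set1_row.
  - exact: measurableC.
  - by move=> w /= ->; move/range_div.
  - exact: (prob1_setC mS cn).
rewrite -(prob1_setI mT0 (measurableC mS) T1).
have [e' _ e'K] := e_bij.
(* What lies in the translate but not in the range is a countable union of null points. *)
have : nu.-negligible (\bigcup_i (~` range io `&` [set io (e i) - y])).
  apply: negligible_bigcup => i; have [h|h] := pselect (range io (io (e i) - y)).
    rewrite (_ : _ `&` _ = set0); first exact: negligible_set0.
    by apply/seteqP; split=> // w [/= w1 w2]; apply: w1; rewrite w2.
  exists [set io (e i) - y]; split; [exact: measurable_set1_row|exact: null|].
  by move=> w [].
move=> [N [mN N0 sub]]; apply: (subset_measure0 _ mN) => //.
  by apply: measurableI => //; exact: measurableC.
move=> w [w1 [v _ vE]]; apply: sub; exists (e' v) => //; split => //=.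
by rewrite e'K vE addrK.
Qed.

End convolution_roots.

Section transfer_roots.
Context {R : realType} {m k : nat} {V : zmodType}.
Variables (io : V -> 'rV[R]_m) (e : nat -> V).
Hypothesis ioD : {morph io : x y / x + y}.
Hypothesis io_inj : injective io.
Hypothesis e_bij : bijective e.
Hypothesis V_div : forall (v : V) n, exists u, u *+ n.+1 = v.

(** The inverse is extended by 0. Measurability is automatic for a map that is constant off a
    countable set. *)
Lemma partial_inverse (j : V -> 'rV[R]_k) : injective j ->
  exists psi, measurable_fun [set: 'rV[R]_k] psi /\ forall v, psi (j v) = io v.
Proof.
move=> j_inj.
have /choice[psi psiP] : forall w, exists z, (forall v, w = j v -> z = io v) /\
    (~ range j w -> z = 0).
  move=> w; have [[v _ <-]|h] := pselect (range j w).
    by exists (io v); split=> [u /j_inj->//|]; case; exists v.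
  exists 0; split=> // v wv; by case: h; exists v.
exists psi; split=> [_ A mA|v]; last exact: (psiP (j v)).1.
have [e' _ e'K] := e_bij.
have cS : countable (range j).
  have -> : range j = \bigcup_n [set j (e n)].
    apply/seteqP; split=> [_ [v _ <-]|w [n _ ->]]; last by exists (e n).
    by exists (e' v) => //=; rewrite e'K.
  by apply: bigcup_countable => // n _; apply: finite_set_countable.
have cm B : B `<=` range j -> measurable B.
  by move=> BS; apply: measurable_countable_row; apply: sub_countable cS; exact: subset_card_le.
rewrite setTI -(setUIDK (psi @^-1` A) (range j)); apply: measurableU; first by apply: cm => w [].
have [A0|A0] := pselect (A 0).
  rewrite (_ : _ `\` _ = ~` range j); first by apply: measurableC; exact: cm.
  by apply/seteqP; split=> w /= => [[]//|wj]; split=> //; rewrite (psiP w).2.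
rewrite (_ : _ `\` _ = set0)//; apply/seteqP; split=> // w /= [wA wj].
by apply: A0; rewrite -((psiP w).2 wj).
Qed.

(** By [conc_convn] a root of the image is carried by the range of [j]. There [psi] is additive and
    inverts the projection, so it sends the root to a root of [mu]. *)
Lemma idm_push_inj (mu : probability 'rV[R]_m R) (f : 'rV[R]_m -> 'rV[R]_k)
  (mf : measurable_fun [set: 'rV[R]_m] f) : conc io mu -> {morph f : x y / x + y} ->
  injective (fun v => f (io v)) -> idm (push mf mu) -> idm mu.
Proof.
move=> cmu fD j_inj h n; have [nu nuE] := h n.
pose j v := f (io v).
have jD : {morph j : x y / x + y} by move=> x y; rewrite /j ioD fD.
have mS : measurable (range io) := measurable_range_io io e_bij.
have mSj : measurable (range j) := measurable_range_io j e_bij.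
have cj : conc j (push mf mu).
  rewrite /conc pushE; apply/eqP; rewrite eq_le; apply/andP; split.
    by apply: probability_le1; have := mf measurableT _ mSj; rewrite setTI.
  rewrite -cmu; apply: le_measure; rewrite ?inE//.
    by have := mf measurableT _ mSj; rewrite setTI.
  by move=> _ [v _ <-]; exists v.
have cnu : conc j nu.
  exact: (conc_convn jD e_bij V_div (eqm_conc e_bij nuE cj)).
have [psi [mpsi psiP]] := partial_inverse j_inj.
exists (push mpsi nu).
apply: (@eqm_trans _ _ _ (push mpsi (push mf mu))).
  move=> A mA; rewrite -[RHS]/(mu (f @^-1` (psi @^-1` A))).
  apply: (prob1_eq mS mA _ cmu) => [|_ [v _ <-] /=].
    have mA' := mpsi measurableT A mA; rewrite setTI in mA'.
    by have := mf measurableT _ mA'; rewrite setTI.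
  by rewrite psiP.
apply: eqm_trans (eqm_push mpsi nuE) _.
have [] := @push_convn _ _ _ psi mpsi nu (range j) n mSj cnu _ _ => //.
  by move=> _ _ [u _ <-] [v _ <-]; exists (u + v) => //; rewrite jD.
by move=> _ _ [u _ <-] [v _ <-]; rewrite -jD !psiP ioD.
Qed.

End transfer_roots.

(** * The scalar product and the conclusion *)

Section scalar_product.
Context {R : realType} {d : nat}.
Implicit Types c x : 'rV[R]_d.

Lemma measurable_dotv c : measurable_fun [set: 'rV[R]_d] (dotv c).
Proof.
apply: measurable_fun_row => i.
rewrite (_ : (fun t => _) = (fun t : 'rV[R]_d => \sum_(i < d) c ord0 i * t ord0 i)).
  apply: measurable_sum => k; apply: measurable_funM => //; exact: measurable_row.
by apply/funext => t; rewrite mxE.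
Qed.

Lemma dotvD c : {morph dotv c : x y / x + y}.
Proof.
move=> x y; apply/rowP => i; rewrite !mxE -big_split /=.
by apply: eq_bigr => k _; rewrite mxE mulrDr.
Qed.

Lemma crd_dotv c x : crd (dotv c x) = \sum_(i < d) c ord0 i * x ord0 i.
Proof. by rewrite /crd mxE. Qed.

End scalar_product.

(** The law built from the weights is visibly carried by the range of [io], and [mu] has the same
    distribution function. *)
Lemma discrete_conc (R : realType) (d : nat) (mu : probability 'rV[R]_d R)
  (V : zmodType) (io : V -> 'rV[R]_d) (e : nat -> V) (x : nat -> 'rV[R]_d) (w : nat -> R) :
  bijective e -> (forall n, range io (x n)) -> (forall n, 0 <= w n) ->
  (\sum_(0 <= n <oo) (w n)%:E = 1)%E ->
  (forall y, df mu y = (\sum_(0 <= n <oo | x n \in orthant y) (w n)%:E)%E) -> conc io mu.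
Proof.
move=> e_bij xio w0 w1 muE; have [nu nuE] := discrete_probability x w0 w1.
have : conc io nu.
  rewrite /conc nuE -[RHS]w1; apply: eq_eseriesr => n _.
  by rewrite diracE mem_set ?mule1.
apply: (eqm_conc e_bij); apply: df_eqm; apply/funext => y.
rewrite muE /df nuE [RHS]eseries_mkcond; apply: eq_eseriesr => n _.
by rewrite diracE; case: ifP => _; rewrite ?mule1 ?mule0.
Qed.

Theorem theorem4 (R : realType) (d : nat) (hd : (0 < d)%N)
    (disp : measure_display) (T : measurableType disp) (P : probability T R)
    (xi : {RV P >-> 'rV[R]_d})
    (x : nat -> 'rV[R]_d) (p : 'rV[R]_d -> R)
    (F : 'rV[R]_d -> \bar R) (Fc : 'rV[R]_d -> 'rV[R]_1 -> \bar R)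
    (x_distinct : injective x)
    (p_ge0 : forall k : nat, 0 <= p (x k))
    (p_sum1 : (\sum_(0 <= k <oo) (p (x k))%:E = 1)%E)
    (F_def : F = df (distribution P xi))
    (F_discrete : forall y : 'rV[R]_d,
      F y = (\sum_(0 <= k <oo | x k \in orthant y) (p (x k))%:E)%E)
    (Fc_def : forall c : 'rV[R]_d,
      Fc c = df (pushforward P (fun t : T => dotv c (xi t)))) :
  (infinitely_divisible F <->
     forall c : 'rV[R]_d, infinitely_divisible (Fc c)) /\
  (quasi_infinitely_divisible F <->
     forall c : 'rV[R]_d, quasi_infinitely_divisible (Fc c)).
Proof.
set mu := distribution P xi.
have FcE c : Fc c = df (push (measurable_dotv c) mu) by rewrite Fc_def.
have [e e_bij] := qspan_enum x_distinct.
have cmu : conc (@qval R d x) mu.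
  apply: (discrete_conc e_bij _ p_ge0 p_sum1); last by rewrite -F_def.
  by move=> n; exists (mkspan x 'X^n) => //; rewrite mkspanE comb_mono.
have ioD := @qvalD R d x; have div := @qspan_div R d x.
have [c c_gen] := generic_vector (@qval R d x) e_bij.
have c0 (v : qspan x) : v != 0 -> crd (dotv c (qval v)) != 0.
  by move=> v0; rewrite crd_dotv; apply: c_gen; apply: contra v0 => /eqP h; apply/eqP/qval_inj.
have c_inj : injective (fun v : qspan x => dotv c (qval v)).
  move=> u v uv; apply/eqP; rewrite -subr_eq0; apply/negP => /negP /c0 /eqP; apply.
  by rewrite (ioB ioD) crd_dotv -[RHS](subrr (crd (dotv c (qval u)))) {2}uv !crd_dotv -sumrB;
    apply: eq_bigr => i _; rewrite !mxE mulrBr.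
split; split.
- rewrite F_def => /idm_df h b; rewrite FcE; apply/idm_df.
  by apply: idm_push => //; exact: dotvD.
- move=> /(_ c); rewrite FcE F_def => /idm_df h; apply/idm_df.
  exact: (idm_push_inj ioD e_bij div cmu (dotvD c) c_inj h).
- rewrite F_def => /qidm_df h b; rewrite FcE; apply/qidm_df.
  by apply: qidm_push => //; exact: dotvD.
move=> /(_ c); rewrite FcE F_def => /qidm_df h; apply/qidm_df.
exact: (qidm_push_inj ioD (@qval_inj R d x) e_bij div cmu (dotvD c) c0 h).
Qed.
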